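(* Let $\mathcal A$, $\mathcal B$ be $C^*$-algebras and ${}_{\mathcal A}\mathcal M_{\mathcal B}$ a bi-Hilbertian bimodule. Then there exists a universal bi-Hilbertian $M(\mathcal A)$-$M(\mathcal B)$-bimodule $M(\mathcal M)$ with a monomorphism $I:{}_{\mathcal A}\mathcal M_{\mathcal B}\to{}_{M(\mathcal A)}M(\mathcal M)_{M(\mathcal B)}$, satisfying the universal property with respect to bi-Hilbertian bimodules containing $\mathcal M$ as an essential ideal; that is, $I$ realizes $\mathcal M$ as an essential ideal of $M(\mathcal M)$, and whenever ${}_{\mathcal A'}\mathcal M'_{\mathcal B'}$ is a bi-Hilbertian bimodule, with $\mathcal A'$, $\mathcal B'$ unital $C^*$-algebras acting unitally on $\mathcal M'$, containing ${}_{\mathcal A}\mathcal M_{\mathcal B}$ as an essential ideal, there exists a monomorphism $I':{}_{\mathcal A'}\mathcal M'_{\mathcal B'}\to{}_{M(\mathcal A)}M(\mathcal M)_{M(\mathcal B)}$ extending $I$.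
   Context: $M(\mathcal A)$ denotes the multiplier algebra of the $C^*$-algebra $\mathcal A$. Let $\mathcal M$ be a Hilbert $\mathcal A$-$\mathcal B$-bimodule, i.e. a right Hilbert $\mathcal B$-module with a left action of $\mathcal A$ by adjointable operators, with $\mathcal B$-valued scalar product $\langle\cdot,\cdot\rangle_{\mathcal B}$, such that the $C^*$-algebra $K(\mathcal M)$ of compact right $\mathcal B$-module operators is contained in $\mathcal A$ (compatibly with the left action). Then $\langle\psi,\psi'\rangle_{\mathcal A}:=\theta_{\psi,\psi'}\in K(\mathcal M)\subseteq\mathcal A$, where $\theta_{\psi,\psi'}\varphi:=\psi\langle\psi',\varphi\rangle_{\mathcal B}$, is an $\mathcal A$-valued scalar product (left $\mathcal A$-linear in the first variable). $\mathcal M$ is a bi-Hilbertian bimodule, written ${}_{\mathcal A}\mathcal M_{\mathcal B}$, if $\|\psi\|^2=\|\theta_{\psi,\psi}\|$ for all $\psi\in\mathcal M$. A morphism of bi-Hilbertian bimodules ${}_{\mathcal A}\mathcal M_{\mathcal B}\to{}_{\mathcal A'}\mathcal M'_{\mathcal B'}$ is a bounded linear map $\phi:\mathcal M\to\mathcal M'$ together with $C^*$-algebra morphisms $\phi_l:\mathcal A\to\mathcal A'$, $\phi_r:\mathcal B\to\mathcal B'$ such that $\phi(a\psi b)=\phi_l(a)\phi(\psi)\phi_r(b)$, $\phi_r(\langle\psi,\psi'\rangle_{\mathcal B})=\langle\phi(\psi),\phi(\psi')\rangle_{\mathcal B'}$, $\phi_l(\langle\psi,\psi'\rangle_{\mathcal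 A})=\langle\phi(\psi),\phi(\psi')\rangle_{\mathcal A'}$; it is a monomorphism if $\phi,\phi_l,\phi_r$ are injective. For $I$, the maps $I_l$, $I_r$ are the canonical inclusions $\mathcal A\subseteq M(\mathcal A)$, $\mathcal B\subseteq M(\mathcal B)$. A bi-Hilbertian bimodule ${}_{\mathcal A}\mathcal M_{\mathcal B}$ is the same thing as a two-object $C^*$-category with objects $\rho,\sigma$ and arrows $(\rho,\rho)=\mathcal B$, $(\sigma,\sigma)=\mathcal A$, $(\rho,\sigma)=\mathcal M$, $(\sigma,\rho)=\mathcal M^*$ (the conjugate bimodule), with compositions given by the products, the bimodule actions, $\psi^*\circ\psi'=\langle\psi,\psi'\rangle_{\mathcal B}$ and $\psi\circ\psi'^*=\langle\psi,\psi'\rangle_{\mathcal A}$. ''$\mathcal M'$ contains $\mathcal M$ as an essential ideal'' means that the two-object $C^*$-category of ${}_{\mathcal A}\mathcal M_{\mathcal B}$ is an essential ideal of that of ${}_{\mathcal A'}\mathcal M'_{\mathcal B'}$. Here an ideal of a $C^*$-category is a $C^*$-subcategory (closed $*$-stable arrow spaces) with the same objects, whose arrows are stable under left and right composition with arbitrary composable arrows; an ideal is essential if for every nonzero ideal there is a pair of objects for which the two arrow spaces intersect nontrivially. *)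

(* Defs.v *)
From HB Require Import structures.
From mathcomp Require Import all_boot all_order all_algebra.
From mathcomp Require Import complex.
From mathcomp Require Import all_classical all_reals topology normedtype.

Set Implicit Arguments.
Unset Strict Implicit.
Unset Printing Implicit Defensive.

Import Order.TTheory GRing.Theory Num.Theory.
Import numFieldNormedType.Exports.

Local Open Scope classical_set_scope.
Local Open Scope ring_scope.

Definition bounded_op (R : realType) (V W : normedModType R[i]) (f : V -> W) :=
  exists k : R[i], forall x, `|f x| <= k * `|x|.

(** C*-algebras over R[i], not necessarily unital. *)

HB.mixin Record isCStarAlgebra (R : realType) A
    of CompleteNormedModule R[i] A := {
  cmul : A -> A -> A;
  star : A -> A;
  cmulA : forall a b c, cmul a (cmul b c) = cmul (cmul a b) c;
  cmulPl : forall (k : R[i]) (a b c : A),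
    cmul (k *: a + b) c = k *: cmul a c + cmul b c;
  cmulPr : forall (k : R[i]) (a b c : A),
    cmul c (k *: a + b) = k *: cmul c a + cmul c b;
  starP : forall (k : R[i]) (a b : A),
    star (k *: a + b) = k^* *: star a + star b;
  starK : forall a, star (star a) = a;
  starM : forall a b, star (cmul a b) = cmul (star b) (star a);
  normM_le : forall a b, `|cmul a b| <= `|a| * `|b|;
  cstar_norm : forall a, `|cmul (star a) a| = `|a| ^+ 2
}.

#[short(type="cstarAlgType")]
HB.structure Definition CStarAlgebra (R : realType) :=
  {A of CompleteNormedModule R[i] A & isCStarAlgebra R A}.

Notation "a ** b" := (cmul a b) (at level 40, left associativity) : ring_scope.

Definition positive (R : realType) (A : cstarAlgType R) (a : A) : Prop :=
  exists b : A, a = star b ** b.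

Definition is_unit (R : realType) (A : cstarAlgType R) (e : A) : Prop :=
  forall a : A, e ** a = a /\ a ** e = a.

Section CStarTheory.
Variables (R : realType) (A : cstarAlgType R).
Implicit Types (a b c : A) (k : R[i]).

Lemma cmulDl a b c : (a + b) ** c = a ** c + b ** c.
Proof. by rewrite -[a in LHS]scale1r cmulPl scale1r. Qed.

Lemma cmul0l c : (0 : A) ** c = 0.
Proof. by apply: (addrI (0 ** c)); rewrite -cmulDl !addr0. Qed.

Lemma cmulZl k a c : (k *: a) ** c = k *: (a ** c).
Proof. by rewrite -[k *: a]addr0 cmulPl cmul0l addr0. Qed.

Lemma cmulDr c a b : c ** (a + b) = c ** a + c ** b.
Proof. by rewrite -[a in LHS]scale1r cmulPr scale1r. Qed.

Lemma cmul0r c : c ** (0 : A) = 0.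
Proof. by apply: (addrI (c ** 0)); rewrite -cmulDr !addr0. Qed.

Lemma cmulZr k c a : c ** (k *: a) = k *: (c ** a).
Proof. by rewrite -[k *: a]addr0 cmulPr cmul0r addr0. Qed.

Lemma cmulBl a b c : (a - b) ** c = a ** c - b ** c.
Proof. by rewrite cmulDl -scaleN1r cmulZl scaleN1r. Qed.

Lemma cmulBr c a b : c ** (a - b) = c ** a - c ** b.
Proof. by rewrite cmulDr -scaleN1r cmulZr scaleN1r. Qed.

Lemma starD a b : star (a + b) = star a + star b.
Proof. by rewrite -[a in LHS]scale1r starP conjC1 scale1r. Qed.

Lemma star0 : star (0 : A) = 0.
Proof. by apply: (addrI (star 0)); rewrite -starD !addr0. Qed.

Lemma starZ k a : star (k *: a) = k^* *: star a.
Proof. by rewrite -[k *: a]addr0 starP star0 addr0. Qed.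

Lemma norm_star_le a : `|a| <= `|star a|.
Proof.
have [->|a0] := eqVneq a 0; first by rewrite normr0.
rewrite -(ler_pM2r (_ : 0 < `|a|)) ?normr_gt0// -expr2 -cstar_norm.
exact: normM_le.
Qed.

Lemma norm_star a : `|star a| = `|a|.
Proof.
by apply/eqP; rewrite eq_le norm_star_le andbT -{2}(starK a) norm_star_le.
Qed.

Lemma norm_le_cmul a (r : R[i]) : 0 <= r ->
  (forall c, `|c ** a| <= r * `|c|) -> `|a| <= r.
Proof.
move=> r0 ar; have [->|a0] := eqVneq a 0; first by rewrite normr0.
rewrite -(ler_pM2r (_ : 0 < `|a|)) ?normr_gt0// -expr2 -cstar_norm.
by rewrite (le_trans (ar _))// norm_star.
Qed.

Lemma norm_le_cmulr a (r : R[i]) : 0 <= r ->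
  (forall c, `|a ** c| <= r * `|c|) -> `|a| <= r.
Proof.
move=> r0 ar; rewrite -norm_star; apply: norm_le_cmul => // c.
by rewrite -norm_star starM starK (le_trans (ar _))// norm_star.
Qed.

Lemma cmul_sep_l a b : (forall c, c ** a = c ** b) -> a = b.
Proof.
move=> h; apply/eqP; rewrite -subr_eq0 -normr_le0.
by apply: norm_le_cmul => // c; rewrite cmulBr h subrr normr0 mul0r.
Qed.

Lemma cmul_sep_r a b : (forall c, a ** c = b ** c) -> a = b.
Proof.
move=> h; apply/eqP; rewrite -subr_eq0 -normr_le0.
by apply: norm_le_cmulr => // c; rewrite cmulBl h subrr normr0 mul0r.
Qed.

End CStarTheory.

(** * Multiplier algebras

   M(A) is the algebra of double centralizers (L, T) of A; the pair (L, T)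
   represents the multiplier m with m a = L a and a m = T a. *)

Section Multiplier.
Variables (R : realType) (A : cstarAlgType R).

Record double_centralizer (L T : A -> A) : Prop := {
  dc_linl : linear L;
  dc_linr : linear T;
  dc_bndl : bounded_op L;
  dc_bndr : bounded_op T;
  dc_l : forall a b, L (a ** b) = L a ** b;
  dc_r : forall a b, T (a ** b) = a ** T b;
  dc_lr : forall a b, T a ** b = a ** L b
}.

Record multiplier := Multiplier {
  lmult : A -> A;
  rmult : A -> A;
  multP : double_centralizer lmult rmult
}.

HB.instance Definition _ := gen_eqMixin multiplier.
HB.instance Definition _ := gen_choiceMixin multiplier.

Implicit Types m n p : multiplier.

Lemma mult_eq m n : lmult m =1 lmult n -> rmult m =1 rmult n -> m = n.
Proof.
case: m n => [L T H] [L' T' H'] /= /funext e /funext f.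
by subst; rewrite (Prop_irrelevance H H').
Qed.

Lemma rmult_cmul m a b : rmult m a ** b = a ** lmult m b.
Proof. exact: dc_lr (multP m) _ _. Qed.

Lemma mult_eql m n : lmult m =1 lmult n -> m = n.
Proof.
move=> e; apply: mult_eq => // a; apply: cmul_sep_r => b.
by rewrite !rmult_cmul e.
Qed.

Lemma bounded_op_pos (V W : normedModType R[i]) (f : V -> W) :
  bounded_op f -> exists2 k : R[i], 0 <= k & forall x, `|f x| <= k * `|x|.
Proof.
move=> [k fk]; have [[x x0]|n0] := pselect (exists x : V, x != 0).
  exists k => //; rewrite -(pmulr_lge0 _ (_ : 0 < `|x|)) ?normr_gt0//.
  exact: le_trans (fk x).
exists 0 => // x; have [->|xn0] := eqVneq x 0; last by case: n0; exists x.
by rewrite (le_trans (fk 0))// normr0 !mulr0.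
Qed.

Lemma scale_dc k m : double_centralizer (fun a => k *: lmult m a)
                                        (fun a => k *: rmult m a).
Proof.
have [ll lr bl br l r e] := multP m; split.
- by move=> x a b; rewrite ll scalerDr !scalerA mulrC.
- by move=> x a b; rewrite lr scalerDr !scalerA mulrC.
- have [x _ xP] := bounded_op_pos bl; exists (`|k| * x) => a.
  by rewrite normrZ -mulrA ler_wpM2l.
- have [x _ xP] := bounded_op_pos br; exists (`|k| * x) => a.
  by rewrite normrZ -mulrA ler_wpM2l.
- by move=> a b; rewrite l cmulZl.
- by move=> a b; rewrite r cmulZr.
- by move=> a b; rewrite cmulZl e cmulZr.
Qed.

Lemma add_dc m n : double_centralizer (fun a => lmult m a + lmult n a)
                                      (fun a => rmult m a + rmult n a).
Proof.
have [ll lr bl br l r e] := multP m; have [ll' lr' bl' br' l' r' e'] := multP n.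
split.
- by move=> x a b; rewrite ll ll' scalerDr addrACA.
- by move=> x a b; rewrite lr lr' scalerDr addrACA.
- have [x _ xP] := bounded_op_pos bl; have [y _ yP] := bounded_op_pos bl'.
  by exists (x + y) => a; rewrite (le_trans (ler_normD _ _))// mulrDl lerD.
- have [x _ xP] := bounded_op_pos br; have [y _ yP] := bounded_op_pos br'.
  by exists (x + y) => a; rewrite (le_trans (ler_normD _ _))// mulrDl lerD.
- by move=> a b; rewrite l l' cmulDl.
- by move=> a b; rewrite r r' cmulDr.
- by move=> a b; rewrite cmulDl e e' cmulDr.
Qed.

Lemma zero_dc : double_centralizer (fun=> 0) (fun=> 0).
Proof.
split => //.
- by move=> k a b; rewrite scaler0 addr0.
- by move=> k a b; rewrite scaler0 addr0.
- by exists 0 => a; rewrite normr0 mul0r.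
- by exists 0 => a; rewrite normr0 mul0r.
- by move=> a b; rewrite cmul0l.
- by move=> a b; rewrite cmul0r.
- by move=> a b; rewrite cmul0l cmul0r.
Qed.

Definition madd m n := Multiplier (add_dc m n).
Definition mscale k m := Multiplier (scale_dc k m).
Definition mzero := Multiplier zero_dc.

Fact maddA : associative madd.
Proof. by move=> m n p; apply: mult_eql => a /=; rewrite addrA. Qed.
Fact maddC : commutative madd.
Proof. by move=> m n; apply: mult_eql => a /=; rewrite addrC. Qed.
Fact madd0 : left_id mzero madd.
Proof. by move=> m; apply: mult_eql => a /=; rewrite add0r. Qed.
Fact maddN : left_inverse mzero (mscale (-1)) madd.
Proof. by move=> m; apply: mult_eql => a /=; rewrite scaleN1r addNr. Qed.

HB.instance Definition _ :=
  GRing.isZmodule.Build multiplier maddA maddC madd0 maddN.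

Fact mscaleA k l m : mscale k (mscale l m) = mscale (k * l) m.
Proof. by apply: mult_eql => a /=; rewrite scalerA. Qed.
Fact mscale1 : left_id 1 mscale.
Proof. by move=> m; apply: mult_eql => a /=; rewrite scale1r. Qed.
Fact mscaleDr : right_distributive mscale +%R.
Proof. by move=> k m n; apply: mult_eql => a /=; rewrite scalerDr. Qed.
Fact mscaleDl m : {morph mscale^~ m : k l / k + l}.
Proof. by move=> k l; apply: mult_eql => a /=; rewrite scalerDl. Qed.

HB.instance Definition _ := GRing.Zmodule_isLmodule.Build R[i] multiplier
  mscaleA mscale1 mscaleDr mscaleDl.

Definition cofR (x : R) : R[i] := Complex x 0.

(* the operator norm of the left action; it takes values in the reals, seen
   inside R[i] *)
Definition mnorm m : R[i] :=
  cofR (sup [set complex.Re `|lmult m a| | a in [set a : A | `|a| <= 1]]).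

Lemma lmult0 m : lmult m 0 = 0.
Proof.
have /(_ 1 0 0) := dc_linl (multP m); rewrite scale1r addr0 scale1r => e.
by apply: (addrI (lmult m 0)); rewrite addr0.
Qed.

Lemma lmultZ m k a : lmult m (k *: a) = k *: lmult m a.
Proof. by rewrite -[k *: a]addr0 (dc_linl (multP m)) lmult0 addr0. Qed.

Let leCR (x y : R) : (cofR x <= cofR y) = (x <= y).
Proof. exact: lecR. Qed.

Let ge0CR (x : R) : (0 <= cofR x) = (0 <= x).
Proof. exact: ler0c. Qed.

Lemma ReE (x : R[i]) : 0 <= x -> cofR (complex.Re x) = x.
Proof. by move=> x0; apply: RRe_real; rewrite realE x0. Qed.

Lemma mnorm_has_sup m :
  has_sup [set complex.Re `|lmult m a| | a in [set a : A | `|a| <= 1]].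
Proof.
split; first by exists (complex.Re `|lmult m 0|); exists 0 => //=; rewrite normr0.
have [k k0 kP] := bounded_op_pos (dc_bndl (multP m)).
exists (complex.Re k) => _ [a /= a1 <-]; rewrite -leCR !ReE//.
by rewrite (le_trans (kP a))// ler_piMr.
Qed.

Lemma mnorm_ge0 m : 0 <= mnorm m.
Proof.
rewrite /mnorm ge0CR; apply: (le_trans _ (ub_le_sup (mnorm_has_sup m).2 _)); last first.
  by exists 0 => /=; [rewrite normr0|reflexivity].
by rewrite -leCR ReE//; exact: normr_ge0.
Qed.

Lemma lmult_le m a : `|lmult m a| <= mnorm m * `|a|.
Proof.
have [->|a0] := eqVneq a 0; first by rewrite lmult0 !normr0 mulr0.
have na : 0 < `|a| by rewrite normr_gt0.
rewrite -ler_pdivrMr// mulrC.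
have -> : `|a|^-1 * `|lmult m a| = `|lmult m (`|a|^-1 *: a)|.
  by rewrite lmultZ normrZ ger0_norm// invr_ge0.
rewrite -[leLHS]ReE// leCR; apply: ub_le_sup; first exact: (mnorm_has_sup m).2.
exists (`|a|^-1 *: a) => //=.
by rewrite normrZ ger0_norm ?invr_ge0// mulVf// gt_eqF.
Qed.

Lemma mnorm_le m (r : R[i]) : 0 <= r ->
  (forall a, `|lmult m a| <= r * `|a|) -> mnorm m <= r.
Proof.
move=> r0 mr; rewrite -(ReE r0) leCR; apply: ge_sup.
  exact: (mnorm_has_sup m).1.
by move=> _ [a /= a1 <-]; rewrite -leCR !ReE// (le_trans (mr a))// ler_piMr.
Qed.

Fact mnormD m n : mnorm (m + n) <= mnorm m + mnorm n.
Proof.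
apply: mnorm_le => [|a]; first by rewrite addr_ge0 ?mnorm_ge0.
by rewrite mulrDl (le_trans (ler_normD _ _))// lerD ?lmult_le.
Qed.

Fact mnormZ_le k m : mnorm (k *: m) <= `|k| * mnorm m.
Proof.
apply: mnorm_le => [|a]; first by rewrite mulr_ge0 ?mnorm_ge0.
by rewrite normrZ -mulrA ler_wpM2l ?lmult_le.
Qed.

Fact mnormZ k m : mnorm (k *: m) = `|k| * mnorm m.
Proof.
have [->|k0] := eqVneq k 0.
  apply/eqP; rewrite eq_le mnormZ_le normr0 mul0r.
  exact: mnorm_ge0.
apply/eqP; rewrite eq_le mnormZ_le -ler_pdivlMl ?normr_gt0//.
by rewrite -normfV -{1}[m](scalerK k0) mnormZ_le.
Qed.

Fact mnorm_eq0 m : mnorm m = 0 -> m = 0.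
Proof.
move=> m0; apply: mult_eql => a; apply/eqP; rewrite -normr_le0.
by rewrite (le_trans (lmult_le m a))// m0 mul0r.
Qed.

HB.instance Definition _ :=
  Lmodule_isNormed.Build R[i] multiplier mnormD mnormZ mnorm_eq0.

Lemma lmult_norm m a : `|lmult m a| <= `|m| * `|a|.
Proof. exact: lmult_le. Qed.

Lemma rmult_le m a : `|rmult m a| <= `|m| * `|a|.
Proof.
apply: norm_le_cmulr => [|c]; first exact: mulr_ge0.
rewrite rmult_cmul (le_trans (normM_le _ _))// mulrC -mulrA (mulrC `|a|).
by rewrite mulrA ler_wpM2r// lmult_norm.
Qed.

Lemma rmult0 m : rmult m 0 = 0.
Proof.
by apply/eqP; rewrite -normr_le0 (le_trans (rmult_le m 0))// normr0 mulr0.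
Qed.

Lemma mul_dc m n : double_centralizer (lmult m \o lmult n) (rmult n \o rmult m).
Proof.
have [ll lr bl br l r e] := multP m; have [ll' lr' bl' br' l' r' e'] := multP n.
split => /=.
- by move=> x a b; rewrite /= ll' ll.
- by move=> x a b; rewrite /= lr lr'.
- exists (`|m| * `|n|) => a /=; rewrite -mulrA (le_trans (lmult_norm _ _))//.
  by rewrite ler_wpM2l// lmult_norm.
- exists (`|n| * `|m|) => a /=; rewrite -mulrA (le_trans (rmult_le _ _))//.
  by rewrite ler_wpM2l// rmult_le.
- by move=> a b; rewrite l' l.
- by move=> a b; rewrite r r'.
- by move=> a b; rewrite e' e.
Qed.

Lemma star_dc m : double_centralizer (star \o rmult m \o star)
                                     (star \o lmult m \o star).
Proof.
have [ll lr bl br l r e] := multP m; split => /=.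
- by move=> x a b; rewrite /= starP lr starP conjCK.
- by move=> x a b; rewrite /= starP ll starP conjCK.
- by exists `|m| => a /=; rewrite norm_star -(norm_star a) rmult_le.
- by exists `|m| => a /=; rewrite norm_star -(norm_star a) lmult_norm.
- by move=> a b; rewrite starM r starM starK.
- by move=> a b; rewrite starM l starM starK.
- by move=> a b; apply: (can_inj (@starK _ A)); rewrite !starM !starK e.
Qed.

Definition mmul m n := Multiplier (mul_dc m n).
Definition mstar m := Multiplier (star_dc m).

Fact mmulA m n p : mmul m (mmul n p) = mmul (mmul m n) p.
Proof. exact: mult_eql. Qed.

Fact mmulPl k m n p : mmul (k *: m + n) p = k *: mmul m p + mmul n p.
Proof. exact: mult_eql. Qed.

Fact mmulPr k m n p : mmul p (k *: m + n) = k *: mmul p m + mmul p n.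
Proof. by apply: mult_eql => a /=; rewrite (dc_linl (multP p)). Qed.

Fact mstarP k m n : mstar (k *: m + n) = k^* *: mstar m + mstar n.
Proof. by apply: mult_eql => a /=; rewrite starP. Qed.

Fact mstarK m : mstar (mstar m) = m.
Proof. by apply: mult_eql => a /=; rewrite !starK. Qed.

Fact mstarM m n : mstar (mmul m n) = mmul (mstar n) (mstar m).
Proof. by apply: mult_eql => a /=; rewrite starK. Qed.

Fact mnormM m n : `|mmul m n| <= `|m| * `|n|.
Proof.
apply: mnorm_le => [|a /=]; first exact: mulr_ge0.
by rewrite -mulrA (le_trans (lmult_norm _ _))// ler_wpM2l// lmult_norm.
Qed.

Lemma mnorm_star m : `|mstar m| = `|m|.
Proof.
have H n : `|mstar n| <= `|n|.
  apply: mnorm_le => // a /=.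
  by rewrite norm_star -(norm_star a) rmult_le.
by apply/eqP; rewrite eq_le H -{1}(mstarK m) H.
Qed.

Fact mcstar m : `|mmul (mstar m) m| = `|m| ^+ 2.
Proof.
apply/eqP; rewrite eq_le (le_trans (mnormM _ _)) ?mnorm_star ?expr2//=.
set r := `|mmul _ _|; rewrite -expr2.
have r0 : 0 <= r by exact: normr_ge0.
rewrite -[leRHS]sqrtCK; apply: lerXn2r; rewrite ?nnegrE ?sqrtC_ge0//.
apply: mnorm_le => [|a]; first by rewrite sqrtC_ge0.
rewrite -(@ler_pXn2r _ 2) ?nnegrE ?mulr_ge0 ?sqrtC_ge0// exprMn sqrtCK.
rewrite -cstar_norm.
have -> : star (lmult m a) ** lmult m a =
          star a ** lmult (mmul (mstar m) m) a.
  by rewrite -(rmult_cmul (mmul (mstar m) m)) /= starK rmult_cmul.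
rewrite (le_trans (normM_le _ _))// norm_star expr2 mulrCA.
by rewrite ler_wpM2l// lmult_norm.
Qed.

Let norm_lim_le (F : set_system multiplier) (f : multiplier -> A) (c l : A)
    (r : R[i]) : ProperFilter F -> 0 <= r ->
  f m @[m --> F] --> l -> (\forall m \near F, `|f m - c| <= r) -> `|l - c| <= r.
Proof.
move=> FF r0 fl fr; rewrite real_leNgt ?ger0_real//; apply/negP => rl.
have /cvgrPdist_lt/(_ (`|l - c| - r)) fe := fl.
have {fe} : \forall m \near F, `|l - f m| < `|l - c| - r by apply: fe; rewrite subr_gt0.
move=> H; have [m [h1 h2]] := filter_ex (filterI H fr).
have : `|l - c| < `|l - c| - r + r.
  rewrite (le_lt_trans (ler_distD (f m) _ _))//.
  by rewrite ltr_leD.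
by rewrite subrK ltxx.
Qed.

Let cmul_cvgl (F : set_system multiplier) (f : multiplier -> A) (l b : A) :
  ProperFilter F -> f m @[m --> F] --> l -> (f m ** b) @[m --> F] --> l ** b.
Proof.
move=> FF fl; apply/cvgrPdist_lt => e e0.
have e'0 : 0 < e / (`|b| + 1) by rewrite divr_gt0 ?ltr_wpDl.
have /cvgrPdist_lt/(_ _ e'0) := fl; apply: filterS => m.
rewrite ltr_pdivlMr ?ltr_wpDl// -cmulBl; apply: le_lt_trans.
by rewrite (le_trans (normM_le _ _))// ler_wpM2l// lerDl.
Qed.

Let cmul_cvgr (F : set_system multiplier) (f : multiplier -> A) (l b : A) :
  ProperFilter F -> f m @[m --> F] --> l -> (b ** f m) @[m --> F] --> b ** l.
Proof.
move=> FF fl; apply/cvgrPdist_lt => e e0.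
have e'0 : 0 < e / (`|b| + 1) by rewrite divr_gt0 ?ltr_wpDl.
have /cvgrPdist_lt/(_ _ e'0) := fl; apply: filterS => m.
rewrite ltr_pdivlMr ?ltr_wpDl// -cmulBr; apply: le_lt_trans.
by rewrite (le_trans (normM_le _ _))// mulrC ler_wpM2l// lerDl.
Qed.

Fact mcomplete (F : set_system multiplier) :
  ProperFilter F -> cauchy F -> cvg F.
Proof.
move=> FF /cauchy_ballP Fc; apply/cvg_ex.
have Fc' (e : R[i]) : 0 < e -> \forall m & n \near F, `|m - n| < e.
  by move=> e0; have := Fc e e0; rewrite near_simpl -ball_normE.
have Fd (e : R[i]) : 0 < e -> \forall m \near F, \forall n \near F, `|m - n| < e.
  by move=> e0; apply: nearP_dep; exact: Fc'.
have cvgop (f : multiplier -> A) (a : A) :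
    (forall m n, `|f m - f n| <= `|m - n| * `|a|) ->
    exists l : A, f m @[m --> F] --> l.
  move=> fP; apply/cvg_ex; apply: cauchy_cvg; apply/cauchy_ballP => e e0.
  have e'0 : 0 < e / (`|a| + 1) by rewrite divr_gt0 ?ltr_wpDl.
  rewrite near_map2; have := Fc' _ e'0.
  apply: filterS => -[m n] /= mn; rewrite -ball_normE /ball_/=.
  rewrite (le_lt_trans (fP _ _))//.
  rewrite (@le_lt_trans _ _ (`|m - n| * (`|a| + 1)))//.
    by rewrite ler_wpM2l// lerDl.
  by rewrite -ltr_pdivlMr ?ltr_wpDl.
have lB m n a : lmult m a - lmult n a = lmult (m - n) a.
  by rewrite /= scaleN1r.
have rB m n a : rmult m a - rmult n a = rmult (m - n) a.
  by rewrite /= scaleN1r.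
have /choice[L Ll] : forall a, exists l : A, lmult m a @[m --> F] --> l.
  by move=> a; apply: (cvgop _ a) => m n; rewrite lB lmult_norm.
have /choice[T Tl] : forall a, exists l : A, rmult m a @[m --> F] --> l.
  by move=> a; apply: (cvgop _ a) => m n; rewrite rB rmult_le.
have est m (e : R[i]) : 0 <= e -> (\forall n \near F, `|m - n| < e) ->
    forall a, `|L a - lmult m a| <= e * `|a| /\ `|T a - rmult m a| <= e * `|a|.
  move=> e0 me a; split.
    apply: norm_lim_le (Ll a) _ => //; first exact: mulr_ge0.
    apply: filterS me => n /ltW mn.
    by rewrite lB (le_trans (lmult_norm _ _))// ler_wpM2r// distrC.
  apply: norm_lim_le (Tl a) _ => //; first exact: mulr_ge0.
  apply: filterS me => n /ltW mn.
  by rewrite rB (le_trans (rmult_le _ _))// ler_wpM2r// distrC.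
have [m0 m0P] := filter_ex (Fd 1 ltr01).
have {}m0P := est _ _ ler01 m0P.
have unicity (f g : multiplier -> A) (l l' : A) : f =1 g ->
    f m @[m --> F] --> l -> g m @[m --> F] --> l' -> l = l'.
  by move=> /funext -> fl; exact: cvg_unique fl.
have LT : double_centralizer L T.
  split.
  - move=> k a b; apply: (unicity _ (fun m => k *: lmult m a + lmult m b)
      _ _ _ (Ll _)).
      by move=> m; rewrite (dc_linl (multP m)).
    by apply: cvgD (Ll b); apply: cvgZr; exact: Ll.
  - move=> k a b; apply: (unicity _ (fun m => k *: rmult m a + rmult m b)
      _ _ _ (Tl _)).
      by move=> m; rewrite (dc_linr (multP m)).
    by apply: cvgD (Tl b); apply: cvgZr; exact: Tl.
  - exists (1 + `|m0|) => a; rewrite mulrDl -[L a](subrK (lmult m0 a)).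
    rewrite (le_trans (ler_normD _ _))// lerD ?lmult_norm//.
    exact: (m0P a).1.
  - exists (1 + `|m0|) => a; rewrite mulrDl -[T a](subrK (rmult m0 a)).
    rewrite (le_trans (ler_normD _ _))// lerD ?rmult_le//.
    exact: (m0P a).2.
  - move=> a b; refine (unicity _ _ _ _ _ (Ll _) (@cmul_cvgl _ _ _ b FF (Ll a))) => m.
    exact: dc_l (multP m) _ _.
  - move=> a b; refine (unicity _ _ _ _ _ (Tl _) (@cmul_cvgr _ _ _ a FF (Tl b))) => m.
    exact: dc_r (multP m) _ _.
  - move=> a b; refine (unicity _ _ _ _ _ (@cmul_cvgl _ _ _ b FF (Tl a)) (@cmul_cvgr _ _ _ a FF (Ll b))) => m.
    exact: rmult_cmul.
exists (Multiplier LT); apply/cvgrPdist_lt => e e0.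
have e20 : 0 < e / 2 by rewrite divr_gt0.
have := Fd _ e20; apply: filterS => m me.
apply: (@le_lt_trans _ _ (e / 2)); last by rewrite gtr_pMr// invf_lt1// ltr1n.
apply: mnorm_le => [|a]; first exact: ltW.
by rewrite -lB /=; have [] := est _ _ (ltW e20) me a.
Qed.

HB.instance Definition _ := Uniform_isComplete.Build multiplier mcomplete.

HB.instance Definition _ := isCStarAlgebra.Build R multiplier
  mmulA mmulPl mmulPr mstarP mstarK mstarM mnormM mcstar.

Fact mult_incl_dc (a : A) : double_centralizer (cmul a) (cmul^~ a).
Proof.
split.
- by move=> k b c; rewrite cmulPr.
- by move=> k b c; rewrite cmulPl.
- by exists `|a| => b; exact: normM_le.
- by exists `|a| => b; rewrite mulrC normM_le.
- by move=> b c; rewrite cmulA.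
- by move=> b c; rewrite cmulA.
- by move=> b c; rewrite cmulA.
Qed.

(* the canonical inclusion of A in M(A) *)
Definition mult_incl (a : A) : multiplier := Multiplier (mult_incl_dc a).

Fact mult_one_dc : double_centralizer (@id A) id.
Proof. by split => //; exists 1 => a; rewrite mul1r. Qed.

Lemma mult_one_unit : is_unit (Multiplier mult_one_dc).
Proof. by move=> m; split; exact: mult_eql. Qed.

End Multiplier.

(** * Hilbert modules and bi-Hilbertian bimodules *)

Record hilbertModule (R : realType) (B : cstarAlgType R) := HilbertModule {
  hm_sort :> completeNormedModType R[i];
  ract : hm_sort -> B -> hm_sort;
  ip : hm_sort -> hm_sort -> B;
  ractPl : forall (k : R[i]) psi phi b,
    ract (k *: psi + phi) b = k *: ract psi b + ract phi b;
  ractPr : forall (k : R[i]) psi b c,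
    ract psi (k *: b + c) = k *: ract psi b + ract psi c;
  ractM : forall psi b c, ract psi (b ** c) = ract (ract psi b) c;
  ipPr : forall (k : R[i]) phi psi psi',
    ip phi (k *: psi + psi') = k *: ip phi psi + ip phi psi';
  ip_star : forall phi psi, star (ip phi psi) = ip psi phi;
  ip_ract : forall phi psi b, ip phi (ract psi b) = ip phi psi ** b;
  ip_ge0 : forall psi, positive (ip psi psi);
  ip_norm : forall psi, `|psi| ^+ 2 = `|ip psi psi|
}.

Section Compact.
Variables (R : realType) (B : cstarAlgType R) (M : hilbertModule B).

(* S is adjointable, with adjoint T *)
Definition adjoint_of (S T : M -> M) : Prop :=
  forall phi psi, ip (S phi) psi = ip phi (T psi).

Definition theta (psi psi' phi : M) : M := ract psi (ip psi' phi).

(* K(M), the operator-norm closure of the linear span of the theta's; since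
   k *: theta psi psi' = theta (k *: psi) psi', sums of theta's are enough *)
Definition compact_op (T : M -> M) : Prop :=
  forall e : R[i], 0 < e -> exists s : seq (M * M), forall phi : M,
    `|T phi - \sum_(p <- s) theta p.1 p.2 phi| <= e * `|phi|.

End Compact.

Section Theta.
Variables (R : realType) (B : cstarAlgType R) (M : hilbertModule B).
Implicit Types (phi psi chi : M).

Lemma compact_theta psi psi' : compact_op (@theta R B M psi psi').
Proof.
move=> e e0; exists [:: (psi, psi')] => phi.
by rewrite big_seq1 subrr normr0 mulr_ge0// ltW.
Qed.

Lemma theta_adj psi psi' : adjoint_of (@theta R B M psi psi') (theta psi' psi).
Proof.
move=> phi chi; rewrite /theta -[LHS]ip_star !ip_ract starM.
by rewrite !ip_star.
Qed.

Lemma ip_ractl psi phi b : ip (ract psi b) phi = star b ** ip psi phi.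
Proof. by rewrite -[LHS]ip_star ip_ract starM ip_star. Qed.

Lemma ip_sep psi psi' : (forall phi, ip phi psi = ip phi psi') -> psi = psi'.
Proof.
move=> h; apply/eqP; rewrite -subr_eq0 -normr_eq0 -sqrf_eq0 ip_norm.
have -> : psi - psi' = (-1) *: psi' + psi by rewrite scaleN1r addrC.
by rewrite ipPr h scaleN1r addNr normr0.
Qed.

End Theta.

(* kincl is the inclusion of K(M) in A; only its values on compact operators
   are meaningful, and it is injective on them by kinclE. kincl_lact is the left
   A-linearity of the A-valued scalar product lip below; when A does not act
   faithfully on M it is not a consequence of kinclE. *)
Record biHilbert (R : realType) (A B : cstarAlgType R) := BiHilbert {
  bh_mod :> hilbertModule B;
  lact : A -> bh_mod -> bh_mod;
  kincl : (bh_mod -> bh_mod) -> A;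
  lactPl : forall (k : R[i]) a b psi,
    lact (k *: a + b) psi = k *: lact a psi + lact b psi;
  lactPr : forall (k : R[i]) a psi phi,
    lact a (k *: psi + phi) = k *: lact a psi + lact a phi;
  lactM : forall a b psi, lact (a ** b) psi = lact a (lact b psi);
  lact_ract : forall a psi b, lact a (ract psi b) = ract (lact a psi) b;
  lact_adj : forall a, adjoint_of (lact a) (lact (star a));
  kinclP : forall (k : R[i]) S T, compact_op S -> compact_op T ->
    kincl (fun phi => k *: S phi + T phi) = k *: kincl S + kincl T;
  kinclM : forall S T, compact_op S -> compact_op T ->
    kincl (S \o T) = kincl S ** kincl T;
  kincl_star : forall S T, compact_op S -> compact_op T -> adjoint_of S T ->
    kincl T = star (kincl S);
  kinclE : forall T, compact_op T -> lact (kincl T) = T;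
  kincl_lact : forall a psi psi',
    kincl (theta (lact a psi) psi') = a ** kincl (theta psi psi');
  kincl_norm : forall psi, `|psi| ^+ 2 = `|kincl (theta psi psi)|
}.

Definition lip (R : realType) (A B : cstarAlgType R) (M : biHilbert A B)
  (psi psi' : M) : A := kincl (theta psi psi').

Definition acts_unitally (R : realType) (A B : cstarAlgType R)
    (M : biHilbert A B) (eA : A) (eB : B) : Prop :=
  forall psi : M, lact eA psi = psi /\ ract psi eB = psi.

(** * Morphisms *)

Record cstar_hom (R : realType) (A A' : cstarAlgType R) (f : A -> A') : Prop := {
  hom_linear : linear f;
  hom_mul : forall a b, f (a ** b) = f a ** f b;
  hom_star : forall a, f (star a) = star (f a)
}.

Record biHilbertHom (R : realType) (A B A' B' : cstarAlgType R)
    (M : biHilbert A B) (M' : biHilbert A' B') := BiHilbertHom {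
  hom_mod :> M -> M';
  hom_l : A -> A';
  hom_r : B -> B';
  hom_mod_linear : linear hom_mod;
  hom_mod_bounded : bounded_op hom_mod;
  hom_l_hom : cstar_hom hom_l;
  hom_r_hom : cstar_hom hom_r;
  hom_act : forall a psi b,
    hom_mod (ract (lact a psi) b) = ract (lact (hom_l a) (hom_mod psi)) (hom_r b);
  hom_ip : forall psi psi', hom_r (ip psi psi') = ip (hom_mod psi) (hom_mod psi');
  hom_lip : forall psi psi', hom_l (lip psi psi') = lip (hom_mod psi) (hom_mod psi')
}.

Definition bimod_mono (R : realType) (A B A' B' : cstarAlgType R)
    (M : biHilbert A B) (M' : biHilbert A' B') (f : biHilbertHom M M') : Prop :=
  [/\ injective f, injective (hom_l f) & injective (hom_r f)].

(** * Ideals of C*-categories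

   A C*-category enters the notion of (essential) ideal only through its arrow
   spaces, composition and involution, so only these are recorded; no identity
   arrows are required. For the category linking M of a bimodule, associativity,
   the laws of the involution and the C*-identity are lk_compA, lk_starK,
   lk_star_comp and lk_cstar_norm below. *)

Record starCategory (R : realType) := StarCategory {
  cat_obj : Type;
  arrow : cat_obj -> cat_obj -> completeNormedModType R[i];
  comp : forall x y z, arrow y z -> arrow x y -> arrow x z;
  cat_star : forall x y, arrow x y -> arrow y x
}.
Arguments arrow {R s} x y.
Arguments comp {R s x y z}.
Arguments cat_star {R s x y}.

Section Ideals.
Variables (R : realType) (C : starCategory R).

Definition arrow_sets := forall x y : cat_obj C, set (arrow x y).

Record cat_ideal (J : arrow_sets) : Prop := {
  ideal0 : forall x y, J x y 0;
  idealP : forall x y (k : R[i]) f g, J x y f -> J x y g -> J x y (k *: f + g);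
  ideal_closed : forall x y, closed (J x y);
  ideal_star : forall x y f, J x y f -> J y x (cat_star f);
  ideal_compl : forall x y z (f : arrow y z) g, J x y g -> J x z (comp f g);
  ideal_compr : forall x y z f (g : arrow x y), J y z f -> J x z (comp f g)
}.

Definition essential_ideal (I : arrow_sets) : Prop :=
  cat_ideal I /\
  forall J : arrow_sets, cat_ideal J ->
    (exists x y, exists2 f, J x y f & f != 0) ->
    exists x y, exists2 f, (I x y `&` J x y) f & f != 0.

End Ideals.

(** * The conjugate module and the two-object category of a bimodule *)

Definition conj_mod (V : Type) : Type := V.

Section ConjMod.
Variables (R : realType) (V : completeNormedModType R[i]).

HB.instance Definition _ := GRing.Zmodule.on (conj_mod V).
Let cscale (k : R[i]) (v : conj_mod V) : conj_mod V := k^* *: (v : V).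

Fact cscaleA k l v : cscale k (cscale l v) = cscale (k * l) v.
Proof. by rewrite /cscale scalerA rmorphM. Qed.
Fact cscale1 : left_id 1 cscale.
Proof. by move=> v; rewrite /cscale conjC1 scale1r. Qed.
Fact cscaleDr : right_distributive cscale +%R.
Proof. by move=> k u v; rewrite /cscale scalerDr. Qed.
Fact cscaleDl v : {morph cscale^~ v : k l / k + l}.
Proof. by move=> k l; rewrite /cscale rmorphD scalerDl. Qed.

HB.instance Definition _ := GRing.Zmodule_isLmodule.Build R[i] (conj_mod V)
  cscaleA cscale1 cscaleDr cscaleDl.
HB.instance Definition _ := PseudoMetricNormedZmod.copy (conj_mod V) V.
HB.instance Definition _ := Complete.copy (conj_mod V) V.

Fact cnormZ (k : R[i]) (v : conj_mod V) : `|k *: v| = `|k| * `|v|.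
Proof. by rewrite [LHS](normrZ (k^*) (v : V)) norm_conjC. Qed.

HB.instance Definition _ := PseudoMetricNormedZmod_Lmodule_isNormedModule.Build
  R[i] (conj_mod V) cnormZ.

End ConjMod.

Variant two_obj := rho | sigma.

Section Linking.
Variables (R : realType) (A B : cstarAlgType R) (M : biHilbert A B).

(* an element psi of conj_mod M stands for the arrow psi^* : sigma -> rho *)
Definition lk_arrow (x y : two_obj) : completeNormedModType R[i] :=
  match x, y with
  | rho, rho => B
  | sigma, sigma => A
  | rho, sigma => M
  | sigma, rho => conj_mod M
  end.

(* row by row: b c, psi^* o psi' = <psi, psi'>_B, psi b, a psi,
   b o psi^* = (psi b^* )^*, psi o psi'^* = <psi, psi'>_A,
   psi^* o a = (a^* psi)^*, a c *)
Definition lk_comp (x y z : two_obj) :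
    lk_arrow y z -> lk_arrow x y -> lk_arrow x z :=
  match x, y, z with
  | rho, rho, rho => fun (b c : B) => b ** c
  | rho, sigma, rho => fun (psi psi' : M) => ip psi psi'
  | rho, rho, sigma => fun (psi : M) (b : B) => ract psi b
  | rho, sigma, sigma => fun (a : A) (psi : M) => lact a psi
  | sigma, rho, rho => fun (b : B) (psi : M) => ract psi (star b)
  | sigma, rho, sigma => fun (psi psi' : M) => lip psi psi'
  | sigma, sigma, rho => fun (psi : M) (a : A) => lact (star a) psi
  | sigma, sigma, sigma => fun (a c : A) => a ** c
  end.

Definition lk_star (x y : two_obj) : lk_arrow x y -> lk_arrow y x :=
  match x, y with
  | rho, rho => fun b : B => star b
  | sigma, sigma => fun a : A => star a
  | rho, sigma => fun psi : M => psi
  | sigma, rho => fun psi : M => psi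
  end.

Definition linking : starCategory R := StarCategory lk_comp lk_star.

End Linking.

Section LinkingLaws.
Variables (R : realType) (A B : cstarAlgType R) (M : biHilbert A B).

Lemma lip_star (psi psi' : M) : star (lip psi psi') = lip psi' psi.
Proof.
by rewrite -(kincl_star _ _ (theta_adj psi psi'))//; exact: compact_theta.
Qed.

Lemma lact_lip (psi psi' phi : M) : lact (lip psi psi') phi = ract psi (ip psi' phi).
Proof. by rewrite /lip kinclE//; exact: compact_theta. Qed.

Lemma lip_lactr (psi psi' : M) a : lip psi (lact a psi') = lip psi psi' ** star a.
Proof.
by rewrite -[LHS]lip_star [X in star X]kincl_lact starM lip_star.
Qed.

Lemma lip_ract (psi psi' : M) b : lip (ract psi b) psi' = lip psi (ract psi' (star b)).
Proof.
congr kincl; apply/funext => phi.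
by rewrite /theta -ractM ip_ractl starK.
Qed.

(* the laws of a category with a contravariant involution and the C*-identity *)
Lemma lk_compA w x y z (f : lk_arrow M y z) (g : lk_arrow M x y)
    (h : lk_arrow M w x) :
  lk_comp f (lk_comp g h) = lk_comp (lk_comp f g) h.
Proof.
case: w x y z f g h => [] [] [] [] f g h /=;
  rewrite ?cmulA ?starM ?lactM ?ractM ?starK ?lact_lip ?lip_star ?ip_star
    ?ip_ract ?ip_ractl ?lip_lactr ?starK//.
- by rewrite lact_ract.
- by rewrite lact_adj starK.
- by rewrite lip_ract.
- exact: lact_lip.
- by rewrite [RHS]kincl_lact.
- by rewrite lact_ract.
Qed.

Lemma lk_starK x y (f : lk_arrow M x y) : lk_star (lk_star f) = f.
Proof. by case: x y f => [] [] f //=; rewrite starK. Qed.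

Lemma lk_star_comp x y z (f : lk_arrow M y z) (g : lk_arrow M x y) :
  lk_star (lk_comp f g) = lk_comp (lk_star g) (lk_star f).
Proof.
by case: x y z f g => [] [] [] f g /=; rewrite ?starM ?starK ?ip_star ?lip_star.
Qed.

Lemma lk_cstar_norm x y (f : lk_arrow M x y) :
  `|lk_comp (lk_star f) f| = `|f| ^+ 2.
Proof.
case: x y f => [] [] f /=; rewrite ?cstar_norm//.
- by rewrite -ip_norm.
- by rewrite -kincl_norm.
Qed.

End LinkingLaws.

Section Extension.
Variables (R : realType) (A B A' B' : cstarAlgType R).
Variables (M : biHilbert A B) (M' : biHilbert A' B') (f : biHilbertHom M M').

Definition lk_map (x y : two_obj) : lk_arrow M x y -> lk_arrow M' x y :=
  match x, y with
  | rho, rho => hom_r f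
  | sigma, sigma => hom_l f
  | rho, sigma => hom_mod f
  | sigma, rho => hom_mod f
  end.

(* M' contains M, embedded by f, as an essential ideal *)
Definition essential_embedding : Prop :=
  bimod_mono f /\
  @essential_ideal R (linking M') (fun x y => range (@lk_map x y)).

End Extension.

(* Main.v *)
Require Import Defs.
From HB Require Import structures.
From mathcomp Require Import all_boot all_order all_algebra.
From mathcomp Require Import complex.
From mathcomp Require Import all_classical all_reals topology normedtype.
From mathcomp Require Import ring.
From mathcomp Require Import interval_inference sequences.

(* M(M) consists of the arrows rho -> sigma of the multiplier category of the
   two-object category of M: such an arrow is a double centralizer, acting on all
   arrow spaces from the left and from the right. The endomorphisms of sigma and
   rho in it are M(A) and M(B): every arrow f is a limit of composites a f with a
   an endomorphism of its target, so a double centralizer of A or B extends to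
   all arrow spaces. Positivity of h = m^* m in M(B) follows from that of b^* h b
   in B through the negative part of h, and K(M(M)) embeds in M(A) because finite
   sums of the elements <m, m'>_{M(A)} have in M(A) at most the norm with which
   they act on M(M).

   If J embeds M as an essential ideal of M', composition with an arrow m of M'
   preserves the image of J and so gives a double centralizer of M, bounded
   because an injective homomorphism of C*-algebras with closed range is
   isometric. The arrows giving 0 form an ideal that meets the image of J
   trivially, so only 0 does. *)

Set Implicit Arguments.
Unset Strict Implicit.
Unset Printing Implicit Defensive.

Import Order.TTheory GRing.Theory Num.Theory.
Import numFieldNormedType.Exports.

Local Open Scope classical_set_scope.
Local Open Scope ring_scope.

(** No spectra and no functional calculus occur; one iteration replaces them. It solves
    [(1 - c)^2 = 1 - h] for [|h| <= 1], and its limit lies in the closure of every set that contains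
    0 and is stable under its step. Self-adjointness, commutation and membership in the closed range
    of a homomorphism thus pass to [c]; square roots, positivity of [x^* x], monotonicity of the
    norm and isometry of embeddings all come from this root.

    The algebras may lack units, so the order of [B] is read off in its multiplier algebra, into
    which [B] embeds isometrically. Approximate units are replaced too: composing [f] with a
    suitable multiple of [f f^*] leaves an error of at most half the norm of [f], because
    [x (1 - x)^2 <= 1/4] on [0, 1], and repeating this on the residue gives the composites [a f].

    Working with all arrows of the two-object category at once gives [A], [B], [M] and the conjugate
    module one common treatment. The price is that a multiplier of [A] or [B] is given on
    endomorphisms only and has to be extended to the other arrows. *)

Section Approximation.

(** * Limits and estimates in normed spaces over [R[i]] *)

Variable R : realType.
Implicit Types (x y c e d : R[i]).

Lemma norm_small x c : 0 <= x -> 0 <= c ->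
  (forall e, 0 < e -> x <= c * e) -> x = 0.
Proof.
move=> x0 c0 h; apply/eqP; rewrite eq_le x0 andbT.
apply/ler_addgt0Pr => e e0; rewrite add0r.
(* The [+ 1] keeps the denominator positive when [c] is 0; the same device recurs below. *)
have d0 : 0 < e / (c + 1) by rewrite divr_gt0// ltr_wpDl.
rewrite (le_trans (h _ d0))// mulrCA ler_piMr//; first exact: ltW.
by rewrite ler_pdivrMr ?ltr_wpDl// mul1r lerDl.
Qed.

Lemma norm_small0 (V : normedModType R[i]) (v : V) c : 0 <= c ->
  (forall e, 0 < e -> `|v| <= c * e) -> v = 0.
Proof. by move=> c0 h; apply/eqP; rewrite -normr_eq0 (norm_small _ c0 h). Qed.

Lemma ltCR (r s : R) : (cofR r < cofR s) = (r < s).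
Proof. exact: ltcR. Qed.

Lemma leCR (r s : R) : (cofR r <= cofR s) = (r <= s).
Proof. exact: lecR. Qed.

Lemma cofR_gt0 (r : R) : (0 < cofR r) = (0 < r).
Proof. exact: ltcR. Qed.

Lemma cofR_nat n : cofR n%:R = n%:R :> R[i].
Proof. exact: (rmorph_nat (real_complex R)). Qed.

Lemma cofRM (r s : R) : cofR (r * s) = cofR r * cofR s.
Proof. exact: (rmorphM (real_complex R)). Qed.

Lemma cofRV (r : R) : cofR r^-1 = (cofR r)^-1.
Proof. exact: (fmorphV (real_complex R)). Qed.

Lemma cofRD (r s : R) : cofR (r + s) = cofR r + cofR s.
Proof. exact: (rmorphD (real_complex R)). Qed.

Lemma cofRB (r s : R) : cofR (r - s) = cofR r - cofR s.
Proof. exact: (rmorphB (real_complex R)). Qed.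

Lemma gt0_cofR e : 0 < e -> exists2 r : R, 0 < r & e = cofR r.
Proof.
move=> e0; exists (complex.Re e); last by rewrite Defs.ReE// ltW.
by rewrite -cofR_gt0 Defs.ReE// ltW.
Qed.

(** Read [Q e v] as: [v] is within [e] of the object sought. Values picked at errors 1/(n+1) form a
    Cauchy sequence, and its limit is within [e] of every [e]-approximant, whichever ones were
    picked. Square roots, completeness of the multiplier arrows, the extension of centralizers and
    the inclusion of the compacts all take their limits this way. *)
Lemma net_limit (V : completeNormedModType R[i]) (Q : R[i] -> V -> Prop) :
  (forall e, 0 < e -> exists v, Q e v) ->
  (forall e d v w, Q e v -> Q d w -> `|v - w| <= e + d) ->
  exists l, forall e v, Q e v -> `|v - l| <= e.
Proof.
move=> Qex Qd.
have /choice[v vQ] : forall n, exists v, Q (cofR n.+1%:R^-1) v.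
  by move=> n; apply: Qex; rewrite cofR_gt0 invr_gt0 ltr0n.
have Vsmall e : 0 < e -> exists N, forall n, (N <= n)%N -> cofR n.+1%:R^-1 < e.
  move=> /gt0_cofR[r r0 ->].
  have [N _ NP] := near_infty_natSinv_lt (PosNum r0).
  by exists N => n Nn; rewrite ltCR; exact: NP.
have vc : cauchy (v @ \oo).
  apply/cauchy_ballP => e e0.
  have [N NP] := Vsmall (e / 2) (divr_gt0 e0 (ltr0n _ 2)).
  pose tail := [set v n | n in [set n | (N <= n)%N]]; exists (tail, tail).
    by split; exists N => // n Nn; exists n.
  move=> [_ _] /= [[n Nn <-] [m Nm <-]]; rewrite -ball_normE /=.
  rewrite (le_lt_trans (Qd _ _ _ _ (vQ n) (vQ m)))//.
  by rewrite [ltRHS]splitr ltrD ?NP.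
have /cvg_ex[l /cvgrPdist_lt vl] : cvg (v @ \oo) by exact: cauchy_cvg.
exists l => e w Qw; apply/ler_addgt0Pr => d d0.
have [N NP] := Vsmall (d / 2) (divr_gt0 d0 (ltr0n _ 2)).
have [M _ MP] := vl (d / 2) (divr_gt0 d0 (ltr0n _ 2)).
pose n := maxn N M.
rewrite (le_trans (ler_distD (v n) _ _))// [d in leRHS]splitr addrA lerD//.
  rewrite (le_trans (Qd _ _ _ _ Qw (vQ n)))// lerD2l ltW// NP//.
  exact: leq_maxl.
by rewrite distrC ltW// MP//= leq_maxr.
Qed.

Lemma closure_normP (V : normedModType R[i]) (S : set V) (v : V) :
  closure S v <-> forall e, 0 < e -> exists2 w, S w & `|v - w| < e.
Proof.
split=> [Sv e e0|h B /nbhs_ballP[e /= e0 eB]].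
  have [w [Sw]] := Sv _ (nbhsx_ballx v e e0).
  by rewrite -ball_normE /= => vw; exists w.
have [w Sw vw] := h e e0; exists w; split => //.
by apply: eB; rewrite -ball_normE.
Qed.

Lemma closed_normP (V : normedModType R[i]) (S : set V) :
  (forall v, (forall e, 0 < e -> exists2 w, S w & `|v - w| < e) -> S v) ->
  closed S.
Proof. by move=> h v /closure_normP; exact: h. Qed.

(** Completeness of [V]: preimages of points near [w] are near each other, and their limit maps to
    [w]. *)
Lemma isometry_closed_range (V : completeNormedModType R[i])
    (W : normedModType R[i]) (f : V -> W) :
  (forall u v, `|f u - f v| = `|u - v|) -> closed (range f).
Proof.
move=> fi; apply: closed_normP => w wP.
have [||l lP] := @net_limit V (fun e v => `|w - f v| <= e).
- by move=> e /wP[_ [v _ <-]] /ltW ?; exists v.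
- move=> e d u v ue vd; rewrite -fi (le_trans (ler_distD w _ _))// lerD//.
  by rewrite distrC.
exists l => //; apply/esym/eqP; rewrite -subr_eq0; apply/eqP.
apply: (@norm_small0 _ _ 2) => // e /wP[_ [v _ <-]] /ltW ve.
rewrite (le_trans (ler_distD (f v) _ _))// mulr_natl mulr2n lerD//.
by rewrite fi lP.
Qed.

(** Bernoulli's inequality for [x = 1 + d], against the archimedean property. It removes a
    multiplicative constant from an estimate that holds for all powers. *)
Lemma expr_bounded_le1 (c x : R[i]) : 0 <= x -> (forall n, x ^+ n <= c) -> x <= 1.
Proof.
move=> x0 xc; rewrite real_leNgt ?ger0_real//; apply/negP => x1.
have c0 : 0 <= c by rewrite (le_trans _ (xc 0)).
have [d d0 xd] : exists2 d : R, 0 < d & x = 1 + cofR d.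
  have /gt0_cofR[d d0 dE] : 0 < x - 1 by rewrite subr_gt0.
  by exists d => //; rewrite -dE addrC subrK.
have bern n : 1 + n%:R * cofR d <= x ^+ n.
  elim: n => [|n ih]; first by rewrite mul0r addr0.
  rewrite exprS (le_trans _ (ler_wpM2l x0 ih))// {1}xd -natr1.
  have -> : (1 + cofR d) * (1 + n%:R * cofR d) =
            1 + (n%:R + 1) * cofR d + n%:R * cofR d ^+ 2 by ring.
  by rewrite lerDl mulr_ge0// exprn_ge0// ltW// cofR_gt0.
have c0' : 0 <= complex.Re c by rewrite -leCR Defs.ReE.
have := archi_boundP (divr_ge0 c0' (ltW d0)).
set n := Num.bound _; rewrite ltr_pdivrMr// -ltCR [X in X < _]Defs.ReE//.
rewrite cofRM cofR_nat => cn.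
have := lt_le_trans cn (le_trans (_ : _ <= 1 + _) (le_trans (bern n) (xc n))).
by rewrite ltxx lerDr ler01 => /(_ isT).
Qed.

Lemma half_pow_small c e : 0 <= c -> 0 < e ->
  exists n, 2^-1 ^+ n * c <= e.
Proof.
move=> c0 e0; have ce : 0 <= c / e by rewrite divr_ge0// ltW.
have r0 : 0 <= complex.Re (c / e) by rewrite -leCR Defs.ReE.
exists (Num.bound (complex.Re (c / e))); set n := Num.bound _.
rewrite exprVn mulrC ler_pdivrMr ?exprn_gt0// mulrC -ler_pdivrMr//.
rewrite -[leLHS]Defs.ReE// -natrX -cofR_nat leCR.
rewrite (le_trans (ltW (archi_boundP r0)))// ler_nat ltnW//.
exact: ltn_expl.
Qed.

End Approximation.

(** * Positive elements of C*-algebras *)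

Section HalfRoot.
Variables (R : realType) (A : cstarAlgType R).
Implicit Types a b h x y : A.

Lemma sqr_diff_le x y :
  `|x ** x - y ** y| <= (`|x| + `|y|) * `|x - y|.
Proof.
rewrite (le_trans (ler_distD (x ** y) _ _))// -cmulBr -cmulBl mulrDl lerD//.
  exact: normM_le.
by rewrite (le_trans (normM_le _ _))// mulrC.
Qed.

(* A solution of (1 - c)^2 = 1 - h in an algebra that need not have a unit, as
   the limit of the iteration x |-> (h + x^2)/2 from 0. The same iteration for
   the number 1 in place of h increases and bounds the norms of the steps. *)
Lemma half_root h : `|h| <= 1 ->
  exists c, c + c = h + c ** c /\
    forall S : set A, S 0 -> (forall x, S x -> S (2^-1 *: (h + x ** x))) ->
      closure S c.
Proof.
move=> h1.
pose F x := 2^-1 *: (h + x ** x); pose G (t : R) := (1 + t ^+ 2) / 2.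
pose x n := iter n F 0; pose t n := iter n G 0.
have t01 n : 0 <= t n <= 1.
  elim: n => [|n /andP[t0 t1]]; first by rewrite lexx ler01.
  rewrite [t _]/(G (t n)) /G divr_ge0 ?addr_ge0 ?sqr_ge0//=.
  rewrite ler_pdivrMr// mul1r [leRHS](_ : 2 = 1 + 1)// lerD2l.
  by rewrite expr_le1.
have tle n : t n <= t n.+1.
  rewrite -[t n.+1]/(G (t n)) /G ler_pdivlMr// -subr_ge0.
  rewrite (_ : _ - _ = (1 - t n) ^+ 2) ?sqr_ge0//; ring.
have cofRG r : cofR (G r) = (1 + cofR r ^+ 2) / 2.
  by rewrite /G cofRM cofRV cofRD expr2 cofRM !cofR_nat (cofR_nat _ 1).
have Gdiff r s : cofR (G r - G s) =
    2^-1 * ((cofR r + cofR s) * (cofR r - cofR s)).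
  by rewrite cofRB !cofRG; ring.
have xS n : x n.+1 = F (x n) by [].
have tS n : t n.+1 = G (t n) by [].
have Fdist u v : `|F u - F v| <= 2^-1 * ((`|u| + `|v|) * `|u - v|).
  rewrite /F -scalerBr normrZ ger0_norm ?invr_ge0// ler_wpM2l ?invr_ge0//.
  by rewrite opprD addrACA subrr add0r sqr_diff_le.
have xt n : `|x n| <= cofR (t n).
  elim: n => [|n ih]; first by rewrite normr0 lexx.
  rewrite xS tS /F normrZ ger0_norm ?invr_ge0// cofRG mulrC.
  rewrite ler_wpM2r ?invr_ge0// (le_trans (ler_normD _ _))// lerD// expr2.
  by rewrite (le_trans (normM_le _ _))// ler_pM.
have xd n : `|x n.+1 - x n| <= cofR (t n.+1 - t n).
  elim: n => [|n ih].
    rewrite xS tS /x/= /F subr0 cmul0l addr0 /t/= /G expr0n/= addr0 subr0.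
    rewrite normrZ ger0_norm ?invr_ge0// cofRM cofRV cofR_nat mulrC.
    by rewrite (cofR_nat _ 1) ler_wpM2r// invr_ge0.
  rewrite -[leLHS]/`|F (x n.+1) - F (x n)| (le_trans (Fdist _ _))//.
  rewrite -[t n.+2 - _]/(G (t n.+1) - G (t n)) Gdiff.
  rewrite ler_wpM2l ?invr_ge0// ler_pM ?addr_ge0// ?lerD// -cofRB.
  exact: ih.
have xdk n k : `|x (n + k)%N - x n| <= cofR (t (n + k)%N - t n).
  elim: k => [|k ih]; first by rewrite addn0 !subrr normr0.
  rewrite addnS (le_trans (ler_distD (x (n + k)%N) _ _))//.
  by rewrite -(subrKA (t (n + k)%N)) cofRD lerD.
have tmono : {homo t : n m / (n <= m)%N >-> n <= m}.
  by apply: homo_leq => //; exact: le_trans.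
have tcv : cvgn t.
  apply: nondecreasing_is_cvgn => //.
  by exists 1 => _ [n _ <-]; case/andP: (t01 n).
pose l := limn t.
have tl n : t n <= l by exact: nondecreasing_cvgn_le.
have small e : 0 < e -> exists n, cofR (l - t n) <= e.
  move=> /gt0_cofR[r r0 ->]; move/cvgrPdist_le/(_ r r0): (tcv) => [N _ NP].
  exists N; rewrite leCR -[leLHS]ger0_norm ?subr_ge0//; exact: (NP N (leqnn N)).
have ge0 n : 0 <= cofR (l - t n) by rewrite -[0]/(cofR 0) leCR subr_ge0.
(* [x n] approximates the limit up to [l - t n], the sum of the remaining steps of the numerical
   iteration. *)
have [||c cP] := @net_limit R A (fun e v => exists2 n, v = x n & cofR (l - t n) <= e).
- by move=> e /small[n ne]; exists (x n), n.
- move=> e d _ _ [n -> ne] [m -> me].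
  have e0 := le_trans (ge0 _) ne; have d0 := le_trans (ge0 _) me.
  have key i j : (i <= j)%N -> `|x j - x i| <= cofR (l - t i).
    move=> ij; rewrite -(subnKC ij) (le_trans (xdk _ _))// leCR lerD2r.
    exact: tl.
  case/orP: (leq_total n m) => [/key|/key] h'.
    by rewrite distrC (le_trans h')// (le_trans ne)// lerDl.
  by rewrite (le_trans h')// (le_trans me)// lerDr.
have xc n : `|x n - c| <= cofR (l - t n) by apply: cP; exists n.
have x1 n : `|x n| <= 1.
  by rewrite (le_trans (xt n))// -[1]/(cofR 1) leCR; case/andP: (t01 n).
have c1 : `|c| <= 1.
  apply/ler_addgt0Pr => e /small[n ne]; rewrite -[c](subrKC (x n)).
  by rewrite (le_trans (ler_normD _ _))// lerD// distrC (le_trans (xc n)).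
exists c; split; last first.
  move=> S S0 SF; apply/closure_normP => e e0.
  have [n ne] := small (e / 2) (divr_gt0 e0 (ltr0n _ 2)).
  exists (x n).
    by elim: n {ne} => [//|n ih]; exact: SF.
  rewrite distrC (le_lt_trans (xc n))// (le_lt_trans ne)//.
  by rewrite gtr_pMr// invf_lt1// ltr1n.
(* [x n.+1 + x n.+1 = h + x n ** x n] holds exactly, and each side is within [2 * e] of its limit,
   the right one because the norms are at most 1; hence the constant 4. *)
apply/eqP; rewrite -subr_eq0; apply/eqP; apply: (@norm_small0 _ _ _ 4) => // e.
move=> /small[n ne].
rewrite (le_trans (ler_distD (x n.+1 + x n.+1) _ _))//.
have -> : 4 * e = 2 * e + 2 * e by ring.
rewrite lerD//.
  rewrite opprD addrACA (le_trans (ler_normD _ _))// mulr_natl mulr2n.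
  have nc : `|c - x n.+1| <= e.
    by rewrite distrC (le_trans (xc _))// (le_trans _ ne)// leCR lerD2l lerN2.
  by rewrite lerD.
have -> : x n.+1 + x n.+1 = h + x n ** x n.
  by rewrite xS /F -scalerDl -[2^-1]div1r -splitr scale1r.
rewrite opprD addrACA subrr add0r (le_trans (sqr_diff_le _ _))//.
by rewrite ler_pM ?addr_ge0// ?lerD// (le_trans (xc n)).
Qed.

End HalfRoot.

Lemma half_double (R : realType) (V : lmodType R[i]) (v : V) : 2^-1 *: (v + v) = v.
Proof. by rewrite -mulr2n -[v *+ 2]scaler_nat scalerA mulVf ?pnatr_eq0// scale1r. Qed.

Section ClosureBounds.
Variables (R : realType) (V W : normedModType R[i]).

Lemma closure_lipschitz_eq0 (f : V -> W) (k : R[i]) (S : set V) (c : V) : 0 <= k ->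
  (forall u v, `|f u - f v| <= k * `|u - v|) -> closure S c ->
  (forall x, S x -> f x = 0) -> f c = 0.
Proof.
move=> k0 fk /closure_normP cS fS; apply: (@norm_small0 _ _ _ k) => // e e0.
have [x Sx xe] := cS e e0.
by rewrite -[f c]subr0 -(fS _ Sx) (le_trans (fk _ _))// ler_wpM2l// ltW.
Qed.

Lemma closure_norm_le (r : R[i]) (S : set V) (c : V) :
  closure S c -> (forall x, S x -> `|x| <= r) -> `|c| <= r.
Proof.
move=> /closure_normP cS Sr; apply/ler_addgt0Pr => e e0.
have [x Sx xe] := cS e e0; rewrite -[c](subrKC x).
by rewrite (le_trans (ler_normD _ _))// lerD ?Sr// ltW.
Qed.

End ClosureBounds.

Section AlgebraExtra.
Variables (R : realType) (A : cstarAlgType R).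
Implicit Types a b c : A.

Lemma cmulNl a b : (- a) ** b = - (a ** b).
Proof. by rewrite -sub0r cmulBl cmul0l sub0r. Qed.

Lemma cmulNr a b : a ** (- b) = - (a ** b).
Proof. by rewrite -sub0r cmulBr cmul0r sub0r. Qed.

Lemma starN a : star (- a) = - star a.
Proof. by rewrite -scaleN1r starZ rmorphN rmorph1 scaleN1r. Qed.

Lemma starB a b : star (a - b) = star a - star b.
Proof. by rewrite starD starN. Qed.

Lemma norm_sqr_sa a : star a = a -> `|a ** a| = `|a| ^+ 2.
Proof. by move=> aE; rewrite -{1}aE cstar_norm. Qed.

Lemma sqr_sa_eq0 a : star a = a -> a ** a = 0 -> a = 0.
Proof.
move=> /norm_sqr_sa + a0; rewrite a0 normr0 => /esym/eqP.
by rewrite sqrf_eq0 normr_eq0 => /eqP.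
Qed.

Lemma cstar_eq0 a : star a ** a = 0 -> a = 0.
Proof.
move=> a0; apply/eqP; rewrite -normr_eq0 -sqrf_eq0 -cstar_norm a0.
by rewrite normr0.
Qed.

(** Each property of [c] holds at 0, survives the step of the iteration and passes to the limit. The
    closure clause is kept for use with the range of a homomorphism. *)
Lemma half_root_sa (h : A) : `|h| <= 1 -> star h = h ->
  exists c, [/\ c + c = h + c ** c, star c = c, `|c| <= 1,
    (forall x, x ** h = h ** x -> x ** c = c ** x) &
    forall S : set A, S 0 -> (forall x, S x -> S (2^-1 *: (h + x ** x))) ->
      closure S c].
Proof.
move=> h1 hE; have [c [cE cS]] := half_root h1.
have half_norm (a : A) : `|a| <= 1 -> `|2^-1 *: (h + a ** a)| <= 1.
  move=> a1; rewrite normrZ ger0_norm ?invr_ge0// mulrC ler_pdivrMr// mul1r.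
  rewrite (le_trans (ler_normD _ _))// [leRHS](_ : 2 = 1 + 1)// lerD//.
  by rewrite (le_trans (normM_le _ _))// mulr_ile1.
exists c; split => //.
- apply/eqP; rewrite -subr_eq0; apply/eqP.
  apply: (@closure_lipschitz_eq0 _ _ _ (fun x : A => star x - x) 2
    [set x | star x = x]) => //=.
  + move=> u v; have -> : star u - u - (star v - v) = star (u - v) - (u - v).
      by rewrite starB !opprB addrACA [- u - _]addrC addrACA.
    by rewrite (le_trans (ler_normB _ _))// norm_star mulr_natl mulr2n.
  + apply: cS => /= [|x xE]; first exact: star0.
    by rewrite starZ starD hE starM xE fmorphV rmorph_nat.
  + by move=> x ->; rewrite subrr.
- apply: closure_norm_le (cS [set x | `|x| <= 1] _ _) _ => //=.
  by rewrite normr0.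
- move=> x xh; apply/eqP; rewrite -subr_eq0; apply/eqP.
  apply: (@closure_lipschitz_eq0 _ _ _ (fun c => x ** c - c ** x) (2 * `|x|)
    [set c | x ** c = c ** x]) => /=.
  + by rewrite mulr_ge0.
  + move=> u v.
    have -> : x ** u - u ** x - (x ** v - v ** x) = x ** (u - v) - (u - v) ** x.
      by rewrite cmulBl cmulBr !opprB addrACA [- _ - _]addrC addrACA.
    rewrite (le_trans (ler_normB _ _))// -mulrA mulr_natl mulr2n lerD ?normM_le//.
    by rewrite mulrC normM_le.
  + apply: cS => /= [|y xy]; first by rewrite cmul0l cmul0r.
    by rewrite cmulZl cmulZr cmulDl cmulDr xh cmulA xy -cmulA xy cmulA.
  + by move=> y ->; rewrite subrr.
Qed.

End AlgebraExtra.

Section Positivity.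
Variables (R : realType) (A : cstarAlgType R).
Implicit Types (a b c g h k d x : A) (s t : R[i]).

(* Positivity relative to a unit e through the norm; for h = h^* it says that
   the spectrum of h lies in [0, 2t]. *)
Definition nonneg (e h : A) : Prop :=
  star h = h /\ exists2 t : R[i], 0 <= t & `|t *: e - h| <= t.

Variables (e : A) (e_unit : is_unit e).

Lemma unit_l a : e ** a = a. Proof. by case: (e_unit a). Qed.
Lemma unit_r a : a ** e = a. Proof. by case: (e_unit a). Qed.

Lemma star_unit : star e = e.
Proof. by rewrite -[LHS]unit_l -[X in X ** _]starK -starM unit_l starK. Qed.

(** Only an inequality, because in the zero algebra the unit is 0. *)
Lemma norm_unit_le1 : `|e| <= 1.
Proof.
have [->|e0] := eqVneq e 0; first by rewrite normr0.
rewrite -(ler_pM2r (_ : 0 < `|e|)) ?normr_gt0// mul1r -expr2 -cstar_norm.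
by rewrite star_unit unit_l.
Qed.

Lemma norm_scale_unit s : 0 <= s -> `|s *: e| <= s.
Proof. by move=> s0; rewrite normrZ ger0_norm// ler_piMr// norm_unit_le1. Qed.

Lemma star_scale_unit s : 0 <= s -> star (s *: e) = s *: e.
Proof. by move=> s0; rewrite starZ star_unit geC0_conj. Qed.

Lemma nonneg0 : nonneg e 0.
Proof. by split; [exact: star0|exists 0; rewrite ?scale0r ?subr0 ?normr0]. Qed.

Lemma nonnegD g h : nonneg e g -> nonneg e h -> nonneg e (g + h).
Proof.
move=> [gE [s s0 gs]] [hE [t t0 ht]]; split; first by rewrite starD gE hE.
exists (s + t); first exact: addr_ge0.
by rewrite scalerDl opprD addrACA (le_trans (ler_normD _ _))// lerD.
Qed.

Lemma nonnegZ s h : 0 <= s -> nonneg e h -> nonneg e (s *: h).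
Proof.
move=> s0 [hE [t t0 ht]]; split; first by rewrite starZ hE geC0_conj.
exists (s * t); first exact: mulr_ge0.
by rewrite -scalerA -scalerBr normrZ ger0_norm// ler_wpM2l.
Qed.

Lemma nonneg_unitB s h : 0 <= s -> star h = h -> `|h| <= s -> nonneg e (s *: e - h).
Proof.
move=> s0 hE hs; split; first by rewrite starB hE star_scale_unit.
by exists s => //; rewrite opprB addrC subrK.
Qed.

Lemma unit_commute s a : a ** (s *: e) = (s *: e) ** a.
Proof. by rewrite cmulZl cmulZr unit_l unit_r. Qed.

Lemma unit_half_root c g : c + c = g + c ** c -> (e - c) ** (e - c) = e - g.
Proof.
move=> cE; rewrite cmulBl !cmulBr !unit_l unit_r opprB -addrA (addrA (- c)) (addrC (- c)).
by rewrite -addrA -opprD cE opprD [- g - _]addrC addrA subrr add0r.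
Qed.

(** Write [h = t (e - g)] with [|g| <= 1]. The half root [c] of [g] satisfies [(e - c)^2 = e - g],
    and [|c| <= 1] is what makes [e - c] nonnegative. *)
Lemma nonneg_sqrt h : nonneg e h ->
  exists k, [/\ nonneg e k, k ** k = h & forall x, x ** h = h ** x -> x ** k = k ** x].
Proof.
move=> [hE [t t0 ht]]; have [t00|tn0] := eqVneq t 0.
  move: ht; rewrite t00 scale0r sub0r normrN normr_le0 => /eqP ->.
  exists 0; split; [exact: nonneg0|exact: cmul0l|].
  by move=> x _; rewrite cmul0l cmul0r.
have tp : 0 < t by rewrite lt_def tn0.
pose g := e - t^-1 *: h.
have gE : star g = g by rewrite starB starZ hE star_unit geC0_conj ?invr_ge0.
have g1 : `|g| <= 1.
  have -> : g = t^-1 *: (t *: e - h) by rewrite scalerBr scalerA mulVf ?scale1r.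
  by rewrite normrZ ger0_norm ?invr_ge0// mulrC ler_pdivrMr ?mul1r.
have [c [cE cS c1 cC _]] := half_root_sa g1 gE.
have s0 : 0 <= sqrtC t by rewrite sqrtC_ge0.
exists (sqrtC t *: (e - c)); split.
- apply: nonnegZ => //; split; first by rewrite starB star_unit cS.
  by exists 1 => //; rewrite scale1r opprB addrC subrK.
- rewrite cmulZl cmulZr scalerA -expr2 sqrtCK.
  rewrite (unit_half_root cE) /g opprB addrC subrK.
  by rewrite scalerA mulfV// scale1r.
- move=> x xh; have xg : x ** g = g ** x.
    by rewrite cmulBl cmulBr cmulZl cmulZr xh unit_l unit_r.
  by rewrite cmulZl cmulZr cmulBl cmulBr unit_l unit_r cC.
Qed.

(* k + i d is a multiple of a unitary and k is its real part. *)
Lemma commuting_squares_le k d s : star k = k -> star d = d -> k ** d = d ** k ->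
  0 <= s -> k ** k + d ** d = s *: e -> `|k ** k| <= s.
Proof.
move=> kE dE kd s0 kds; set u := k + 'i *: d.
have uE : star u = k - 'i *: d by rewrite starD starZ kE dE conjCi scaleNr.
have uu : star u ** u = s *: e.
  rewrite uE -kds cmulBl !cmulDr !cmulZl !cmulZr kd scalerA -expr2 sqrCi scaleN1r.
  by rewrite opprD opprK addrA addrK.
have us : `|u| ^+ 2 <= s by rewrite -cstar_norm uu norm_scale_unit.
rewrite norm_sqr_sa// (le_trans _ us)// lerXn2r ?nnegrE//.
have -> : k = 2^-1 *: (u + star u).
  by rewrite uE addrACA subrr addr0 half_double.
rewrite normrZ ger0_norm ?invr_ge0// mulrC ler_pdivrMr//.
by rewrite (le_trans (ler_normD _ _))// norm_star mulr_natr mulr2n.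
Qed.

(** Let [d] be the square root of [|k ** k| e - k ** k]. The squares of [d] and [k] sum to a
    multiple of [e], so [commuting_squares_le] bounds [d ** d], and this bound is the norm condition
    sought. *)
Lemma nonneg_sqr k : star k = k -> nonneg e (k ** k).
Proof.
move=> kE; split; first by rewrite starM kE.
have kkE : star (k ** k) = k ** k by rewrite starM kE.
have [d [[dE _] dd dC]] := nonneg_sqrt (nonneg_unitB (normr_ge0 _) kkE (lexx _)).
have kd : k ** d = d ** k.
  by apply: dC; rewrite cmulBl cmulBr unit_commute cmulA.
exists `|k ** k| => //; rewrite -dd.
by apply: (commuting_squares_le (d := k)) => //; rewrite dd subrK.
Qed.

(** The square roots of [h] and [s e - h] commute, and their squares sum to [s e]. *)
Lemma nonneg_norm_le h s : 0 <= s -> nonneg e h -> nonneg e (s *: e - h) -> `|h| <= s.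
Proof.
move=> s0 /nonneg_sqrt[k [[kE _] kk kC]] /nonneg_sqrt[d [[dE _] dd dC]].
rewrite -kk; apply: (commuting_squares_le (d := d)) => //.
  apply: dC; rewrite cmulBl cmulBr unit_commute; congr (_ - _).
  by rewrite -kk cmulA.
by rewrite kk dd subrKC.
Qed.

Lemma nonneg_norm_mono h g : nonneg e h -> nonneg e (g - h) -> `|h| <= `|g|.
Proof.
move=> h0 gh; have gE : star g = g.
  by have := (nonnegD h0 gh).1; rewrite subrKC.
apply: nonneg_norm_le => //; rewrite -(subrKA g).
by apply: nonnegD => //; apply: nonneg_unitB.
Qed.

Lemma nonnegD_eq0 h g : nonneg e h -> nonneg e g -> h + g = 0 -> h = 0.
Proof.
move=> h0 g0 hg; apply/eqP; rewrite -normr_le0 -(normr0 A).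
by apply: nonneg_norm_mono => //; rewrite sub0r (addr0_eq hg).
Qed.

(** For [x = a + i b] with [a], [b] self-adjoint the sum is [2 (a^2 + b^2)]; in the proof [p = 2 a]
    and [q = - 2 b]. *)
Lemma nonneg_sumsq x : nonneg e (star x ** x + x ** star x).
Proof.
pose p := x + star x; pose q := 'i *: (x - star x).
have pE : star p = p by rewrite starD starK addrC.
have qE : star q = q.
  by rewrite starZ starB starK conjCi scaleNr -scalerN opprB.
have -> : star x ** x + x ** star x = 2^-1 *: (p ** p + q ** q).
  rewrite cmulZl cmulZr scalerA -expr2 sqrCi scaleN1r.
  rewrite /p; have -> : (x + star x) ** (x + star x) - (x - star x) ** (x - star x) =
     (star x ** x + x ** star x) + (star x ** x + x ** star x).
    rewrite cmulBl !cmulBr cmulDl !cmulDr !opprB [x ** x + _]addrC.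
    rewrite [_ - _ + (_ - _)]addrC addrACA [X in X + _]addrACA subrr addr0.
    by rewrite [X in _ + X]addrACA subrr addr0 addrACA addrC addrACA addrC.
  by rewrite half_double.
by apply: nonnegZ; rewrite ?invr_ge0//; apply: nonnegD; apply: nonneg_sqr.
Qed.

(* With g = r^2 and y = x r, both y^* y = - g^2 and y y^* = - (x x^* )^2. *)
Lemma sqr_eq_nonneg_opp x g : nonneg e g -> star x ** x = - g -> g = 0.
Proof.
move=> g0 xg; have [r [[rE _] rr _]] := nonneg_sqrt g0.
pose f := x ** star x; pose y := x ** r.
have fE : star f = f by rewrite starM starK.
have yy : star y ** y = - (g ** g).
  rewrite starM rE cmulA -(cmulA r) xg cmulNr cmulNl -rr.
  by rewrite !cmulA.
have yy' : y ** star y = - (f ** f).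
  rewrite starM rE cmulA -(cmulA x) rr -[g]opprK -xg cmulNr cmulNl.
  by rewrite !cmulA.
have gg0 := nonneg_sqr g0.1; have ff0 := nonneg_sqr fE.
have := nonneg_sumsq y; rewrite yy yy' => gf.
apply: sqr_sa_eq0; first exact: g0.1.
apply: (@nonnegD_eq0 _ (- (g ** g))) => //; last exact: subrr.
by have := nonnegD gf ff0; rewrite subrK.
Qed.

(* p is twice the negative part of h. *)
Lemma negative_part h : star h = h -> exists p q, [/\ star p = p, star q = q,
  p ** h ** p = - (q ** q) & (q = 0 -> nonneg e h)].
Proof.
(* [a] is the modulus of [h] and [r] its square root, so that [p h p = - p a p = - (p r)^2]. *)
move=> hE; have [a [a0 aa aC]] := nonneg_sqrt (nonneg_sqr hE).
have [r [[rE _] rr rC]] := nonneg_sqrt a0.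
have ha : h ** a = a ** h by apply: aC; rewrite cmulA.
pose p := a - h; have pE : star p = p by rewrite starB hE a0.1.
have pa : p ** a = a ** p by rewrite cmulBl cmulBr ha.
have pr : p ** r = r ** p by exact: rC.
have hp : h ** p = - (a ** p) by rewrite !cmulBr aa opprB ha.
exists p, (p ** r); split => //.
- by rewrite starM pE rE pr.
- rewrite -cmulA hp cmulNr -rr.
  by rewrite -!cmulA -pr.
move=> pr0; suff p0 : p = 0.
  by move/eqP: p0; rewrite subr_eq0 => /eqP <-.
have ap : a ** p = 0 by rewrite -rr -cmulA -pr pr0 cmul0r.
apply: sqr_sa_eq0 => //.
by rewrite {1}/p cmulBl hp ap oppr0 subrr.
Qed.

(** If [p] and [q] come from the negative part of [h = x^* x], then [y = x p] has
    [y^* y = p h p = - q^2]. By [sqr_eq_nonneg_opp] this forces [q = 0], so there is no negative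
    part. *)
Lemma nonneg_star_mul x : nonneg e (star x ** x).
Proof.
have hE : star (star x ** x) = star x ** x by rewrite starM starK.
have [p [q [pE qE pq]]] := negative_part hE; apply.
apply: sqr_sa_eq0 => //; apply: (@sqr_eq_nonneg_opp (x ** p)).
  exact: nonneg_sqr.
by rewrite starM pE -pq !cmulA.
Qed.

Lemma nonneg_conj h x : nonneg e h -> nonneg e (star x ** h ** x).
Proof.
move=> /nonneg_sqrt[k [[kE _] <- _]].
by have := nonneg_star_mul (k ** x); rewrite starM kE !cmulA.
Qed.

Lemma nonneg_positive h : nonneg e h -> positive h.
Proof. by move=> /nonneg_sqrt[k [[kE _] kk _]]; exists k; rewrite kE. Qed.

End Positivity.

(** * Positivity in an algebra without unit, through its multipliers *)

Section MultiplierEmbedding.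
Variables (R : realType) (B : cstarAlgType R).
Implicit Types (a b c g : B) (h m n : multiplier B).

Definition mult_one : multiplier B := Multiplier (mult_one_dc B).

Lemma mult_oneP : is_unit mult_one. Proof. exact: mult_one_unit. Qed.

Lemma mult_incl_linear : linear (@mult_incl R B).
Proof. by move=> k a b; apply: mult_eql => c /=; rewrite cmulPl. Qed.

Lemma mult_incl_hom : cstar_hom (@mult_incl R B).
Proof.
split; first exact: mult_incl_linear.
- by move=> a b; apply: mult_eql => c /=; rewrite cmulA.
- by move=> a; apply: mult_eql => c /=; rewrite starM starK.
Qed.

Lemma mult_inclD a b : mult_incl (a + b) = mult_incl a + mult_incl b.
Proof. by have := mult_incl_linear 1 a b; rewrite !scale1r. Qed.

Lemma mult_incl0 : mult_incl (0 : B) = 0.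
Proof. by apply: mult_eql => b /=; rewrite cmul0l. Qed.

Lemma mult_inclZ (k : R[i]) a : mult_incl (k *: a) = k *: mult_incl a.
Proof. by have := mult_incl_linear k a 0; rewrite mult_incl0 !addr0. Qed.

Lemma mult_inclB a b : mult_incl (a - b) = mult_incl a - mult_incl b.
Proof. by rewrite mult_inclD -scaleN1r mult_inclZ scaleN1r. Qed.

Lemma mult_inclM a b : mult_incl (a ** b) = mult_incl a ** mult_incl b.
Proof. exact: hom_mul mult_incl_hom _ _. Qed.

Lemma mult_incl_star a : mult_incl (star a) = star (mult_incl a).
Proof. exact: hom_star mult_incl_hom _. Qed.

Lemma mult_incl_norm a : `|mult_incl a| = `|a|.
Proof.
apply/eqP; rewrite eq_le; apply/andP; split.
  by apply: mnorm_le => // b; exact: normM_le.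
by apply: norm_le_cmulr => // b; exact: (lmult_norm (mult_incl a)).
Qed.

Lemma star_lmult m a b : star (lmult m a) ** b = star a ** lmult (star m) b.
Proof. by rewrite -rmult_cmul /= starK. Qed.

Lemma positive_multiplier h : star h = h ->
  (forall b, positive (star b ** lmult h b)) -> positive h.
Proof.
move=> hE hpos; have [p [q [pE qE pq qh]]] := negative_part mult_oneP hE.
apply: (nonneg_positive mult_oneP); apply: qh.
apply: mult_eql => b; have [c cE] := hpos (lmult p b).
(* The hypothesis at [p b] makes [b^* p h p b = - (q b)^* (q b)] positive. Two positive elements
   with sum 0 vanish, so [q b = 0]. *)
have sumE : star c ** c + star (lmult q b) ** lmult q b = 0.
  rewrite -cE !star_lmult pE qE -[lmult p (lmult h _)]/(lmult (p ** h ** p) b) pq.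
  by rewrite -[lmult q (lmult q b)]/(lmult (q ** q) b) /= scaleN1r cmulNr addNr.
apply: cstar_eq0; apply/eqP; rewrite -normr_eq0 -mult_incl_norm normr_eq0.
apply/eqP; apply: (nonnegD_eq0 mult_oneP (g := mult_incl (star c ** c))).
- by rewrite mult_inclM mult_incl_star; exact: nonneg_star_mul mult_oneP _.
- by rewrite mult_inclM mult_incl_star; exact: nonneg_star_mul mult_oneP _.
by rewrite -mult_inclD addrC sumE mult_incl0.
Qed.

(** [B] may lack a unit to compare with, so its order is that of [multiplier B]. As [mult_incl] is
    isometric, the resulting norm estimates hold in [B]. *)
Definition incl_nonneg a := nonneg mult_one (mult_incl a).

Lemma incl_nonneg_positive a : positive a -> incl_nonneg a.
Proof.
move=> [b ->]; rewrite /incl_nonneg mult_inclM mult_incl_star.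
exact: nonneg_star_mul mult_oneP _.
Qed.

Lemma incl_nonneg_mono a b : incl_nonneg a -> incl_nonneg (b - a) -> `|a| <= `|b|.
Proof.
rewrite /incl_nonneg mult_inclB -2!mult_incl_norm => a0 ba.
exact: nonneg_norm_mono mult_oneP _ _ a0 ba.
Qed.

Lemma incl_nonneg_conj (g a : B) : positive g ->
  incl_nonneg (`|g| *: (star a ** a) - star a ** g ** a).
Proof.
move=> /incl_nonneg_positive g0; have [gE _] := g0.
have := nonneg_unitB mult_oneP (normr_ge0 g) gE; rewrite mult_incl_norm.
move=> /(_ (lexx _))/(nonneg_conj mult_oneP (mult_incl a)).
rewrite cmulBr cmulBl cmulZr cmulZl (unit_r mult_oneP).
by rewrite -mult_incl_star -!mult_inclM -mult_inclZ -mult_inclB.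
Qed.

(* With h = s g this says |h (1 - h)^2| <= 1/4, and 0 <= h <= 1. *)
Lemma cubic_le (g : B) (s : R[i]) : positive g -> g != 0 -> s = `|g|^-1 ->
  `|(g - s *: (g ** g)) - s *: (g ** (g - s *: (g ** g)))| <= 4^-1 * `|g|.
Proof.
move=> g0 gn0 sE; have ng : 0 < `|g| by rewrite normr_gt0.
have s0 : 0 <= s by rewrite sE invr_ge0.
set h := mult_incl (s *: g); set e := mult_one.
have h0 : nonneg e h.
  by rewrite /h mult_inclZ; apply: nonnegZ => //; exact: incl_nonneg_positive.
have h1 : `|h| = 1.
  by rewrite /h mult_incl_norm normrZ ger0_norm// sE mulVf// gt_eqF.
have eh0 : nonneg e (e - h).
  have := nonneg_unitB mult_oneP ler01 h0.1.
  by rewrite h1 scale1r => /(_ (lexx _)).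
have eh1 : `|e - h| <= 1.
  apply: (nonneg_norm_le mult_oneP ler01 eh0).
  by rewrite scale1r opprB addrC subrK.
(* The element to be bounded is [|g|] times [(1 - h) w], where the factors have norm at most 1 and
   1/4; the latter since [w = 1/4 - (h - 1/2)^2]. *)
set w := h - h ** h.
have w0 : nonneg e w.
  have [d [[dE _] dd dC]] := nonneg_sqrt mult_oneP eh0.
  have hd : h ** d = d ** h.
    by apply: dC; rewrite cmulBl cmulBr (unit_l mult_oneP) (unit_r mult_oneP).
  have := nonneg_conj mult_oneP d h0.
  by rewrite dE -hd -cmulA dd cmulBr (unit_r mult_oneP).
have w4 : `|w| <= 4^-1.
  apply: (nonneg_norm_le mult_oneP _ w0); first by rewrite invr_ge0.
  have -> : 4^-1 *: e - w = (h - 2^-1 *: e) ** (h - 2^-1 *: e).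
    rewrite cmulBl !cmulBr !cmulZl !cmulZr !(unit_r mult_oneP) !(unit_l mult_oneP).
    rewrite scalerA /w opprB opprB addrCA -addrA; congr (_ + _).
    rewrite [RHS]addrCA -opprD -scalerDl -[2^-1 in X in _ = _ - X]div1r -splitr scale1r.
    by rewrite (_ : 4^-1 = 2^-1 * 2^-1 :> R[i])//; field.
  apply: nonneg_sqr; first exact: mult_oneP.
  by rewrite starB h0.1 (star_scale_unit mult_oneP)// invr_ge0.
have -> : g - s *: (g ** g) - s *: (g ** (g - s *: (g ** g))) =
    `|g| *: (s *: g - s *: g ** (s *: g) - s *: g ** (s *: g - s *: g ** (s *: g))).
  rewrite !scalerBr !cmulZl !cmulZr !cmulBr !scalerBr !cmulZr !scalerA !mulrA sE.
  by rewrite mulfV ?gt_eqF// !mul1r !scale1r.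
rewrite normrZ normr_id mulrC ler_wpM2r// -mult_incl_norm.
rewrite !(mult_inclB, mult_inclM) -/h -/w.
rewrite -[X in X - _](unit_l mult_oneP) -/e -cmulBl (le_trans (normM_le _ _))//.
by rewrite -[leRHS]mul1r ler_pM.
Qed.

End MultiplierEmbedding.

(** * Hilbert modules: Cauchy-Schwarz and approximation *)

Section HilbertModuleTheory.
Variables (R : realType) (B : cstarAlgType R) (N : hilbertModule B).
Implicit Types (phi psi chi : N) (a b : B) (k : R[i]).

Lemma ipDr phi psi chi : ip phi (psi + chi) = ip phi psi + ip phi chi.
Proof. by have := ipPr 1 phi psi chi; rewrite !scale1r. Qed.

Lemma ip0r phi : ip phi 0 = 0.
Proof. by apply: (addrI (ip phi 0)); rewrite -ipDr !addr0. Qed.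

Lemma ipZr k phi psi : ip phi (k *: psi) = k *: ip phi psi.
Proof. by have := ipPr k phi psi 0; rewrite ip0r !addr0. Qed.

Lemma ipBr phi psi chi : ip phi (psi - chi) = ip phi psi - ip phi chi.
Proof. by rewrite ipDr -scaleN1r ipZr scaleN1r. Qed.

Lemma ipDl phi psi chi : ip (psi + chi) phi = ip psi phi + ip chi phi.
Proof. by rewrite -ip_star ipDr starD !ip_star. Qed.

Lemma ipZl k phi psi : ip (k *: phi) psi = k^* *: ip phi psi.
Proof. by rewrite -ip_star ipZr starZ ip_star. Qed.

Lemma ipBl phi psi chi : ip (psi - chi) phi = ip psi phi - ip chi phi.
Proof. by rewrite -ip_star ipBr starB !ip_star. Qed.

Lemma ip_cauchy_schwarz phi psi : `|ip phi psi| <= `|phi| * `|psi|.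
Proof.
set a := ip phi psi.
have [s sE] : exists s, s = `|phi| ^+ 2 by eexists.
have s0 : 0 <= s by rewrite sE exprn_ge0.
have [s00|sn0] := eqVneq s 0.
  have -> : a = 0.
    move/eqP: s00; rewrite /a sE sqrf_eq0 normr_eq0 => /eqP ->.
    by rewrite -ip_star ip0r star0.
  by rewrite normr0 mulr_ge0.
(* Expanding [<chi, chi> >= 0] and bounding [a^* <phi, phi> a] by [s a^* a] leaves
   [s a^* a <= s^2 <psi, psi>]; the norm is monotone on positive elements. *)
pose chi := ract phi a - s *: psi.
have chiE : ip chi chi = star a ** ip phi phi ** a - s *: (star a ** a) -
    (s *: (star a ** a) - (s * s) *: ip psi psi).
  rewrite ipBl !ipBr !ip_ractl !ip_ract !ipZr !ipZl geC0_conj//.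
  by rewrite cmulZl cmulZr scalerA -[ip psi phi]ip_star -/a cmulA.
have := incl_nonneg_conj a (ip_ge0 phi); rewrite -ip_norm -sE.
move=> /(nonnegD (incl_nonneg_positive (ip_ge0 chi))).
rewrite -mult_inclD chiE.
have -> : star a ** ip phi phi ** a - s *: (star a ** a) -
    (s *: (star a ** a) - (s * s) *: ip psi psi) +
    (s *: (star a ** a) - star a ** ip phi phi ** a) =
    (s * s) *: ip psi psi - s *: (star a ** a).
  by rewrite opprB addrC addrA subrKA subrr add0r.
set b := s *: (star a ** a) => sb.
have b0 : incl_nonneg b.
  rewrite /incl_nonneg mult_inclZ; apply: nonnegZ => //.
  by apply: incl_nonneg_positive; exists a.
have := incl_nonneg_mono b0 sb.
rewrite /b !normrZ !(ger0_norm s0) cstar_norm -ip_norm -mulrA.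
by rewrite ler_pM2l ?lt_def ?sn0// sE -exprMn ler_pXn2r ?nnegrE ?mulr_ge0.
Qed.

(** With [g = <psi, psi>] and [s = 1 / |g|], the square of the norm of [psi (1 - s g)] is the norm
    of [g (1 - s g)^2], at most a quarter of [|g|] by [cubic_le]. A factor below 1 is what lets the
    approximation be iterated in [lk_approx_unit]. *)
Lemma ip_near psi : exists2 s : R[i], 0 <= s &
  `|psi - s *: ract psi (ip psi psi)| <= 2^-1 * `|psi|.
Proof.
have [->|psi0] := eqVneq psi 0.
  exists 0; rewrite // scale0r subr0 normr0 mulr0//.
set g := ip psi psi; have gn0 : g != 0.
  by rewrite -normr_eq0 -ip_norm sqrf_eq0 normr_eq0.
have := cubic_le (ip_ge0 psi) gn0 erefl; set s := `|_|^-1 => h.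
have s0 : 0 <= s by rewrite invr_ge0.
exists s => //; rewrite -(@ler_pXn2r _ 2)// ?nnegrE ?mulr_ge0 ?invr_ge0//.
rewrite exprMn !ip_norm ipBl ipZl ip_ractl geC0_conj// ip_star -/g.
rewrite !ipBr !ipZr !ip_ract (le_trans h)//.
by rewrite (_ : 4^-1 = 2^-1 ^+ 2 :> R[i])//; field.
Qed.

End HilbertModuleTheory.

Section AlgebraNear.
Variables (R : realType) (A : cstarAlgType R).

Lemma cstar_near (a : A) : exists2 s : R[i], 0 <= s &
  `|a - s *: (a ** (star a ** a))| <= 2^-1 * `|a|.
Proof.
have [->|a0] := eqVneq a 0.
  by exists 0; rewrite // scale0r subr0 normr0 mulr0.
set g := star a ** a; have gn0 : g != 0.
  by rewrite -normr_eq0 cstar_norm sqrf_eq0 normr_eq0.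
have := cubic_le (ex_intro _ a erefl) gn0 erefl; set s := `|_|^-1 => h.
have s0 : 0 <= s by rewrite invr_ge0.
have gE : star g = g by rewrite starM starK.
exists s => //; rewrite -(@ler_pXn2r _ 2)// ?nnegrE ?mulr_ge0 ?invr_ge0//.
rewrite exprMn -2!cstar_norm -/g starB starZ starM geC0_conj// gE.
rewrite cmulBl cmulZl -cmulA cmulBr cmulZr cmulA -/g (le_trans h)//.
by rewrite (_ : 4^-1 = 2^-1 ^+ 2 :> R[i])//; field.
Qed.

End AlgebraNear.

(** * Homomorphisms of C*-algebras: contractivity and isometry *)

Section CStarHom.
Variables (R : realType) (A A' : cstarAlgType R) (f : A -> A').
Hypothesis f_hom : cstar_hom f.

Lemma cstar_homD a b : f (a + b) = f a + f b.
Proof. by have := hom_linear f_hom 1 a b; rewrite !scale1r. Qed.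

Lemma cstar_hom0 : f 0 = 0.
Proof. by apply: (addrI (f 0)); rewrite -cstar_homD !addr0. Qed.

Lemma cstar_homZ k a : f (k *: a) = k *: f a.
Proof. by rewrite -[k *: a]addr0 (hom_linear f_hom) cstar_hom0 addr0. Qed.

End CStarHom.

Lemma homogeneous_le (R : realType) (V : lmodType R[i]) (p q : V -> R[i]) :
  (forall v, 0 <= p v) -> (forall v, 0 <= q v) ->
  (forall k v, p (k *: v) = `|k| * p v) -> (forall k v, q (k *: v) = `|k| * q v) ->
  (forall v, p v <= 1 -> q v <= 1) -> forall v, q v <= p v.
Proof.
move=> p0 q0 pZ qZ pq v; apply/ler_addgt0Pr => e e0.
(* [p v] may vanish, so [v] is scaled by [p v + e] instead. *)
have pe0 : 0 < p v + e by rewrite ltr_wpDl.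
have := pq ((p v + e)^-1 *: v).
rewrite pZ qZ ger0_norm; last by rewrite invr_ge0 ltW.
rewrite ![_^-1 * _]mulrC !ler_pdivrMr// !mul1r.
by apply; rewrite lerDl ltW.
Qed.

(* (1 - c)^2 = 1 - a^* a bounds the spectrum of a^* a by 1. *)
Lemma half_root_norm_le1 (R : realType) (A : cstarAlgType R) (a c : A) :
  star c = c -> c + c = star a ** a + c ** c -> `|a| <= 1.
Proof.
move=> cE ca; rewrite -(@expr_le1 _ 2)// -cstar_norm -mult_incl_norm.
have U := @mult_oneP R A; apply: (nonneg_norm_le U ler01).
  by apply: incl_nonneg_positive; exists a.
rewrite scale1r -(unit_half_root U (c := mult_incl c)); last first.
  by rewrite -!mult_inclD -mult_inclM -mult_inclD ca.
apply: (nonneg_sqr U).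
by rewrite starB (star_unit U) -mult_incl_star cE.
Qed.

Section HomIsometry.
Variables (R : realType) (A A' : cstarAlgType R) (f : A -> A').
Hypothesis f_hom : cstar_hom f.

Let norm_star_mul_le1 (B : cstarAlgType R) (a : B) : `|a| <= 1 -> `|star a ** a| <= 1.
Proof. by rewrite cstar_norm => ?; rewrite expr_le1. Qed.

Let star_mul_sa (B : cstarAlgType R) (a : B) : star (star a ** a) = star a ** a.
Proof. by rewrite starM starK. Qed.

(** A half root of [a^* a] is an algebraic witness for [|a| <= 1], and [f] carries it to a witness
    for [|f a| <= 1]. *)
Lemma cstar_hom_norm_le a : `|f a| <= `|a|.
Proof.
apply: (homogeneous_le (p := fun a => `|a|) (q := fun a => `|f a|)) => //.
- by move=> k b; rewrite normrZ.
- by move=> k b; rewrite cstar_homZ// normrZ.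
move=> {}a /norm_star_mul_le1/half_root_sa/(_ (star_mul_sa a))[c [cE cS _ _ _]].
apply: (@half_root_norm_le1 _ _ _ (f c)).
  by rewrite -(hom_star f_hom) cS.
by rewrite -cstar_homD// cE cstar_homD// !(hom_mul f_hom) (hom_star f_hom).
Qed.

(** The witness is now pulled back. The iteration for [f (a^* a)] stays in the range of [f], which
    is closed, so its limit has a preimage; injectivity transports the equation to [A]. *)
Lemma cstar_hom_isometry : injective f -> closed (range f) ->
  forall a, `|f a| = `|a|.
Proof.
move=> fI fcl a; apply/eqP; rewrite eq_le cstar_hom_norm_le/=.
apply: (homogeneous_le (p := fun a => `|f a|) (q := fun a => `|a|)) => //.
- by move=> k b; rewrite cstar_homZ// normrZ.
- by move=> k b; rewrite normrZ.
move=> {}a /norm_star_mul_le1/half_root_sa/(_ (star_mul_sa (f a))).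
move=> [c' [cE cS _ _ cR]].
have /fcl[c _ cc'] : closure (range f) c'.
  apply: cR; first by exists 0; rewrite // cstar_hom0.
  move=> _ [x _ <-]; exists (2^-1 *: (star a ** a + x ** x)) => //.
  by rewrite cstar_homZ// cstar_homD// !(hom_mul f_hom) (hom_star f_hom).
move: cE cS; rewrite -cc' => cE cS; apply: (@half_root_norm_le1 _ _ _ c).
  by apply: fI; rewrite (hom_star f_hom) cS.
apply: fI.
by rewrite !cstar_homD// !(hom_mul f_hom) (hom_star f_hom).
Qed.

End HomIsometry.

(** * The linking category and its multipliers *)

Section LeftStructure.
Variables (R : realType) (A B : cstarAlgType R) (N : hilbertModule B).
Variables (la : A -> N -> N) (li : N -> N -> A).

(** A bi-Hilbertian bimodule presented by its two scalar products. The field [kincl] of [biHilbert]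
    concerns all compact operators, for which no formula is at hand, whereas [li] and its laws are
    algebraic; [biHilbert_of] recovers [kincl]. *)
Record left_structure : Prop := LeftStructure {
  left_actPl : forall (k : R[i]) a b psi,
    la (k *: a + b) psi = k *: la a psi + la b psi;
  left_actPr : forall (k : R[i]) a psi phi,
    la a (k *: psi + phi) = k *: la a psi + la a phi;
  left_actM : forall a b psi, la (a ** b) psi = la a (la b psi);
  left_act_ract : forall a psi b, la a (ract psi b) = ract (la a psi) b;
  left_act_adj : forall a, adjoint_of (la a) (la (star a));
  left_ipPl : forall (k : R[i]) phi phi' psi,
    li (k *: phi + phi') psi = k *: li phi psi + li phi' psi;
  left_ip_star : forall phi psi, star (li phi psi) = li psi phi;
  left_ip_act : forall a phi psi, li (la a phi) psi = a ** li phi psi;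
  left_ip_ract : forall phi psi b,
    li (ract phi b) psi = li phi (ract psi (star b));
  left_act_ip : forall phi psi chi, la (li phi psi) chi = ract phi (ip psi chi);
  left_ip_norm : forall psi, `|psi| ^+ 2 = `|li psi psi|
}.

Hypothesis L : left_structure.

Lemma ract_norm (psi : N) b : `|ract psi b| <= `|psi| * `|b|.
Proof.
rewrite -(@ler_pXn2r _ 2)// ?nnegrE ?mulr_ge0// ip_norm ip_ract ip_ractl.
rewrite (le_trans (normM_le _ _))// (le_trans (ler_wpM2r _ (normM_le _ _)))//.
by rewrite norm_star -ip_norm exprMn mulrAC mulrC -expr2.
Qed.

Lemma left_act_norm a psi : `|la a psi| <= `|a| * `|psi|.
Proof.
rewrite -(@ler_pXn2r _ 2)// ?nnegrE ?mulr_ge0// (left_ip_norm L) (left_ip_act L).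
rewrite -(left_ip_star L) (left_ip_act L) starM (left_ip_star L) cmulA.
rewrite (le_trans (normM_le _ _))// (le_trans (ler_wpM2r _ (normM_le _ _)))//.
by rewrite norm_star -(left_ip_norm L) exprMn mulrAC -expr2.
Qed.

(* If <psi, psi> = b^* b then <phi, psi><psi, phi> = <phi b^*, phi b^*>. *)
Lemma left_ip_cauchy_schwarz phi psi : `|li phi psi| <= `|phi| * `|psi|.
Proof.
rewrite -(@ler_pXn2r _ 2)// ?nnegrE ?mulr_ge0// -norm_star -cstar_norm starK.
rewrite (left_ip_star L) -(left_ip_act L) (left_act_ip L).
have [b bE] := ip_ge0 psi; rewrite bE ractM.
rewrite (left_ip_ract L) -(left_ip_norm L).
rewrite ler_pXn2r ?nnegrE ?mulr_ge0// (le_trans (ract_norm _ _))//.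
rewrite ler_wpM2l// norm_star -(@ler_pXn2r _ 2)// ?nnegrE//.
by rewrite ip_norm bE cstar_norm.
Qed.

End LeftStructure.

Local Notation "f \c g" := (lk_comp f g) (at level 40, left associativity).

Section LinkingTheory.
Variables (R : realType) (A B : cstarAlgType R) (M : biHilbert A B).

Lemma biHilbert_left : left_structure (@lact R A B M) (@lip R A B M).
Proof.
split.
- exact: lactPl.
- exact: lactPr.
- exact: lactM.
- exact: lact_ract.
- exact: lact_adj.
- move=> k phi phi' psi; rewrite -kinclP; try exact: compact_theta.
  by congr kincl; apply/funext => chi; exact: ractPl.
- exact: lip_star.
- exact: kincl_lact.
- exact: lip_ract.
- exact: lact_lip.
- exact: kincl_norm.
Qed.

Lemma lk_starP x y (k : R[i]) (f g : lk_arrow M x y) :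
  lk_star (k *: f + g) = k^* *: lk_star f + lk_star g.
Proof.
case: x y f g => [] [] f g /=; try exact: starP; last by [].
by rewrite -[RHS]/(k^*^* *: (f : M) + g) conjCK.
Qed.

Lemma lk_norm_star x y (f : lk_arrow M x y) : `|lk_star f| = `|f|.
Proof. by case: x y f => [] [] f //=; exact: norm_star. Qed.

Lemma lk_compPl x y z (k : R[i]) (f g : lk_arrow M y z) (h : lk_arrow M x y) :
  (k *: f + g) \c h = k *: (f \c h) + g \c h.
Proof.
case: x y z f g h => [] [] [] f g h /=.
- exact: cmulPl.
- exact: ractPl.
- by rewrite ipDl -[k *: f]/(k^* *: (f : M)) ipZl conjCK.
- exact: lactPl.
- rewrite starP -[RHS]/(k^* *: ract (h : M) (star f) + ract (h : M) (star g)).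
  exact: ractPr.
- exact: (left_ipPl biHilbert_left).
- exact: (@lactPr _ _ _ M (k^*)).
- exact: cmulPl.
Qed.

Lemma lk_compPr x y z (k : R[i]) (h : lk_arrow M y z) (f g : lk_arrow M x y) :
  h \c (k *: f + g) = k *: (h \c f) + h \c g.
Proof.
rewrite -[LHS]lk_starK lk_star_comp lk_starP lk_compPl -!lk_star_comp.
by rewrite lk_starP !lk_starK conjCK.
Qed.

Lemma lk_norm_comp x y z (f : lk_arrow M y z) (g : lk_arrow M x y) :
  `|f \c g| <= `|f| * `|g|.
Proof.
case: x y z f g => [] [] [] f g /=; try exact: normM_le.
- exact: ract_norm.
- exact: ip_cauchy_schwarz.
- exact: (left_act_norm biHilbert_left).
- by rewrite mulrC -[`|f|]norm_star; exact: ract_norm.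
- exact: (left_ip_cauchy_schwarz biHilbert_left).
- by rewrite mulrC -[`|g|]norm_star; exact: (left_act_norm biHilbert_left).
Qed.

Lemma lk_near x y (f : lk_arrow M x y) : exists2 s : R[i], 0 <= s &
  `|f - s *: (f \c (lk_star f \c f))| <= 2^-1 * `|f|.
Proof.
case: x y f => [] [] f /=; try exact: cstar_near.
  exact: ip_near.
have [s s0 sf] := ip_near (f : M); exists s => //.
rewrite lip_star lact_lip.
by rewrite -[s *: _]/(s^* *: ract (f : M) (ip (f : M) f)) geC0_conj.
Qed.

End LinkingTheory.

(** * Separation of arrows by endomorphisms *)

Section LinkingSeparation.
Variables (R : realType) (A B : cstarAlgType R) (M : biHilbert A B).

Lemma lk_compDl x y z (f g : lk_arrow M y z) (h : lk_arrow M x y) :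
  (f + g) \c h = f \c h + g \c h.
Proof. by rewrite -[f in LHS]scale1r lk_compPl scale1r. Qed.

Lemma lk_comp0l x y z (h : lk_arrow M x y) : (0 : lk_arrow M y z) \c h = 0.
Proof. by apply: (addrI (0 \c h)); rewrite -lk_compDl !addr0. Qed.

Lemma lk_compZl x y z k (f : lk_arrow M y z) (h : lk_arrow M x y) :
  (k *: f) \c h = k *: (f \c h).
Proof. by rewrite -[k *: f]addr0 lk_compPl lk_comp0l addr0. Qed.

Lemma lk_compBl x y z (f g : lk_arrow M y z) (h : lk_arrow M x y) :
  (f - g) \c h = f \c h - g \c h.
Proof. by rewrite lk_compDl -scaleN1r lk_compZl scaleN1r. Qed.

Lemma lk_compDr x y z (h : lk_arrow M y z) (f g : lk_arrow M x y) :
  h \c (f + g) = h \c f + h \c g.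
Proof. by rewrite -[f in LHS]scale1r lk_compPr scale1r. Qed.

Lemma lk_comp0r x y z (h : lk_arrow M y z) : h \c (0 : lk_arrow M x y) = 0.
Proof. by apply: (addrI (h \c 0)); rewrite -lk_compDr !addr0. Qed.

Lemma lk_compZr x y z k (h : lk_arrow M y z) (f : lk_arrow M x y) :
  h \c (k *: f) = k *: (h \c f).
Proof. by rewrite -[k *: f]addr0 lk_compPr lk_comp0r addr0. Qed.

Lemma lk_compBr x y z (h : lk_arrow M y z) (f g : lk_arrow M x y) :
  h \c (f - g) = h \c f - h \c g.
Proof. by rewrite lk_compDr -scaleN1r lk_compZr scaleN1r. Qed.

(** Two uses of the C*-identity: [|f|^4] is the norm of [(f^* f)^2], which is [f^*] composed with
    [f f^* f]. It lets an arrow be tested against a single endomorphism, [f f^*]. *)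
Lemma lk_norm_cube x y (f : lk_arrow M x y) :
  `|f| ^+ 3 <= `|f \c lk_star f \c f|.
Proof.
have [->|f0] := eqVneq f 0; first by rewrite normr0 expr0n.
rewrite -(ler_pM2l (_ : 0 < `|f|)) ?normr_gt0// -exprS.
rewrite -[4%N]/(2 * 2)%N exprM -lk_cstar_norm -lk_cstar_norm.
rewrite lk_star_comp lk_starK -lk_compA (le_trans (lk_norm_comp _ _))//.
by rewrite lk_norm_star lk_compA.
Qed.

Lemma lk_norm_le_endol x y (f : lk_arrow M x y) (r : R[i]) : 0 <= r ->
  (forall g : lk_arrow M y y, `|g \c f| <= r * `|g|) -> `|f| <= r.
Proof.
move=> r0 h; have [->|f0] := eqVneq f 0; first by rewrite normr0.
rewrite -(ler_pM2r (_ : 0 < `|f| ^+ 2)) ?exprn_gt0 ?normr_gt0// -exprS.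
rewrite (le_trans (lk_norm_cube f))// (le_trans (h _))// ler_wpM2l//.
by rewrite (le_trans (lk_norm_comp _ _))// lk_norm_star.
Qed.

Lemma lk_norm_le_endor x y (f : lk_arrow M x y) (r : R[i]) : 0 <= r ->
  (forall g : lk_arrow M x x, `|f \c g| <= r * `|g|) -> `|f| <= r.
Proof.
move=> r0 h; rewrite -lk_norm_star; apply: lk_norm_le_endol => // g.
by rewrite -lk_norm_star lk_star_comp lk_starK (le_trans (h _))// lk_norm_star.
Qed.

Lemma lk_sepl x y (f g : lk_arrow M x y) :
  (forall h : lk_arrow M y y, h \c f = h \c g) -> f = g.
Proof.
move=> h; apply/eqP; rewrite -subr_eq0 -normr_le0.
by apply: lk_norm_le_endol => // k; rewrite lk_compBr h subrr normr0 mul0r.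
Qed.

Lemma lk_sepr x y (f g : lk_arrow M x y) :
  (forall h : lk_arrow M x x, f \c h = g \c h) -> f = g.
Proof.
move=> h; apply/eqP; rewrite -subr_eq0 -normr_le0.
by apply: lk_norm_le_endor => // k; rewrite lk_compBl h subrr normr0 mul0r.
Qed.

End LinkingSeparation.

(** * The multiplier category: its normed arrow spaces, composition and star *)

Section MultiplierArrows.
Variables (R : realType) (A B : cstarAlgType R) (M : biHilbert A B).

(* An arrow x -> y of the multiplier category, that is, a double centralizer of
   the linking category: maL f stands for m f and maR g for g m. *)
Record mult_arrow (x y : two_obj) := MultArrow {
  maL : forall w, lk_arrow M w x -> lk_arrow M w y;
  maR : forall z, lk_arrow M y z -> lk_arrow M x z;
  maP : forall w z (g : lk_arrow M y z) (f : lk_arrow M w x),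
    g \c maL f = maR g \c f;
  maB : exists2 k : R[i], 0 <= k &
    forall w (f : lk_arrow M w x), `|maL f| <= k * `|f|
}.

HB.instance Definition _ x y := gen_eqMixin (mult_arrow x y).
HB.instance Definition _ x y := gen_choiceMixin (mult_arrow x y).

Lemma ma_eq x y (m n : mult_arrow x y) :
  (forall w (f : lk_arrow M w x), maL m f = maL n f) -> m = n.
Proof.
move=> mn; have mn' z (g : lk_arrow M y z) : maR m g = maR n g.
  by apply: lk_sepr => h; rewrite -!maP mn.
case: m n mn mn' => [L T P Q] [L' T' P' Q'] /= e e'.
have ? : L = L' by apply: functional_extensionality_dep => w; apply/funext.
have ? : T = T' by apply: functional_extensionality_dep => w; apply/funext.
by subst; congr MultArrow; exact: Prop_irrelevance.
Qed.

(** [maP] alone forces linearity: seen through any [h], [maL m] is composition with [maR m h].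
    Compatibility with composition follows likewise. *)
Lemma maLP x y (m : mult_arrow x y) w k (f g : lk_arrow M w x) :
  maL m (k *: f + g) = k *: maL m f + maL m g.
Proof.
by apply: lk_sepl => h; rewrite maP lk_compPr -!maP lk_compPr.
Qed.

Lemma maL0 x y (m : mult_arrow x y) w : maL m (0 : lk_arrow M w x) = 0.
Proof. by apply: lk_sepl => h; rewrite maP !lk_comp0r. Qed.

Lemma maLZ x y (m : mult_arrow x y) w k (f : lk_arrow M w x) :
  maL m (k *: f) = k *: maL m f.
Proof. by rewrite -[k *: f]addr0 maLP maL0 addr0. Qed.

Lemma maL_comp x y (m : mult_arrow x y) v w (f : lk_arrow M w x)
    (g : lk_arrow M v w) : maL m (f \c g) = maL m f \c g.
Proof. by apply: lk_sepl => h; rewrite maP !lk_compA -maP. Qed.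

Lemma maRP x y (m : mult_arrow x y) z k (f g : lk_arrow M y z) :
  maR m (k *: f + g) = k *: maR m f + maR m g.
Proof.
by apply: lk_sepr => h; rewrite -maP lk_compPl !maP lk_compPl.
Qed.

Lemma maR_bound x y (m : mult_arrow x y) z (g : lk_arrow M y z) (k : R[i]) :
  0 <= k -> (forall w (f : lk_arrow M w x), `|maL m f| <= k * `|f|) ->
  `|maR m g| <= k * `|g|.
Proof.
move=> k0 mk; apply: lk_norm_le_endor => [|f]; first exact: mulr_ge0.
rewrite -maP (le_trans (lk_norm_comp _ _))// [k * _]mulrC -mulrA ler_wpM2l// mk.
Qed.

Fact ma_add_subproof x y (m n : mult_arrow x y) w z (g : lk_arrow M y z)
  (f : lk_arrow M w x) : g \c (maL m f + maL n f) = (maR m g + maR n g) \c f.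
Proof. by rewrite lk_compDr lk_compDl !maP. Qed.

Fact ma_add_bound x y (m n : mult_arrow x y) : exists2 k : R[i], 0 <= k &
  forall w (f : lk_arrow M w x), `|maL m f + maL n f| <= k * `|f|.
Proof.
have [k k0 kP] := maB m; have [l l0 lP] := maB n.
exists (k + l) => [|w f]; first exact: addr_ge0.
by rewrite (le_trans (ler_normD _ _))// mulrDl lerD.
Qed.

Definition ma_add x y (m n : mult_arrow x y) : mult_arrow x y :=
  MultArrow (ma_add_subproof m n) (ma_add_bound m n).

Fact ma_scale_subproof x y k (m : mult_arrow x y) w z (g : lk_arrow M y z)
  (f : lk_arrow M w x) : g \c (k *: maL m f) = (k *: maR m g) \c f.
Proof. by rewrite lk_compZr lk_compZl maP. Qed.

Fact ma_scale_bound x y k (m : mult_arrow x y) : exists2 l : R[i], 0 <= l &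
  forall w (f : lk_arrow M w x), `|k *: maL m f| <= l * `|f|.
Proof.
have [l l0 lP] := maB m; exists (`|k| * l) => [|w f]; first exact: mulr_ge0.
by rewrite normrZ -mulrA ler_wpM2l// lP.
Qed.

Definition ma_scale x y k (m : mult_arrow x y) : mult_arrow x y :=
  MultArrow (@ma_scale_subproof x y k m) (ma_scale_bound k m).

Fact ma_zero_subproof x y w z (g : lk_arrow M y z) (f : lk_arrow M w x) :
  g \c (0 : lk_arrow M w y) = (0 : lk_arrow M x z) \c f.
Proof. by rewrite lk_comp0r lk_comp0l. Qed.

Fact ma_zero_bound x y : exists2 k : R[i], 0 <= k &
  forall w (f : lk_arrow M w x), `|0 : lk_arrow M w y| <= k * `|f|.
Proof. by exists 0 => // w f; rewrite normr0 mul0r. Qed.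

Definition ma_zero x y : mult_arrow x y :=
  @MultArrow x y (fun w _ => 0) (fun z _ => 0) (@ma_zero_subproof x y)
    (ma_zero_bound x y).

Section Zmod.
Variables x y : two_obj.
Implicit Types m n p : mult_arrow x y.

Fact ma_addA : associative (@ma_add x y).
Proof. by move=> m n p; apply: ma_eq => w f /=; rewrite addrA. Qed.
Fact ma_addC : commutative (@ma_add x y).
Proof. by move=> m n; apply: ma_eq => w f /=; rewrite addrC. Qed.
Fact ma_add0 : left_id (ma_zero x y) (@ma_add x y).
Proof. by move=> m; apply: ma_eq => w f /=; rewrite add0r. Qed.
Fact ma_addN : left_inverse (ma_zero x y) (ma_scale (-1)) (@ma_add x y).
Proof. by move=> m; apply: ma_eq => w f /=; rewrite scaleN1r addNr. Qed.

HB.instance Definition _ :=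
  GRing.isZmodule.Build (mult_arrow x y) ma_addA ma_addC ma_add0 ma_addN.

Fact ma_scaleA k l m : ma_scale k (ma_scale l m) = ma_scale (k * l) m.
Proof. by apply: ma_eq => w f /=; rewrite scalerA. Qed.
Fact ma_scale1 : left_id 1 (@ma_scale x y).
Proof. by move=> m; apply: ma_eq => w f /=; rewrite scale1r. Qed.
Fact ma_scaleDr : right_distributive (@ma_scale x y) +%R.
Proof. by move=> k m n; apply: ma_eq => w f /=; rewrite scalerDr. Qed.
Fact ma_scaleDl m : {morph (@ma_scale x y)^~ m : k l / k + l}.
Proof. by move=> k l; apply: ma_eq => w f /=; rewrite scalerDl. Qed.

HB.instance Definition _ := GRing.Zmodule_isLmodule.Build R[i] (mult_arrow x y)
  ma_scaleA ma_scale1 ma_scaleDr ma_scaleDl.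

Definition ma_ball_norms m : set R :=
  [set r | exists w (f : lk_arrow M w x), `|f| <= 1 /\ r = complex.Re `|maL m f|].

Definition ma_norm m : R[i] := cofR (sup (ma_ball_norms m)).

Lemma ma_has_sup m : has_sup (ma_ball_norms m).
Proof.
split; first by exists (complex.Re `|maL m (0 : lk_arrow M x x)|), x, 0; rewrite normr0.
have [k k0 kP] := maB m; exists (complex.Re k) => _ [w [f [f1 ->]]].
by rewrite -leCR !Defs.ReE// (le_trans (kP _ f))// ler_piMr.
Qed.

Lemma ma_norm_ge0 m : 0 <= ma_norm m.
Proof.
rewrite /ma_norm -[0]/(cofR 0) leCR.
apply: (le_trans _ (ub_le_sup (ma_has_sup m).2 _)); last first.
  by exists x, 0; rewrite normr0.
by rewrite -leCR Defs.ReE//; exact: normr_ge0.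
Qed.

Lemma ma_norm_bound m w (f : lk_arrow M w x) : `|maL m f| <= ma_norm m * `|f|.
Proof.
have [->|f0] := eqVneq f 0; first by rewrite maL0 !normr0 mulr0.
have nf : 0 < `|f| by rewrite normr_gt0.
rewrite -ler_pdivrMr// mulrC.
have -> : `|f|^-1 * `|maL m f| = `|maL m (`|f|^-1 *: f)|.
  by rewrite maLZ normrZ ger0_norm// invr_ge0.
rewrite -[leLHS]Defs.ReE// leCR; apply: ub_le_sup; first exact: (ma_has_sup m).2.
exists w, (`|f|^-1 *: f); split => //.
by rewrite normrZ ger0_norm ?invr_ge0// mulVf// gt_eqF.
Qed.

Lemma ma_norm_le m (r : R[i]) : 0 <= r ->
  (forall w (f : lk_arrow M w x), `|maL m f| <= r * `|f|) -> ma_norm m <= r.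
Proof.
move=> r0 mr; rewrite -(Defs.ReE r0) leCR; apply: ge_sup.
  exact: (ma_has_sup m).1.
move=> _ [w [f [f1 ->]]]; rewrite -leCR !Defs.ReE//.
by rewrite (le_trans (mr _ f))// ler_piMr.
Qed.

Fact ma_normD m n : ma_norm (m + n) <= ma_norm m + ma_norm n.
Proof.
apply: ma_norm_le => [|w f]; first by rewrite addr_ge0 ?ma_norm_ge0.
by rewrite mulrDl (le_trans (ler_normD _ _))// lerD ?ma_norm_bound.
Qed.

Fact ma_normZ_le k m : ma_norm (k *: m) <= `|k| * ma_norm m.
Proof.
apply: ma_norm_le => [|w f]; first by rewrite mulr_ge0 ?ma_norm_ge0.
by rewrite normrZ -mulrA ler_wpM2l ?ma_norm_bound.
Qed.

Fact ma_normZ k m : ma_norm (k *: m) = `|k| * ma_norm m.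
Proof.
have [->|k0] := eqVneq k 0.
  apply/eqP; rewrite eq_le ma_normZ_le normr0 mul0r.
  exact: ma_norm_ge0.
apply/eqP; rewrite eq_le ma_normZ_le -ler_pdivlMl ?normr_gt0//.
by rewrite -normfV -{1}[m](scalerK k0) ma_normZ_le.
Qed.

Fact ma_norm_eq0 m : ma_norm m = 0 -> m = 0.
Proof.
move=> m0; apply: ma_eq => w f; apply/eqP; rewrite -normr_le0.
by rewrite (le_trans (ma_norm_bound m f))// m0 mul0r.
Qed.

HB.instance Definition _ :=
  Lmodule_isNormed.Build R[i] (mult_arrow x y) ma_normD ma_normZ ma_norm_eq0.

Lemma maL_norm m w (f : lk_arrow M w x) : `|maL m f| <= `|m| * `|f|.
Proof. exact: ma_norm_bound. Qed.

Lemma maR_norm m z (g : lk_arrow M y z) : `|maR m g| <= `|m| * `|g|.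
Proof. by apply: maR_bound => // w f; exact: maL_norm. Qed.

Lemma maB_L m n w (f : lk_arrow M w x) : maL m f - maL n f = maL (m - n) f.
Proof. by rewrite /= scaleN1r. Qed.

Lemma maB_R m n z (g : lk_arrow M y z) : maR m g - maR n g = maR (m - n) g.
Proof. by rewrite /= scaleN1r. Qed.

Fact ma_complete (F : set_system (mult_arrow x y)) :
  ProperFilter F -> cauchy F -> cvg F.
Proof.
move=> FF /cauchy_ballP Fc; apply/cvg_ex.
have Fd (e : R[i]) : 0 < e ->
    exists m, \forall n \near F, `|m - n| <= e.
  move=> e0; have : \forall m & n \near F, `|m - n| < e.
    by have := Fc e e0; rewrite near_simpl -ball_normE.
  move=> /nearP_dep/filter_ex[m mP]; exists m.
  by apply: filterS mP => n /ltW.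
(* [g] stands for the evaluation of [maL] or [maR] at a fixed arrow of norm [c]. The estimate is
   proportional to [c], so the pointwise limits are limits in the operator norm. *)
have lim (V : completeNormedModType R[i]) (g : mult_arrow x y -> V) (c : R[i]) :
    0 <= c -> (forall m n, `|g m - g n| <= `|m - n| * c) ->
    exists l, forall m e, 0 <= e -> (\forall n \near F, `|m - n| <= e) ->
      `|l - g m| <= e * c.
  move=> c0 gc; have [||l lP] := @net_limit R V
    (fun e v => \forall n \near F, `|g n - v| <= e).
  - move=> e e0; have [|m mP] := Fd (e / (c + 1)).
      by rewrite divr_gt0// ltr_wpDl.
    exists (g m); apply: filterS mP => n mn.
    rewrite distrC (le_trans (gc _ _))// (le_trans (ler_wpM2r _ mn))//.
    by rewrite mulrAC ler_pdivrMr ?ltr_wpDl// ler_wpM2l ?(ltW e0)// lerDl.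
  - move=> e d v w ve wd; have [n [nv nw]] := filter_ex (filterI ve wd).
    by rewrite (le_trans (ler_distD (g n) _ _))// lerD// distrC.
  exists l => m e e0 mP; rewrite distrC; apply: lP.
  apply: filterS mP => n mn.
  by rewrite distrC (le_trans (gc _ _))// ler_wpM2r.
have Lex w (f : lk_arrow M w x) := lim _ (fun m => maL m f) `|f| (normr_ge0 f)
  (fun m n => eq_ind_r (fun v => `|v| <= _) (maL_norm _ f) (maB_L m n f)).
have Rex z (g : lk_arrow M y z) := lim _ (fun m => maR m g) `|g| (normr_ge0 g)
  (fun m n => eq_ind_r (fun v => `|v| <= _) (maR_norm _ g) (maB_R m n g)).
pose L w f := projT1 (cid (Lex w f)); pose T z g := projT1 (cid (Rex z g)).
have LE m e : 0 <= e -> (\forall n \near F, `|m - n| <= e) ->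
    forall w f, `|L w f - maL m f| <= e * `|f|.
  by move=> e0 me w f; rewrite /L; case: cid => l /= /(_ m e e0 me).
have TE m e : 0 <= e -> (\forall n \near F, `|m - n| <= e) ->
    forall z g, `|T z g - maR m g| <= e * `|g|.
  by move=> e0 me z g; rewrite /T; case: cid => l /= /(_ m e e0 me).
have LT w z (g : lk_arrow M y z) (f : lk_arrow M w x) : g \c L w f = T z g \c f.
  apply/eqP; rewrite -subr_eq0; apply/eqP.
  apply: (@norm_small0 _ _ _ (2 * (`|g| * `|f|))); first by rewrite !mulr_ge0.
  move=> e e0; have [m mP] := Fd e e0.
  have -> : g \c L w f - T z g \c f =
      g \c (L w f - maL m f) - (T z g - maR m g) \c f.
    by rewrite lk_compBr lk_compBl maP opprB addrA subrK.
  rewrite (le_trans (ler_normB _ _))// -mulrA mulr_natl mulr2n lerD//.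
    rewrite (le_trans (lk_norm_comp _ _))// -mulrA ler_wpM2l// mulrC.
    exact: LE (ltW e0) mP _ _.
  rewrite (le_trans (lk_norm_comp _ _))// [_ * e]mulrC mulrA ler_wpM2r//.
  exact: TE (ltW e0) mP _ _.
have [m0 m0P] := Fd 1 ltr01.
have LB : exists2 k : R[i], 0 <= k & forall w f, `|L w f| <= k * `|f|.
  exists (1 + `|m0|) => [|w f]; first by rewrite addr_ge0.
  rewrite mulrDl -[L w f](subrK (maL m0 f)) (le_trans (ler_normD _ _))//.
  by rewrite lerD ?maL_norm// (LE _ _ ler01 m0P).
exists (MultArrow LT LB); apply/cvgrPdist_lt => e e0.
have e4 : 0 < e / 4 by rewrite divr_gt0.
have [m mP] := Fd _ e4.
have lm : `|MultArrow LT LB - m| <= e / 4.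
  apply: ma_norm_le => [|w f]; first exact: ltW.
  by rewrite -maB_L/=; exact: LE (ltW e4) mP _ _.
apply: filterS mP => n mn; rewrite (le_lt_trans (ler_distD m _ _))//.
rewrite (le_lt_trans (lerD lm mn))// (_ : e / 4 + e / 4 = e / 2); last by field.
by rewrite gtr_pMr// invf_lt1// ltr1n.
Qed.

HB.instance Definition _ := Uniform_isComplete.Build (mult_arrow x y) ma_complete.

End Zmod.

Fact ma_comp_subproof x y z (m : mult_arrow y z) (n : mult_arrow x y) u v
  (g : lk_arrow M z v) (f : lk_arrow M u x) :
  g \c maL m (maL n f) = maR n (maR m g) \c f.
Proof. by rewrite !maP. Qed.

Fact ma_comp_bound x y z (m : mult_arrow y z) (n : mult_arrow x y) :
  exists2 k : R[i], 0 <= k &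
  forall w (f : lk_arrow M w x), `|maL m (maL n f)| <= k * `|f|.
Proof.
exists (`|m| * `|n|) => [|w f]; first exact: mulr_ge0.
by rewrite (le_trans (maL_norm _ _))// -mulrA ler_wpM2l ?maL_norm.
Qed.

Definition ma_comp x y z (m : mult_arrow y z) (n : mult_arrow x y) : mult_arrow x z :=
  MultArrow (ma_comp_subproof m n) (ma_comp_bound m n).

Fact ma_star_subproof x y (m : mult_arrow x y) w z (g : lk_arrow M x z)
  (f : lk_arrow M w y) :
  g \c lk_star (maR m (lk_star f)) = lk_star (maL m (lk_star g)) \c f.
Proof.
by rewrite -[LHS]lk_starK lk_star_comp lk_starK -maP lk_star_comp lk_starK.
Qed.

Fact ma_star_bound x y (m : mult_arrow x y) : exists2 k : R[i], 0 <= k &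
  forall w (f : lk_arrow M w y), `|lk_star (maR m (lk_star f))| <= k * `|f|.
Proof.
by exists `|m| => // w f; rewrite lk_norm_star -(lk_norm_star f) maR_norm.
Qed.

(** [m^* f = (f^* m)^*] and [g m^* = (m g^* )^*]. *)
Definition ma_star x y (m : mult_arrow x y) : mult_arrow y x :=
  MultArrow (ma_star_subproof m) (ma_star_bound m).

Lemma ma_compA w x y z (m : mult_arrow y z) (n : mult_arrow x y)
    (p : mult_arrow w x) : ma_comp m (ma_comp n p) = ma_comp (ma_comp m n) p.
Proof. exact: ma_eq. Qed.

Lemma ma_compPl x y z k (m n : mult_arrow y z) (p : mult_arrow x y) :
  ma_comp (k *: m + n) p = k *: ma_comp m p + ma_comp n p.
Proof. exact: ma_eq. Qed.

Lemma ma_compPr x y z k (p : mult_arrow y z) (m n : mult_arrow x y) :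
  ma_comp p (k *: m + n) = k *: ma_comp p m + ma_comp p n.
Proof. by apply: ma_eq => w f /=; rewrite maLP. Qed.

Lemma ma_starP x y k (m n : mult_arrow x y) :
  ma_star (k *: m + n) = k^* *: ma_star m + ma_star n.
Proof. by apply: ma_eq => w f /=; rewrite lk_starP. Qed.

Lemma ma_starK x y (m : mult_arrow x y) : ma_star (ma_star m) = m.
Proof. by apply: ma_eq => w f /=; rewrite !lk_starK. Qed.

Lemma ma_star_comp x y z (m : mult_arrow y z) (n : mult_arrow x y) :
  ma_star (ma_comp m n) = ma_comp (ma_star n) (ma_star m).
Proof. by apply: ma_eq => w f /=; rewrite lk_starK. Qed.

Lemma ma_norm_comp x y z (m : mult_arrow y z) (n : mult_arrow x y) :
  `|ma_comp m n| <= `|m| * `|n|.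
Proof.
apply: ma_norm_le => [|w f /=]; first exact: mulr_ge0.
by rewrite (le_trans (maL_norm _ _))// -mulrA ler_wpM2l ?maL_norm.
Qed.

Lemma ma_norm_star x y (m : mult_arrow x y) : `|ma_star m| = `|m|.
Proof.
have H u v (n : mult_arrow u v) : `|ma_star n| <= `|n|.
  apply: ma_norm_le => // w f /=.
  by rewrite lk_norm_star -(lk_norm_star f) maR_norm.
by apply/eqP; rewrite eq_le H -{1}(ma_starK m) H.
Qed.

Lemma maL_star x y (m : mult_arrow x y) w (f : lk_arrow M w x) :
  lk_star (maL m f) = maR (ma_star m) (lk_star f).
Proof. by rewrite /= lk_starK. Qed.

(** [|m f|^2] is the norm of [f^*] composed with [m^* m f], so the square root of [|m^* m|] bounds
    [m]. *)
Lemma ma_cstar_norm x y (m : mult_arrow x y) :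
  `|ma_comp (ma_star m) m| = `|m| ^+ 2.
Proof.
apply/eqP; rewrite eq_le (le_trans (ma_norm_comp _ _)) ?ma_norm_star ?expr2//=.
set r := `|ma_comp _ _|; rewrite -expr2.
have r0 : 0 <= r by exact: normr_ge0.
rewrite -[leRHS]sqrtCK; apply: lerXn2r; rewrite ?nnegrE ?sqrtC_ge0//.
apply: ma_norm_le => [|w f]; first by rewrite sqrtC_ge0.
rewrite -(@ler_pXn2r _ 2) ?nnegrE ?mulr_ge0 ?sqrtC_ge0// exprMn sqrtCK.
rewrite -lk_cstar_norm maL_star -maP.
rewrite (le_trans (lk_norm_comp _ _))// lk_norm_star expr2 mulrCA.
by rewrite ler_wpM2l// -[maL _ _]/(maL (ma_comp (ma_star m) m) f) maL_norm.
Qed.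

Fact ma_incl_bound x y (g : lk_arrow M x y) : exists2 k : R[i], 0 <= k &
  forall w (f : lk_arrow M w x), `|g \c f| <= k * `|f|.
Proof. by exists `|g| => // w f; exact: lk_norm_comp. Qed.

Fact ma_incl_subproof x y (h : lk_arrow M x y) w z (g : lk_arrow M y z)
  (f : lk_arrow M w x) : g \c (h \c f) = (g \c h) \c f.
Proof. exact: lk_compA. Qed.

Definition ma_incl x y (g : lk_arrow M x y) : mult_arrow x y :=
  MultArrow (ma_incl_subproof g) (ma_incl_bound g).

Lemma ma_incl_comp x y z (f : lk_arrow M y z) (g : lk_arrow M x y) :
  ma_incl (f \c g) = ma_comp (ma_incl f) (ma_incl g).
Proof. by apply: ma_eq => w h /=; rewrite lk_compA. Qed.

Lemma ma_comp_incl x y z (m : mult_arrow y z) (g : lk_arrow M x y) :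
  ma_comp m (ma_incl g) = ma_incl (maL m g).
Proof. by apply: ma_eq => w h /=; rewrite maL_comp. Qed.

Lemma ma_inclP x y k (f g : lk_arrow M x y) :
  ma_incl (k *: f + g) = k *: ma_incl f + ma_incl g.
Proof. by apply: ma_eq => w h /=; rewrite lk_compPl. Qed.

Lemma ma_incl_star x y (f : lk_arrow M x y) :
  ma_incl (lk_star f) = ma_star (ma_incl f).
Proof. by apply: ma_eq => w h /=; rewrite lk_star_comp lk_starK. Qed.

Lemma ma_incl_norm x y (f : lk_arrow M x y) : `|ma_incl f| = `|f|.
Proof.
apply/eqP; rewrite eq_le; apply/andP; split.
  by apply: ma_norm_le => // w g; exact: lk_norm_comp.
by apply: lk_norm_le_endor => // g; exact: (maL_norm (ma_incl f)).
Qed.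

End MultiplierArrows.

(** * Extension of multipliers from endomorphisms to all arrows *)

Section Extension.
Variables (R : realType) (A B : cstarAlgType R) (M : biHilbert A B).

(** If [a] leaves the residue [r = f - a f], take [b = s r r^*]. Since
    [1 - (a + b - b a) = (1 - b) (1 - a)], the new residue is [r - b r], at most half as large by
    [lk_near]. *)
Lemma lk_approx_unit w x (f : lk_arrow M w x) (e : R[i]) : 0 < e ->
  exists a : lk_arrow M x x, `|f - a \c f| <= e.
Proof.
move=> e0; suff h n : exists a : lk_arrow M x x, `|f - a \c f| <= 2^-1 ^+ n * `|f|.
  have [n ne] := half_pow_small (normr_ge0 f) e0; have [a af] := h n.
  by exists a; exact: le_trans af ne.
elim: n => [|n [a ih]]; first by exists 0; rewrite lk_comp0l subr0 mul1r.
pose r := f - a \c f; have [s _ sr] := lk_near r.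
pose b := s *: (r \c lk_star r); exists (a + (b - b \c a)).
have -> : f - (a + (b - b \c a)) \c f = r - s *: (r \c (lk_star r \c r)).
  rewrite lk_compA -lk_compZl -/b lk_compDl lk_compBl -lk_compA -lk_compBr -/r.
  by rewrite opprD addrA.
by rewrite (le_trans sr)// exprS -mulrA ler_wpM2l ?invr_ge0.
Qed.

(** The values on endomorphisms fix [maR m] by separation, and [maR m] in turn fixes [maL m] on
    every arrow. *)
Lemma ma_eq_endo x y (m n : mult_arrow M x y) :
  (forall f : lk_arrow M x x, maL m f = maL n f) -> m = n.
Proof.
move=> mn; apply: ma_eq => w f; apply: lk_sepl => h; rewrite !maP.
by congr (_ \c _); apply: lk_sepr => g; rewrite -!maP mn.
Qed.

Lemma ma_norm_le_endo x y (m : mult_arrow M x y) (r : R[i]) : 0 <= r ->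
  (forall f : lk_arrow M x x, `|maL m f| <= r * `|f|) -> `|m| <= r.
Proof.
move=> r0 mr; apply: ma_norm_le => // w f.
apply: lk_norm_le_endol => [|g]; first exact: mulr_ge0.
rewrite maP (le_trans (lk_norm_comp _ _))// mulrAC ler_wpM2r//.
apply: lk_norm_le_endor => [|h]; first exact: mulr_ge0.
by rewrite -maP (le_trans (lk_norm_comp _ _))// [r * _]mulrC -mulrA ler_wpM2l.
Qed.

Lemma maR_comp x y (m : mult_arrow M x y) v w (f : lk_arrow M v w)
    (g : lk_arrow M y v) : maR m (f \c g) = f \c maR m g.
Proof. by apply: lk_sepr => h; rewrite -maP -!lk_compA maP. Qed.

(* L w f is the limit of (L a) f over the a with a f close to f. *)
Lemma left_extension x (L T : lk_arrow M x x -> lk_arrow M x x) (k : R[i]) :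
  0 <= k -> (forall f g, g \c L f = T g \c f) -> (forall f, `|L f| <= k * `|f|) ->
  forall w (f : lk_arrow M w x), exists h : lk_arrow M w x,
    (forall g : lk_arrow M x x, g \c h = T g \c f) /\
    (forall a : lk_arrow M x x, `|h - L a \c f| <= k * `|f - a \c f|).
Proof.
move=> k0 LT Lk w f.
have Tk g : `|T g| <= k * `|g|.
  apply: lk_norm_le_endor => [|h]; first exact: mulr_ge0.
  rewrite -LT (le_trans (lk_norm_comp _ _))// [k * _]mulrC -mulrA ler_wpM2l//.
(* Formally [d = L r]. This one bound serves both for the Cauchy estimate and for the distance of
   [h] from [L a f]. *)
have Tr (d r : lk_arrow M w x) : (forall g : lk_arrow M x x, g \c d = T g \c r) ->
    `|d| <= k * `|r|.
  move=> dr; apply: lk_norm_le_endol => [|g]; first exact: mulr_ge0.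
  by rewrite dr (le_trans (lk_norm_comp _ _))// mulrAC ler_wpM2r.
have La a g : g \c (L a \c f) = T g \c (a \c f) by rewrite !lk_compA LT.
have [||h hP] := @net_limit R (lk_arrow M w x) (fun e h =>
    exists2 a, h = L a \c f & k * `|f - a \c f| <= e).
- move=> e e0; have [|a af] := lk_approx_unit f (e := e / (k + 1)).
    by rewrite divr_gt0// ltr_wpDl.
  exists (L a \c f), a => //; rewrite (le_trans (ler_wpM2l k0 af))// mulrCA.
  by rewrite ler_piMr ?(ltW e0)// ler_pdivrMr ?ltr_wpDl// mul1r lerDl.
- move=> e d _ _ [a -> ae] [b -> bd].
  rewrite (le_trans (Tr _ (a \c f - b \c f) _))//.
    by move=> g; rewrite !lk_compBr !La.
  rewrite (le_trans (ler_wpM2l k0 (ler_distD f _ _)))// mulrDr lerD// distrC//.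
exists h.
have hg g : g \c h = T g \c f.
  apply/eqP; rewrite -subr_eq0; apply/eqP.
  apply: (@norm_small0 _ _ _ (`|g| + `|g|)); first by rewrite addr_ge0.
  move=> e e0; have [|a af] := lk_approx_unit f (e := e / (k + 1)).
    by rewrite divr_gt0// ltr_wpDl.
  have ke : k * `|f - a \c f| <= e.
    rewrite (le_trans (ler_wpM2l k0 af))// mulrCA.
    by rewrite ler_piMr ?(ltW e0)// ler_pdivrMr ?ltr_wpDl// mul1r lerDl.
  have -> : g \c h - T g \c f = g \c (h - L a \c f) - T g \c (f - a \c f).
    by rewrite !lk_compBr La opprB addrA subrK.
  rewrite (le_trans (ler_normB _ _))// mulrDl lerD//.
    rewrite (le_trans (lk_norm_comp _ _))// ler_wpM2l// distrC.
    by apply: hP; exists a.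
  rewrite (le_trans (lk_norm_comp _ _))// (le_trans (ler_wpM2r _ (Tk g)))//.
  by rewrite mulrAC mulrC ler_wpM2l.
by split=> // a; apply: Tr => g; rewrite !lk_compBr hg La.
Qed.

Lemma ext_exists x (L T : lk_arrow M x x -> lk_arrow M x x) (k : R[i]) :
  0 <= k -> (forall f g, g \c L f = T g \c f) -> (forall f, `|L f| <= k * `|f|) ->
  exists m : mult_arrow M x x, forall f : lk_arrow M x x, maL m f = L f.
Proof.
move=> k0 LT Lk; have lext := left_extension k0 LT Lk.
pose L' w f := projT1 (cid (lext w f)).
have L'T w f (g : lk_arrow M x x) : g \c L' w f = T g \c f.
  by rewrite /L'; case: cid => h [].
have L'L w f (a : lk_arrow M x x) : `|L' w f - L a \c f| <= k * `|f - a \c f|.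
  by rewrite /L'; case: cid => h [].
have L'k w f : `|L' w f| <= k * `|f|.
  apply: lk_norm_le_endol => [|g]; first exact: mulr_ge0.
  rewrite L'T (le_trans (lk_norm_comp _ _))// mulrAC ler_wpM2r//.
  apply: lk_norm_le_endor => [|h]; first exact: mulr_ge0.
  by rewrite -LT (le_trans (lk_norm_comp _ _))// [k * _]mulrC -mulrA ler_wpM2l.
(* The adjoint centralizer: its left extension, conjugated, is the right action of the one
   sought. *)
pose Ls f := lk_star (T (lk_star f)); pose Ts g := lk_star (L (lk_star g)).
have LsT f g : g \c Ls f = Ts g \c f.
  by rewrite /Ls /Ts -[LHS]lk_starK lk_star_comp lk_starK -LT lk_star_comp lk_starK.
have Lsk f : `|Ls f| <= k * `|f|.
  rewrite lk_norm_star -(lk_norm_star f).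
  apply: lk_norm_le_endor => [|h]; first exact: mulr_ge0.
  by rewrite -LT (le_trans (lk_norm_comp _ _))// [k * _]mulrC -mulrA ler_wpM2l.
have rext := left_extension k0 LsT Lsk.
pose R' z (g : lk_arrow M x z) := lk_star (projT1 (cid (rext z (lk_star g)))).
have R'L z g (f : lk_arrow M x x) : R' z g \c f = g \c L f.
  rewrite /R'; case: cid => h /= [hP _].
  rewrite -[LHS]lk_starK lk_star_comp lk_starK hP /Ts lk_star_comp !lk_starK.
  by [].
(* The two actions were extended independently. They agree on the composites [a f], where both sides
   are [g (L a) f], and [f] is a limit of such composites. *)
have P w z (g : lk_arrow M x z) (f : lk_arrow M w x) : g \c L' w f = R' z g \c f.
  apply/eqP; rewrite -subr_eq0; apply/eqP.
  apply: (@norm_small0 _ _ _ (`|g| * k + `|R' z g|)) => [|e e0].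
    by rewrite addr_ge0 ?mulr_ge0.
  have [a af] := lk_approx_unit f e0.
  have -> : g \c L' w f - R' z g \c f =
      g \c (L' w f - L a \c f) - R' z g \c (f - a \c f).
    by rewrite !lk_compBr !lk_compA R'L opprB addrA subrK.
  rewrite (le_trans (ler_normB _ _))// mulrDl lerD//.
    rewrite (le_trans (lk_norm_comp _ _))// -mulrA ler_wpM2l//.
    by rewrite (le_trans (L'L _ _ _))// ler_wpM2l.
  by rewrite (le_trans (lk_norm_comp _ _))// ler_wpM2l.
exists (MultArrow P (ex_intro2 _ _ k k0 L'k)) => f /=.
by apply: lk_sepl => g; rewrite L'T LT.
Qed.

(** The type [lk_arrow M x x] remembers only the normed module; this is the same space with the
    algebra structure that [multiplier] requires. *)
Definition lk_alg (x : two_obj) : cstarAlgType R :=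
  match x with rho => B | sigma => A end.

Fact ma_res_rho_dc (m : mult_arrow M rho rho) :
  @double_centralizer R B (@maL _ _ _ _ _ _ m rho) (@maR _ _ _ _ _ _ m rho).
Proof.
split.
- by move=> k a b; exact: (maLP m k (a : lk_arrow M rho rho) b).
- by move=> k a b; exact: (maRP m k (a : lk_arrow M rho rho) b).
- by exists `|m| => a; exact: (maL_norm m (a : lk_arrow M rho rho)).
- by exists `|m| => a; exact: (maR_norm m (a : lk_arrow M rho rho)).
- by move=> a b; exact: (@maL_comp _ _ _ M _ _ m rho rho a b).
- by move=> a b; exact: (@maR_comp _ _ m rho rho a b).
- by move=> a b; apply/esym; exact: (@maP _ _ _ M _ _ m rho rho a b).
Qed.

Fact ma_res_sigma_dc (m : mult_arrow M sigma sigma) :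
  @double_centralizer R A (@maL _ _ _ _ _ _ m sigma) (@maR _ _ _ _ _ _ m sigma).
Proof.
split.
- by move=> k a b; exact: (maLP m k (a : lk_arrow M sigma sigma) b).
- by move=> k a b; exact: (maRP m k (a : lk_arrow M sigma sigma) b).
- by exists `|m| => a; exact: (maL_norm m (a : lk_arrow M sigma sigma)).
- by exists `|m| => a; exact: (maR_norm m (a : lk_arrow M sigma sigma)).
- by move=> a b; exact: (@maL_comp _ _ _ M _ _ m sigma sigma a b).
- by move=> a b; exact: (@maR_comp _ _ m sigma sigma a b).
- by move=> a b; apply/esym; exact: (@maP _ _ _ M _ _ m sigma sigma a b).
Qed.

Definition ma_res (x : two_obj) : mult_arrow M x x -> multiplier (lk_alg x) :=
  match x with
  | rho => fun m => Multiplier (ma_res_rho_dc m)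
  | sigma => fun m => Multiplier (ma_res_sigma_dc m)
  end.

Lemma ma_res_inj x : injective (@ma_res x).
Proof.
by case: x => m n /(congr1 (@lmult _ _)) mn; apply: ma_eq_endo => f;
  have /= := congr1 (fun h => h f) mn.
Qed.

Lemma ma_resP x k (m n : mult_arrow M x x) :
  ma_res (k *: m + n) = k *: ma_res m + ma_res n.
Proof. by case: x m n => m n; apply: mult_eql. Qed.

Lemma ma_res_comp x (m n : mult_arrow M x x) :
  ma_res (ma_comp m n) = ma_res m ** ma_res n.
Proof. by case: x m n => m n; apply: mult_eql. Qed.

Lemma ma_res_star x (m : mult_arrow M x x) : ma_res (ma_star m) = star (ma_res m).
Proof. by case: x m => m; apply: mult_eql. Qed.

Lemma ma_res_norm x (m : mult_arrow M x x) : `|ma_res m| = `|m|.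
Proof.
apply/eqP; rewrite eq_le; apply/andP; split.
  by case: x m => m; apply: mnorm_le => // f; exact: (maL_norm m).
by apply: ma_norm_le_endo => // f; case: x m f => m f; exact: (lmult_norm (ma_res m) f).
Qed.

Lemma ma_res_surj x (n : multiplier (lk_alg x)) : exists m, ma_res m = n.
Proof.
case: x n => n.
  have [||m mL] := @ext_exists rho (lmult n) (rmult n) _ (normr_ge0 n).
  - by move=> f g /=; rewrite rmult_cmul.
  - by move=> f; exact: lmult_norm.
  by exists m; apply: mult_eql => f; exact: mL.
have [||m mL] := @ext_exists sigma (lmult n) (rmult n) _ (normr_ge0 n).
- by move=> f g /=; rewrite rmult_cmul.
- by move=> f; exact: lmult_norm.
by exists m; apply: mult_eql => f; exact: mL.
Qed.

(** The choice is unique by [ma_res_inj], so extension inverts restriction and inherits its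
    algebraic laws. *)
Definition ma_ext x (n : multiplier (lk_alg x)) : mult_arrow M x x :=
  projT1 (cid (ma_res_surj n)).

Lemma ma_extK x (n : multiplier (lk_alg x)) : ma_res (ma_ext n) = n.
Proof. by rewrite /ma_ext; case: cid. Qed.

Lemma ma_resK x (m : mult_arrow M x x) : ma_ext (ma_res m) = m.
Proof. by apply: ma_res_inj; rewrite ma_extK. Qed.

Lemma ma_extP x k (m n : multiplier (lk_alg x)) :
  ma_ext (k *: m + n) = k *: ma_ext m + ma_ext n.
Proof. by apply: ma_res_inj; rewrite ma_resP !ma_extK. Qed.

Lemma ma_ext_mul x (m n : multiplier (lk_alg x)) :
  ma_ext (m ** n) = ma_comp (ma_ext m) (ma_ext n).
Proof. by apply: ma_res_inj; rewrite ma_res_comp !ma_extK. Qed.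

Lemma ma_ext_star x (m : multiplier (lk_alg x)) :
  ma_ext (star m) = ma_star (ma_ext m).
Proof. by apply: ma_res_inj; rewrite ma_res_star !ma_extK. Qed.

End Extension.

(** * Bi-Hilbertian bimodules from a pair of inner products *)

Section BiHilbertOfLeftStructure.
Variables (R : realType) (A B : cstarAlgType R) (N : hilbertModule B).
Variables (la : A -> N -> N) (li : N -> N -> A).
Hypothesis L : left_structure la li.
Implicit Types (a k : A) (phi psi : N) (s t : seq (N * N)).

Let laDl a b psi : la (a + b) psi = la a psi + la b psi.
Proof. by have := left_actPl L 1 a b psi; rewrite !scale1r. Qed.

Let la0l psi : la 0 psi = 0.
Proof. by apply: (addrI (la 0 psi)); rewrite -laDl !addr0. Qed.

Let laZl (c : R[i]) a psi : la (c *: a) psi = c *: la a psi.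
Proof. by rewrite -[c *: a]addr0 (left_actPl L) la0l addr0. Qed.

Let laBl a b psi : la (a - b) psi = la a psi - la b psi.
Proof. by rewrite laDl -scaleN1r laZl scaleN1r. Qed.

Let liDl phi phi' psi : li (phi + phi') psi = li phi psi + li phi' psi.
Proof. by have := left_ipPl L 1 phi phi' psi; rewrite !scale1r. Qed.

Let li0l psi : li 0 psi = 0.
Proof. by apply: (addrI (li 0 psi)); rewrite -liDl !addr0. Qed.

Let liZl (c : R[i]) phi psi : li (c *: phi) psi = c *: li phi psi.
Proof. by rewrite -[c *: phi]addr0 (left_ipPl L) li0l addr0. Qed.

Definition li_sum s : A := \sum_(p <- s) li p.1 p.2.

(** The closed two-sided ideal spanned by the values of [li]. [A] need not act faithfully on the
    module, but this ideal does; hence [kincl] is sought in it. *)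
Definition li_closure k : Prop :=
  forall e : R[i], 0 < e -> exists s, `|k - li_sum s| <= e.

Lemma la_li_sum s psi : la (li_sum s) psi = \sum_(p <- s) theta p.1 p.2 psi.
Proof.
rewrite /li_sum; elim/big_rec2: _ => [|p x y _ <-]; first exact: la0l.
by rewrite laDl (left_act_ip L).
Qed.

Lemma cmul_li_sum a s : a ** li_sum s = li_sum [seq (la a p.1, p.2) | p <- s].
Proof.
rewrite /li_sum big_map; elim/big_rec2: _ => [|p x y _ <-]; first exact: cmul0r.
by rewrite cmulDr (left_ip_act L).
Qed.

Lemma scale_li_sum (c : R[i]) s :
  c *: li_sum s = li_sum [seq (c *: p.1, p.2) | p <- s].
Proof.
rewrite /li_sum big_map; elim/big_rec2: _ => [|p x y _ <-]; first exact: scaler0.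
by rewrite scalerDr liZl.
Qed.

Lemma star_li_sum s : star (li_sum s) = li_sum [seq (p.2, p.1) | p <- s].
Proof.
rewrite /li_sum big_map; elim/big_rec2: _ => [|p x y _ <-]; first exact: star0.
by rewrite starD (left_ip_star L).
Qed.

Lemma li_sum_cat s t : li_sum (s ++ t) = li_sum s + li_sum t.
Proof. exact: big_cat. Qed.

Lemma li_sumB s t :
  li_sum s - li_sum t = li_sum (s ++ [seq (-1 *: p.1, p.2) | p <- t]).
Proof. by rewrite li_sum_cat -scale_li_sum scaleN1r. Qed.

Lemma li_closure_li phi psi : li_closure (li phi psi).
Proof.
move=> e e0; exists [:: (phi, psi)].
by rewrite /li_sum big_seq1 subrr normr0 ltW.
Qed.

Lemma li_closure_mul a k : li_closure k -> li_closure (a ** k).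
Proof.
move=> kK e e0; have [|s ks] := kK (e / (`|a| + 1)).
  by rewrite divr_gt0// ltr_wpDl.
exists [seq (la a p.1, p.2) | p <- s]; rewrite -cmul_li_sum -cmulBr.
rewrite (le_trans (normM_le _ _))// (le_trans (ler_wpM2l _ ks))// mulrCA.
by rewrite ler_piMr ?(ltW e0)// ler_pdivrMr ?ltr_wpDl// mul1r lerDl.
Qed.

Lemma li_closureP (c : R[i]) k l :
  li_closure k -> li_closure l -> li_closure (c *: k + l).
Proof.
move=> kK lK e e0; have [|s ks] := kK (e / 2 / (`|c| + 1)).
  by rewrite !divr_gt0// ltr_wpDl.
have [|t lt] := lK (e / 2); first by rewrite divr_gt0.
exists ([seq (c *: p.1, p.2) | p <- s] ++ t).
rewrite li_sum_cat -scale_li_sum opprD addrACA -scalerBr.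
rewrite (le_trans (ler_normD _ _))// [leRHS]splitr lerD// normrZ.
rewrite (le_trans (ler_wpM2l _ ks))// mulrCA.
by rewrite ler_piMr ?divr_ge0 ?(ltW e0)// ler_pdivrMr ?ltr_wpDl// mul1r lerDl.
Qed.

Lemma li_closure_star k : li_closure k -> li_closure (star k).
Proof.
move=> kK e /kK[s ks]; exists [seq (p.2, p.1) | p <- s].
by rewrite -star_li_sum -starB norm_star.
Qed.

(** [d = k - l] acts as 0, so [d ** li phi psi = li (la d phi) psi = 0]. As [star d] is a limit of
    sums of values of [li], also [d ** star d = 0]. *)
Lemma li_closure_faithful k l : li_closure k -> li_closure l ->
  la k =1 la l -> k = l.
Proof.
move=> kK lK kl; pose d := k - l; suff d0 : d = 0.
  by apply/eqP; rewrite -subr_eq0 -/d d0.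
have dK : li_closure (star d).
  apply: li_closure_star; rewrite /d addrC -scaleN1r.
  exact: li_closureP.
have ds s : d ** li_sum s = 0.
  rewrite cmul_li_sum /li_sum big_map big1// => p _.
  by rewrite laBl kl subrr li0l.
rewrite -[d]starK; apply/eqP; rewrite -(can_eq (@starK _ A)) starK star0; apply/eqP.
apply: cstar_eq0; rewrite starK; apply: (@norm_small0 _ _ _ `|d|) => // e e0.
have [s es] := dK e e0.
by rewrite -[d ** _]subr0 -(ds s) -cmulBr (le_trans (normM_le _ _))// ler_wpM2l.
Qed.

(* For b = S^* S / r^2 the powers b^(2^n) act with norm at most 1 and are
   multiples of S, so their norms |b|^(2^n) stay bounded. *)
Lemma li_sum_norm_le s (r : R[i]) : 0 < r ->
  (forall psi, `|la (li_sum s) psi| <= r * `|psi|) -> `|li_sum s| <= r.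
Proof.
move=> r0; set S := li_sum s => Sr; have r1 := ltW r0.
pose C : R[i] := \sum_(p <- s) `|p.1| * `|p.2|.
(* A bound on the action of [k] bounds [k ** S] in [A], at the price of a constant [C] that depends
   on [s]; passing to powers removes it. *)
have SC (d : R[i]) k : (forall psi, `|la k psi| <= d * `|psi|) -> `|k ** S| <= d * C.
  move=> kc; rewrite cmul_li_sum /li_sum big_map /C mulr_sumr.
  rewrite (le_trans (ler_norm_sum _ _ _))// ler_sum// => p _.
  rewrite (le_trans (left_ip_cauchy_schwarz L _ _))// mulrA ler_wpM2r//.
  exact: kc.
have Ssr psi : `|la (star S) psi| <= r * `|psi|.
  have [->|S0] := eqVneq (la (star S) psi) 0.
    by rewrite normr0 mulr_ge0.
  rewrite -(ler_pM2r (_ : 0 < `|la (star S) psi|)) ?normr_gt0//.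
  rewrite -expr2 ip_norm (left_act_adj L) starK.
  by rewrite (le_trans (ip_cauchy_schwarz _ _))// [r * _]mulrC -mulrA ler_wpM2l.
pose c : R[i] := r^-1; have c0 : 0 <= c by rewrite invr_ge0.
have crr u : c * (r * u) = u by rewrite mulrA mulVf ?mul1r// gt_eqF.
pose b := (c * c) *: (star S ** S).
have bE : star b = b by rewrite starZ starM starK geC0_conj// mulr_ge0.
have b1 psi : `|la b psi| <= `|psi|.
  rewrite laZl normrZ ger0_norm ?mulr_ge0// (left_actM L).
  rewrite (le_trans (ler_wpM2l _ (Ssr _))) ?mulr_ge0//.
  rewrite (le_trans (ler_wpM2l _ (ler_wpM2l _ (Sr _)))) ?mulr_ge0//.
  by rewrite -mulrA !crr.
pose g n := iter n (fun x : A => x ** x) b.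
have gE n : star (g n) = g n by elim: n => //= n ih; rewrite starM ih.
have g1 n psi : `|la (g n) psi| <= `|psi|.
  by elim: n psi => //= n ih psi; rewrite (left_actM L) (le_trans (ih _)).
have gn n : `|g n| = `|b| ^+ (2 ^ n).
  by elim: n => //= n ih; rewrite norm_sqr_sa// ih expnSr exprM.
have gS n : exists2 k, g n = k ** S & forall psi, `|la k psi| <= c * `|psi|.
  elim: n => [|n [l lE lc]] /=.
    exists ((c * c) *: star S) => [|psi]; first by rewrite cmulZl.
    rewrite laZl normrZ ger0_norm ?mulr_ge0//.
    rewrite (le_trans (ler_wpM2l _ (Ssr _))) ?mulr_ge0//.
    by rewrite -mulrA crr.
  exists (g n ** l) => [|psi]; first by rewrite -cmulA -lE.
  by rewrite (left_actM L) (le_trans (g1 _ _)).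
have bC n : `|b| ^+ (2 ^ n) <= c * C.
  by rewrite -gn; have [l -> lc] := gS n; exact: SC.
have nb : `|b| <= 1.
  rewrite real_leNgt ?ger0_real//; apply/negP => b1'.
  have /expr_bounded_le1 : forall n, `|b| ^+ n <= c * C.
    move=> n; rewrite (le_trans _ (bC n))//.
    by rewrite ler_weXn2l ?(ltW b1')// ltnW// ltn_expl.
  by rewrite normr_ge0 => /(_ isT)/(lt_le_trans b1'); rewrite ltxx.
move: nb; rewrite normrZ ger0_norm ?mulr_ge0// cstar_norm -expr2 -exprMn.
by rewrite expr_le1 ?mulr_ge0// /c mulrC ler_pdivrMr// mul1r.
Qed.

Lemma compact_li_closure T : compact_op T ->
  exists2 k, li_closure k & la k =1 T.
Proof.
(* By [li_sum_norm_le], two approximants of [T] in operator norm are as close in [A], where the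
   limit can then be taken. The predicate records [0 < e] because that lemma asks for a positive
   bound. *)
move=> Tc; have [||k kP] := @net_limit R A (fun e v => 0 < e /\
    exists2 s, v = li_sum s & forall psi, `|T psi - la v psi| <= e * `|psi|).
- move=> e e0; have [s sT] := Tc e e0; exists (li_sum s); split => //.
  by exists s => // psi; rewrite la_li_sum.
- move=> e d v w [e0 [s vs sT]] [d0 [t wt tT]].
  rewrite vs wt li_sumB; apply: li_sum_norm_le => [|psi]; first exact: addr_gt0.
  rewrite -li_sumB -vs -wt laBl (le_trans (ler_distD (T psi) _ _))//.
  by rewrite mulrDl lerD// distrC.
exists k => [e e0|psi].
  have [s sT] := Tc e e0; exists s; rewrite distrC; apply: kP; split => //.
  by exists s => // psi; rewrite la_li_sum.
apply/eqP; rewrite -subr_eq0; apply/eqP.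
apply: (@norm_small0 _ _ _ (2 * `|psi|)) => [|e e0]; first by rewrite mulr_ge0.
have [s sT] := Tc e e0; have sT' phi : `|T phi - la (li_sum s) phi| <= e * `|phi|.
  by rewrite la_li_sum.
rewrite (le_trans (ler_distD (la (li_sum s) psi) _ _))//.
have -> : 2 * `|psi| * e = e * `|psi| + e * `|psi| by ring.
rewrite lerD//; last by rewrite distrC.
rewrite -laBl (le_trans (left_act_norm L _ _))// ler_wpM2r// distrC.
by apply: kP; split => //; exists s.
Qed.

(** The default 0 is returned only if no element of the ideal acts as [T]; for compact [T] there is
    exactly one. *)
Definition left_kincl (T : N -> N) : A := xget 0 [set k | li_closure k /\ la k =1 T].

Lemma left_kinclP T : compact_op T ->
  li_closure (left_kincl T) /\ la (left_kincl T) =1 T.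
Proof.
move=> /compact_li_closure[k kK kT].
exact: (@xgetI _ 0 [set k | li_closure k /\ la k =1 T] k (conj kK kT)).
Qed.

Lemma left_kincl_unique T k : li_closure k -> la k =1 T -> left_kincl T = k.
Proof.
move=> kK kT.
have [lK lT] : li_closure (left_kincl T) /\ la (left_kincl T) =1 T.
  exact: (@xgetI _ 0 [set k | li_closure k /\ la k =1 T] k (conj kK kT)).
by apply: li_closure_faithful => // psi; rewrite lT kT.
Qed.

Lemma left_kincl_theta phi psi : left_kincl (theta phi psi) = li phi psi.
Proof.
by apply: left_kincl_unique => [|chi]; [exact: li_closure_li|exact: (left_act_ip L)].
Qed.

Fact left_kincl_linear (c : R[i]) S T : compact_op S -> compact_op T ->
  left_kincl (fun phi => c *: S phi + T phi) = c *: left_kincl S + left_kincl T.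
Proof.
move=> /left_kinclP[SK SE] /left_kinclP[TK TE].
apply: left_kincl_unique => [|phi]; first exact: li_closureP.
by rewrite (left_actPl L) SE TE.
Qed.

Fact left_kincl_mul S T : compact_op S -> compact_op T ->
  left_kincl (S \o T) = left_kincl S ** left_kincl T.
Proof.
move=> /left_kinclP[SK SE] /left_kinclP[TK TE].
apply: left_kincl_unique => [|phi]; first exact: li_closure_mul.
by rewrite (left_actM L) TE SE.
Qed.

Fact left_kincl_star S T : compact_op S -> compact_op T -> adjoint_of S T ->
  left_kincl T = star (left_kincl S).
Proof.
move=> /left_kinclP[SK SE] _ ST.
apply: left_kincl_unique => [|phi]; first exact: li_closure_star.
by apply: ip_sep => psi; rewrite -(left_act_adj L) SE ST.
Qed.

Fact left_kinclE T : compact_op T -> la (left_kincl T) = T.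
Proof. by move=> /left_kinclP[_ /funext]. Qed.

Fact left_kincl_lact a psi psi' :
  left_kincl (theta (la a psi) psi') = a ** left_kincl (theta psi psi').
Proof. by rewrite !left_kincl_theta (left_ip_act L). Qed.

Fact left_kincl_norm psi : `|psi| ^+ 2 = `|left_kincl (theta psi psi)|.
Proof. by rewrite left_kincl_theta (left_ip_norm L). Qed.

Definition biHilbert_of : biHilbert A B :=
  BiHilbert (left_actPl L) (left_actPr L) (left_actM L) (left_act_ract L)
    (left_act_adj L) left_kincl_linear left_kincl_mul left_kincl_star left_kinclE
    left_kincl_lact left_kincl_norm.

Lemma lip_biHilbert_of (phi psi : biHilbert_of) : lip phi psi = li phi psi.
Proof. exact: left_kincl_theta. Qed.

End BiHilbertOfLeftStructure.

(** * The multiplier bimodule *)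

Section MultiplierBimodule.
Variables (R : realType) (A B : cstarAlgType R) (M : biHilbert A B).
Implicit Types (m : mult_arrow M rho sigma).

Let mract m (n : multiplier B) : mult_arrow M rho sigma :=
  ma_comp m (@ma_ext _ _ _ M rho n).
Let mip m m' : multiplier B := @ma_res _ _ _ M rho (ma_comp (ma_star m) m').
Let mlact (n : multiplier A) m : mult_arrow M rho sigma :=
  ma_comp (@ma_ext _ _ _ M sigma n) m.
Let mlip m m' : multiplier A := @ma_res _ _ _ M sigma (ma_comp m (ma_star m')).

Fact mractPl (k : R[i]) m m' n : mract (k *: m + m') n = k *: mract m n + mract m' n.
Proof. exact: ma_compPl. Qed.

Fact mractPr (k : R[i]) m n n' : mract m (k *: n + n') = k *: mract m n + mract m n'.
Proof. by rewrite /mract (@ma_extP _ _ _ M rho) ma_compPr. Qed.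

Fact mractM m n n' : mract m (n ** n') = mract (mract m n) n'.
Proof. by rewrite /mract (@ma_ext_mul _ _ _ M rho) ma_compA. Qed.

Fact mipPr (k : R[i]) m n n' : mip m (k *: n + n') = k *: mip m n + mip m n'.
Proof. by rewrite /mip ma_compPr (@ma_resP _ _ _ M rho). Qed.

Fact mip_star m m' : star (mip m m') = mip m' m.
Proof.
by rewrite /mip -(@ma_res_star _ _ _ M rho) ma_star_comp ma_starK.
Qed.

Fact mip_ract m m' n : mip m (mract m' n) = mip m m' ** n.
Proof.
by rewrite /mip /mract ma_compA (@ma_res_comp _ _ _ M rho) (@ma_extK _ _ _ M rho).
Qed.

Fact mip_ge0 m : positive (mip m m).
Proof.
apply: positive_multiplier => [|b]; first exact: mip_star.
(* [m b] is an arrow of [M] itself, where [<m b, m b>] is already known to be positive. *)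
have -> : star b ** lmult (mip m m) b =
    ip (maL m (b : lk_arrow M rho rho)) (maL m (b : lk_arrow M rho rho)).
  rewrite -[LHS]/(lk_star (b : lk_arrow M rho rho) \c
    maL (ma_star m) (maL m (b : lk_arrow M rho rho))).
  by rewrite maP -maL_star.
exact: ip_ge0.
Qed.

Fact mip_norm m : `|m| ^+ 2 = `|mip m m|.
Proof. by rewrite (@ma_res_norm _ _ _ M rho) ma_cstar_norm. Qed.

Definition mult_hilbert : hilbertModule (multiplier B) :=
  @HilbertModule R (multiplier B) (mult_arrow M rho sigma) mract mip
    mractPl mractPr mractM mipPr mip_star mip_ract mip_ge0 mip_norm.

Lemma mult_left_structure :
  @left_structure R (multiplier A) (multiplier B) mult_hilbert mlact mlip.
Proof.
split; rewrite /mlact /mlip.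
- by move=> k a b m; rewrite (@ma_extP _ _ _ M sigma) ma_compPl.
- by move=> k a m m'; rewrite ma_compPr.
- by move=> a b m; rewrite (@ma_ext_mul _ _ _ M sigma) ma_compA.
- by move=> a m b; apply: ma_compA.
- move=> a m m' /=; rewrite /mip ma_star_comp -ma_compA.
  by rewrite (@ma_ext_star _ _ _ M sigma).
- by move=> k m m' n; rewrite ma_compPl (@ma_resP _ _ _ M sigma).
- move=> m m'; rewrite -(@ma_res_star _ _ _ M sigma) ma_star_comp.
  by rewrite ma_starK.
- move=> a m m'; rewrite -ma_compA (@ma_res_comp _ _ _ M sigma).
  by rewrite (@ma_extK _ _ _ M sigma).
- move=> m m' b; congr (@ma_res _ _ _ M sigma _).
  rewrite -[ract m b]/(mract m b) -[ract m' _]/(mract m' (star b)) /mract.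
  by rewrite ma_star_comp (@ma_ext_star _ _ _ M rho) ma_starK ma_compA.
- move=> m m' n; rewrite (@ma_resK _ _ _ M sigma) -[RHS]/(mract m (mip m' n)).
  by rewrite /mract (@ma_resK _ _ _ M rho) ma_compA.
- move=> m; rewrite (@ma_res_norm _ _ _ M sigma).
  by rewrite -{2}[m]ma_starK ma_cstar_norm ma_norm_star.
Qed.

Definition mult_bimodule : biHilbert (multiplier A) (multiplier B) :=
  biHilbert_of mult_left_structure.

(* The isomorphism of the two-object category of the multiplier bimodule with the
   multiplier category. *)
Definition ma_of x y : lk_arrow mult_bimodule x y -> mult_arrow M x y :=
  match x, y with
  | rho, rho => fun n : multiplier B => @ma_ext _ _ _ M rho n
  | rho, sigma => fun m : mult_arrow M rho sigma => m
  | sigma, rho => fun m : mult_arrow M rho sigma => ma_star m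
  | sigma, sigma => fun n : multiplier A => @ma_ext _ _ _ M sigma n
  end.

Lemma ma_of_comp x y z (f : lk_arrow mult_bimodule y z)
    (g : lk_arrow mult_bimodule x y) : ma_of (f \c g) = ma_comp (ma_of f) (ma_of g).
Proof.
case: x y z f g => [] [] [] f g /=.
- exact: (@ma_ext_mul _ _ _ M rho).
- by [].
- exact: (@ma_resK _ _ _ M rho).
- by [].
- by rewrite /mract ma_star_comp (@ma_ext_star _ _ _ M rho) ma_starK.
- rewrite -[RHS](@ma_resK _ _ _ M sigma); congr (@ma_ext _ _ _ M sigma _).
  exact: (lip_biHilbert_of (L := mult_left_structure)).
- by rewrite /mlact ma_star_comp (@ma_ext_star _ _ _ M sigma) ma_starK.
- exact: (@ma_ext_mul _ _ _ M sigma).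
Qed.

Lemma ma_of_star x y (f : lk_arrow mult_bimodule x y) :
  ma_of (lk_star f) = ma_star (ma_of f).
Proof.
case: x y f => [] [] f /=; try exact: ma_ext_star.
- by [].
- by rewrite ma_starK.
Qed.

Lemma ma_ofP x y k (f g : lk_arrow mult_bimodule x y) :
  ma_of (k *: f + g) = k *: ma_of f + ma_of g.
Proof.
case: x y f g => [] [] f g /=; try exact: ma_extP; first by [].
by rewrite -[k *: f]/(k^* *: (f : mult_arrow M rho sigma)) ma_starP conjCK.
Qed.

Lemma ma_of_norm x y (f : lk_arrow mult_bimodule x y) : `|ma_of f| = `|f|.
Proof.
case: x y f => [] [] f /=.
- by rewrite -ma_res_norm ma_extK.
- by [].
- exact: ma_norm_star.
- by rewrite -ma_res_norm ma_extK.
Qed.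

Lemma ma_of_inj x y : injective (@ma_of x y).
Proof.
move=> f g fg; apply/eqP; rewrite -subr_eq0 -normr_eq0 -ma_of_norm.
by rewrite addrC -scaleN1r ma_ofP fg scaleN1r addNr normr0.
Qed.

End MultiplierBimodule.

(** * Morphisms into the multiplier bimodule from contractive star-functors *)

Section FunctorHom.
Variables (R : realType) (A B A' B' : cstarAlgType R).
Variables (M : biHilbert A B) (M' : biHilbert A' B').
Variable Psi : forall x y, lk_arrow M' x y -> mult_arrow M x y.
Hypothesis PsiP : forall x y k (f g : lk_arrow M' x y),
  Psi (k *: f + g) = k *: Psi f + Psi g.
Hypothesis Psi_comp : forall x y z (f : lk_arrow M' y z) (g : lk_arrow M' x y),
  Psi (lk_comp f g) = ma_comp (Psi f) (Psi g).
Hypothesis Psi_star : forall x y (f : lk_arrow M' x y),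
  Psi (lk_star f) = ma_star (Psi f).
Hypothesis Psi_norm : forall x y (f : lk_arrow M' x y), `|Psi f| <= `|f|.

Let Fm (psi : M') : mult_bimodule M := Psi (psi : lk_arrow M' rho sigma).
Let Fl (a : A') : multiplier A :=
  @ma_res _ _ _ M sigma (Psi (a : lk_arrow M' sigma sigma)).
Let Fr (b : B') : multiplier B :=
  @ma_res _ _ _ M rho (Psi (b : lk_arrow M' rho rho)).

Fact functor_linear : linear Fm.
Proof. by move=> k f g; exact: PsiP. Qed.

Fact functor_bounded : bounded_op Fm.
Proof. by exists 1 => f; rewrite mul1r; exact: Psi_norm. Qed.

Fact functor_l_hom : cstar_hom Fl.
Proof.
split.
- move=> k a b; rewrite -[RHS](@ma_resP _ _ _ M sigma).
  by congr (@ma_res _ _ _ M sigma _); exact: PsiP.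
- move=> a b; rewrite -[RHS](@ma_res_comp _ _ _ M sigma).
  by congr (@ma_res _ _ _ M sigma _); exact: (@Psi_comp sigma sigma sigma).
- move=> a; rewrite -[RHS](@ma_res_star _ _ _ M sigma).
  by congr (@ma_res _ _ _ M sigma _); exact: (@Psi_star sigma sigma).
Qed.

Fact functor_r_hom : cstar_hom Fr.
Proof.
split.
- move=> k a b; rewrite -[RHS](@ma_resP _ _ _ M rho).
  by congr (@ma_res _ _ _ M rho _); exact: PsiP.
- move=> a b; rewrite -[RHS](@ma_res_comp _ _ _ M rho).
  by congr (@ma_res _ _ _ M rho _); exact: (@Psi_comp rho rho rho).
- move=> a; rewrite -[RHS](@ma_res_star _ _ _ M rho).
  by congr (@ma_res _ _ _ M rho _); exact: (@Psi_star rho rho).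
Qed.

Fact functor_act a psi b :
  Fm (ract (lact a psi) b) = ract (lact (Fl a) (Fm psi)) (Fr b).
Proof.
rewrite -[RHS]/(ma_comp (ma_comp (@ma_ext _ _ _ M sigma (Fl a)) (Fm psi))
  (@ma_ext _ _ _ M rho (Fr b))) (@ma_resK _ _ _ M sigma) (@ma_resK _ _ _ M rho).
have <- := @Psi_comp rho sigma sigma a psi.
by have <- := @Psi_comp rho rho sigma (lact a psi) b.
Qed.

Fact functor_ip psi psi' : Fr (ip psi psi') = ip (Fm psi) (Fm psi').
Proof.
congr (@ma_res _ _ _ M rho _); have <- := @Psi_star rho sigma psi.
exact: (@Psi_comp rho sigma rho).
Qed.

Fact functor_lip psi psi' : Fl (lip psi psi') = lip (Fm psi) (Fm psi').
Proof.
rewrite [RHS](lip_biHilbert_of (L := mult_left_structure M)).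
congr (@ma_res _ _ _ M sigma _); have <- := @Psi_star rho sigma psi'.
exact: (@Psi_comp sigma rho sigma).
Qed.

(** Used twice: with [ma_incl] for the canonical embedding and with [ma_pull] for the universal
    property. *)
Definition functor_hom : biHilbertHom M' (mult_bimodule M) :=
  BiHilbertHom functor_linear functor_bounded functor_l_hom functor_r_hom
    functor_act functor_ip functor_lip.

Lemma ma_of_functor x y (f : lk_arrow M' x y) : ma_of (lk_map functor_hom f) = Psi f.
Proof.
case: x y f => [] [] f.
- exact: (@ma_resK _ _ _ M rho).
- by [].
- by have := @Psi_star rho sigma f => /esym.
- exact: (@ma_resK _ _ _ M sigma).
Qed.

Lemma functor_mono : (forall x y, injective (@Psi x y)) -> bimod_mono functor_hom.
Proof.
move=> inj; split.
- exact: (inj rho sigma).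
- by move=> a b /(@ma_res_inj _ _ _ M sigma); exact: (inj sigma sigma).
- by move=> a b /(@ma_res_inj _ _ _ M rho); exact: (inj rho rho).
Qed.

End FunctorHom.

(** * The canonical embedding and its essentiality *)

Section CanonicalEmbedding.
Variables (R : realType) (A B : cstarAlgType R) (M : biHilbert A B).

Lemma ma_incl_inj x y : injective (@ma_incl _ _ _ M x y).
Proof.
move=> f g fg; apply/eqP; rewrite -subr_eq0 -normr_eq0 -ma_incl_norm.
by rewrite addrC -scaleN1r ma_inclP fg scaleN1r addNr normr0.
Qed.

Lemma ma_incl0 x y : @ma_incl _ _ _ M x y 0 = 0.
Proof. by apply/eqP; rewrite -normr_eq0 ma_incl_norm normr0. Qed.

Lemma ma_of0 x y : ma_of (0 : lk_arrow (mult_bimodule M) x y) = 0.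
Proof. by apply/eqP; rewrite -normr_eq0 ma_of_norm normr0. Qed.

Lemma ma_incl_comp_r x y z (g : lk_arrow M y z) (m : mult_arrow M x y) :
  ma_comp (ma_incl g) m = ma_incl (maR m g).
Proof. by apply: ma_eq => w f /=; rewrite maP. Qed.

Definition mult_embedding : biHilbertHom M (mult_bimodule M) :=
  functor_hom (@ma_inclP _ _ _ M) (@ma_incl_comp _ _ _ M) (@ma_incl_star _ _ _ M)
    (fun x y f => eq_ind_r (fun r => r <= _) (lexx _) (@ma_incl_norm _ _ _ M x y f)).

Lemma ma_of_embedding x y (f : lk_arrow M x y) :
  ma_of (lk_map mult_embedding f) = ma_incl f.
Proof. exact: ma_of_functor. Qed.

Lemma mult_embedding_mono : bimod_mono mult_embedding.
Proof. by apply: functor_mono => x y; exact: ma_incl_inj. Qed.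

Lemma range_embedding x y (f : lk_arrow (mult_bimodule M) x y) :
  range (@lk_map _ _ _ _ _ _ _ mult_embedding x y) f <-> exists g, ma_of f = ma_incl g.
Proof.
split=> [[g _ <-]|[g fg]]; first by exists g; exact: ma_of_embedding.
by exists g => //; apply: ma_of_inj; rewrite ma_of_embedding.
Qed.

Lemma mult_embedding_essential : essential_embedding mult_embedding.
Proof.
split; first exact: mult_embedding_mono.
split.
- split.
  + move=> x y; apply/range_embedding; exists 0.
    by rewrite ma_incl0; exact: ma_of0.
  + move=> x y k f g /range_embedding[f' fE] /range_embedding[g' gE].
    apply/range_embedding; exists (k *: f' + g').
    by rewrite ma_ofP ma_inclP fE gE.
  + move=> x y; apply: isometry_closed_range => u v.
    rewrite -ma_of_norm -scaleN1r addrC ma_ofP !ma_of_embedding -ma_inclP.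
    by rewrite ma_incl_norm addrC scaleN1r.
  + move=> x y f /range_embedding[g fg]; apply/range_embedding.
    by exists (lk_star g); rewrite ma_incl_star -fg; exact: ma_of_star.
  + move=> x y z f g /range_embedding[h gh]; apply/range_embedding.
    exists (maL (ma_of f) h); rewrite -ma_comp_incl -gh; exact: ma_of_comp.
  + move=> x y z f g /range_embedding[h fh]; apply/range_embedding.
    exists (maR (ma_of g) h); rewrite -ma_incl_comp_r -fh; exact: ma_of_comp.
- move=> J JI [x [y [f Jf f0]]].
  (* A nonzero double centralizer moves some arrow [g] of [M]; then [f g] is a nonzero arrow of [J]
     that comes from [M]. *)
  have [w [g fg0]] : exists w (g : lk_arrow M w x), maL (ma_of f) g != 0.
    apply: contrapT => h; move/eqP: f0; apply; apply: ma_of_inj; rewrite ma_of0.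
    apply: ma_eq => w g; apply: contrapT => /eqP fg.
    by apply: h; exists w, g.
  exists w, y, (lk_comp f (lk_map mult_embedding g)).
    split; last exact: ideal_compr JI _ _ _ _ _ Jf.
    apply/range_embedding; exists (maL (ma_of f) g).
    by rewrite ma_of_comp ma_of_embedding ma_comp_incl.
  rewrite -normr_eq0 -ma_of_norm ma_of_comp ma_of_embedding ma_comp_incl.
  by rewrite ma_incl_norm normr_eq0.
Qed.

End CanonicalEmbedding.

(** * The universal property *)

Section Universal.
Variables (R : realType) (A B A' B' : cstarAlgType R).
Variables (M : biHilbert A B) (M' : biHilbert A' B') (J : biHilbertHom M M').

Let j x y (f : lk_arrow M x y) : lk_arrow M' x y := lk_map J f.

Lemma lk_mapP x y k (f g : lk_arrow M x y) :
  lk_map J (k *: f + g) = k *: lk_map J f + lk_map J g.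
Proof.
case: x y f g => [] [] f g.
- exact: hom_linear (hom_r_hom J) k f g.
- exact: hom_mod_linear J k f g.
- exact: hom_mod_linear J (k^*) f g.
- exact: hom_linear (hom_l_hom J) k f g.
Qed.

Lemma lk_map_star x y (f : lk_arrow M x y) :
  lk_map J (lk_star f) = lk_star (lk_map J f).
Proof.
case: x y f => [] [] f //.
- exact: hom_star (hom_r_hom J) f.
- exact: hom_star (hom_l_hom J) f.
Qed.

(* hom_act concerns both actions at once, and units are not available to separate
   them. But d := J (a psi) - J a J psi satisfies <d, J phi> = 0 for all phi,
   whence <d, d> = 0. *)
Lemma hom_mod_lact a (psi : M) : J (lact a psi) = lact (hom_l J a) (J psi).
Proof.
have L := biHilbert_left M'; have L0 := biHilbert_left M.
pose d := J (lact a psi) - lact (hom_l J a) (J psi).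
have lipB phi chi xi : @lip _ _ _ M' (phi - chi) xi = lip phi xi - lip chi xi.
  by rewrite addrC -scaleN1r (left_ipPl L) scaleN1r addrC.
have dJ phi : lip d (J phi) = 0.
  rewrite lipB (left_ip_act L) -!hom_lip -(hom_mul (hom_l_hom J)).
  by rewrite (left_ip_act L0) subrr.
have Jd phi : lip (J phi) d = 0 by rewrite -(left_ip_star L) dJ star0.
have dd : lip d d = 0.
  by rewrite {1}/d lipB (left_ip_act L) !Jd cmul0r subrr.
apply/eqP; rewrite -subr_eq0 -normr_eq0 -sqrf_eq0 (left_ip_norm L) dd.
by rewrite normr0.
Qed.

Lemma hom_mod_ract (psi : M) b : J (ract psi b) = ract (J psi) (hom_r J b).
Proof.
pose d := J (ract psi b) - ract (J psi) (hom_r J b).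
have Jd phi : ip (J phi) d = 0.
  rewrite ipBr ip_ract -!hom_ip -(hom_mul (hom_r_hom J)).
  by rewrite ip_ract subrr.
have dd : ip d d = 0.
  by rewrite {1}/d ipBl ip_ractl !Jd cmul0r subrr.
apply/eqP; rewrite -subr_eq0 -normr_eq0 -sqrf_eq0 ip_norm dd.
by rewrite normr0.
Qed.

Lemma lk_map_comp x y z (f : lk_arrow M y z) (g : lk_arrow M x y) :
  lk_map J (f \c g) = lk_map J f \c lk_map J g.
Proof.
case: x y z f g => [] [] [] f g /=.
- exact: hom_mul (hom_r_hom J) f g.
- exact: hom_mod_ract.
- exact: hom_ip.
- exact: hom_mod_lact.
- by rewrite hom_mod_ract (hom_star (hom_r_hom J)).
- exact: hom_lip.
- by rewrite hom_mod_lact (hom_star (hom_l_hom J)).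
- exact: hom_mul (hom_l_hom J) f g.
Qed.

Hypothesis J_ess : essential_embedding J.

Lemma lk_map_inj x y : injective (@lk_map _ _ _ _ _ _ _ J x y).
Proof. by have [[Jm Jl Jr] _] := J_ess; case: x y => [] []. Qed.

Let range_ideal := J_ess.2.1.

Lemma lk_map_norm x y (f : lk_arrow M x y) : `|lk_map J f| = `|f|.
Proof.
have [[Jm Jl Jr] _] := J_ess.
have rn : forall b, `|hom_r J b| = `|b|.
  apply: cstar_hom_isometry (hom_r_hom J) Jr _.
  exact: (@ideal_closed _ _ _ range_ideal rho rho).
have ln : forall a, `|hom_l J a| = `|a|.
  apply: cstar_hom_isometry (hom_l_hom J) Jl _.
  exact: (@ideal_closed _ _ _ range_ideal sigma sigma).
have mn (psi : M) : `|J psi| = `|psi|.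
  apply/eqP; rewrite -(@eqrXn2 _ 2)//.
  by rewrite !ip_norm -hom_ip rn.
by case: x y f => [] [] f /=; [exact: rn|exact: mn|exact: mn|exact: ln].
Qed.

Let pull_ex x y (m : lk_arrow M' x y) w (f : lk_arrow M w x) :
  exists g, j g = m \c j f.
Proof.
have [g _ gE] : range (@lk_map _ _ _ _ _ _ _ J w y) (m \c j f).
  by apply: (ideal_compl range_ideal m); exists f.
by exists g.
Qed.

Let push_ex x y (m : lk_arrow M' x y) z (g : lk_arrow M y z) :
  exists f, j f = j g \c m.
Proof.
have [f _ fE] : range (@lk_map _ _ _ _ _ _ _ J x z) (j g \c m).
  by apply: (ideal_compr range_ideal m); exists g.
by exists f.
Qed.

(** Since [j] is injective, the chosen preimages are the only ones, and identities between them can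
    be checked after applying [lk_map J]. *)
Let pull x y m w f := projT1 (cid (@pull_ex x y m w f)).
Let push x y m z g := projT1 (cid (@push_ex x y m z g)).

Let pullE x y (m : lk_arrow M' x y) w (f : lk_arrow M w x) : j (pull m f) = m \c j f.
Proof. by rewrite /pull; case: cid. Qed.

Let pushE x y (m : lk_arrow M' x y) z (g : lk_arrow M y z) : j (push m g) = j g \c m.
Proof. by rewrite /push; case: cid. Qed.

Fact pull_push x y (m : lk_arrow M' x y) w z (g : lk_arrow M y z)
    (f : lk_arrow M w x) :
  g \c pull m f = push m g \c f.
Proof.
apply: lk_map_inj; rewrite !lk_map_comp -/(j (pull m f)) -/(j (push m g)).
by rewrite pullE pushE lk_compA.
Qed.

Fact pull_bound x y (m : lk_arrow M' x y) : exists2 k : R[i], 0 <= k &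
  forall w (f : lk_arrow M w x), `|pull m f| <= k * `|f|.
Proof.
exists `|m| => // w f; rewrite -lk_map_norm -/(j (pull m f)) pullE.
by rewrite (le_trans (lk_norm_comp _ _))// lk_map_norm.
Qed.

Definition ma_pull x y (m : lk_arrow M' x y) : mult_arrow M x y :=
  MultArrow (pull_push m) (pull_bound m).

Lemma maL_pull x y (m : lk_arrow M' x y) w (f : lk_arrow M w x) :
  lk_map J (maL (ma_pull m) f) = m \c lk_map J f.
Proof. exact: pullE. Qed.

Lemma maR_pull x y (m : lk_arrow M' x y) z (g : lk_arrow M y z) :
  lk_map J (maR (ma_pull m) g) = lk_map J g \c m.
Proof. exact: pushE. Qed.

Lemma ma_pullP x y k (m n : lk_arrow M' x y) :
  ma_pull (k *: m + n) = k *: ma_pull m + ma_pull n.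
Proof.
apply: ma_eq => w f; apply: lk_map_inj.
by rewrite maL_pull lk_mapP !maL_pull lk_compPl.
Qed.

Lemma ma_pull_comp x y z (m : lk_arrow M' y z) (n : lk_arrow M' x y) :
  ma_pull (m \c n) = ma_comp (ma_pull m) (ma_pull n).
Proof.
apply: ma_eq => w f; apply: lk_map_inj.
by rewrite maL_pull [RHS]maL_pull maL_pull lk_compA.
Qed.

Lemma ma_pull_star x y (m : lk_arrow M' x y) :
  ma_pull (lk_star m) = ma_star (ma_pull m).
Proof.
apply: ma_eq => w f; apply: lk_map_inj.
rewrite maL_pull -[LHS]lk_starK lk_star_comp lk_starK -lk_map_star.
by rewrite -maR_pull -lk_map_star.
Qed.

Lemma ma_pull_norm x y (m : lk_arrow M' x y) : `|ma_pull m| <= `|m|.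
Proof.
apply: ma_norm_le => // w f; rewrite -lk_map_norm maL_pull.
by rewrite (le_trans (lk_norm_comp _ _))// lk_map_norm.
Qed.

Lemma ma_pull_map x y (f : lk_arrow M x y) : ma_pull (lk_map J f) = ma_incl f.
Proof.
apply: ma_eq => w g; apply: lk_map_inj.
by rewrite maL_pull lk_map_comp.
Qed.

(** The star exchanges the two one-sided conditions, so imposing both makes the family stable under
    it. *)
Let annihilator : arrow_sets (linking M') := fun x y => [set m : lk_arrow M' x y |
  (forall w (f : lk_arrow M w x), m \c lk_map J f = 0) /\
  (forall z (g : lk_arrow M y z), lk_map J g \c m = 0)].

Lemma annihilator_ideal : cat_ideal annihilator.
Proof.
split.
- by move=> x y; split=> *; rewrite ?lk_comp0l ?lk_comp0r.
- move=> x y k m n [ml mr] [nl nr]; split=> [w f|z g].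
    by rewrite lk_compPl ml nl scaler0 addr0.
  by rewrite lk_compPr mr nr scaler0 addr0.
- move=> x y; apply: closed_normP => m mP; split=> [w f|z g].
    apply: (@norm_small0 _ _ _ `|lk_map J f|) => // e e0.
    have [n [nl _] mn] := mP e e0; rewrite -[_ \c _]subr0 -(nl w f) -lk_compBl.
    by rewrite (le_trans (lk_norm_comp _ _))// mulrC ler_wpM2l// ltW.
  apply: (@norm_small0 _ _ _ `|lk_map J g|) => // e e0.
  have [n [_ nr] mn] := mP e e0; rewrite -[_ \c _]subr0 -(nr z g) -lk_compBr.
  by rewrite (le_trans (lk_norm_comp _ _))// ler_wpM2l// ltW.
- move=> x y m [ml mr]; split=> [w f|z g] /=.
    rewrite -[LHS]lk_starK lk_star_comp lk_starK -lk_map_star mr.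
    by apply/eqP; rewrite -normr_eq0 lk_norm_star normr0.
  rewrite -[LHS]lk_starK lk_star_comp lk_starK -lk_map_star ml.
  by apply/eqP; rewrite -normr_eq0 lk_norm_star normr0.
- move=> x y z m n [nl nr]; split=> [w f|v g] /=.
    by rewrite -lk_compA nl lk_comp0r.
  by rewrite lk_compA -maR_pull nr.
- move=> x y z m n [ml mr]; split=> [w f|v g] /=.
    by rewrite -lk_compA -maL_pull ml.
  by rewrite lk_compA mr lk_comp0l.
Qed.

Lemma ma_pull_inj x y : injective (@ma_pull x y).
Proof.
move=> m n mn; apply: contrapT => /eqP mn0.
have [l lE] : exists l, l = m - n by exists (m - n).
have pl : ma_pull l = 0.
  by rewrite lE addrC -scaleN1r ma_pullP mn scaleN1r addNr.
have map0 u v : lk_map J (0 : lk_arrow M u v) = 0.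
  by apply/eqP; rewrite -normr_eq0 lk_map_norm normr0.
have ll : annihilator l.
  by split=> [w f|z g]; rewrite -?maL_pull -?maR_pull pl; exact: map0.
have [|u [v [f [[g _ gf] [fl fr]] f0]]] := J_ess.2.2 _ annihilator_ideal.
  by exists x, y, l => //; rewrite lE subr_eq0.
(* [f] is the image of [g] and also annihilates the image of [lk_star g], which is [f^*]; hence
   [|f|^2 = |f f^*| = 0]. *)
move/eqP: f0; apply; apply/eqP; rewrite -normr_eq0 -lk_norm_star -sqrf_eq0.
by rewrite -lk_cstar_norm lk_starK -gf -lk_map_star gf fl normr0.
Qed.

Definition universal_hom : biHilbertHom M' (mult_bimodule M) :=
  functor_hom ma_pullP ma_pull_comp ma_pull_star ma_pull_norm.

Lemma universal_hom_mono : bimod_mono universal_hom.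
Proof. by apply: functor_mono => x y; exact: ma_pull_inj. Qed.

Lemma universal_hom_extends x y (f : lk_arrow M x y) :
  lk_map universal_hom (lk_map J f) = lk_map (mult_embedding M) f.
Proof.
by apply: ma_of_inj; rewrite ma_of_functor ma_pull_map ma_of_embedding.
Qed.

End Universal.

Theorem corollary2p3 (R : realType) (A B : cstarAlgType R)
    (M : biHilbert A B) :
  exists (MM : biHilbert (multiplier A) (multiplier B))
         (I : biHilbertHom M MM),
    hom_l I =1 @mult_incl R A /\ hom_r I =1 @mult_incl R B /\
    bimod_mono I /\ essential_embedding I /\
    forall (A' B' : cstarAlgType R) (M' : biHilbert A' B') (eA : A') (eB : B')
           (J : biHilbertHom M M'),
      is_unit eA -> is_unit eB -> acts_unitally M' eA eB ->
      essential_embedding J ->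
      exists I' : biHilbertHom M' MM,
        bimod_mono I' /\
        (forall psi : M, hom_mod I' (hom_mod J psi) = hom_mod I psi) /\
        (forall a : A, hom_l I' (hom_l J a) = hom_l I a) /\
        (forall b : B, hom_r I' (hom_r J b) = hom_r I b).
Proof.
exists (mult_bimodule M), (mult_embedding M).
split; first by move=> a; exact: mult_eql.
split; first by move=> b; exact: mult_eql.
split; first exact: mult_embedding_mono.
split; first exact: mult_embedding_essential.
move=> A' B' M' eA eB J _ _ _ J_ess; exists (universal_hom J_ess).
split; first exact: universal_hom_mono.
split; first exact: (@universal_hom_extends _ _ _ _ _ _ _ _ J_ess rho sigma).
split; first exact: (@universal_hom_extends _ _ _ _ _ _ _ _ J_ess sigma sigma).
exact: (@universal_hom_extends _ _ _ _ _ _ _ _ J_ess rho rho).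
Qed.
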